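(* The action with harmonic term $$S(\phi)=\int dx\Big(\tfrac12(\partial_\mu\phi)\star_\theta(\partial_\mu\phi)+\tfrac{\Omega^2}2(\widetilde x_\mu\phi)\star_\theta(\widetilde x_\mu\phi)+\tfrac{M^2}2\phi\star_\theta\phi+\lambda\,\phi\star_\theta\phi\star_\theta\phi\star_\theta\phi\Big)$$ can be expressed in terms of the deformed product $\star$ of $\mathbb R^{m|1}$ and of the trace $\mathrm{tr}$: $$S(\phi)=\mathrm{tr}\Big(\tfrac12\sum_\mu\big|[-\tfrac i2\widetilde x_\mu\eta,\phi\eta]_\star\big|^2+\tfrac{M^2}2|\phi\eta|^2+\lambda\,|(\phi\eta)\star(\phi\eta)|^2\Big),$$ up to a redefinition of the parameters, and with $\eta=a+b\xi$, $a,b\in\mathbb R$.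
   Context: $m$ is even and $\theta=1/a_0$ with $a_0$ a nonzero real number. Moyal product on $\mathbb R^m$: $(f\star_\theta g)(x)=\frac1{(\pi\theta)^m}\int dy\,dz\,f(y)g(z)e^{\frac{2i}\theta(\omega(x,y)+\omega(y,z)+\omega(z,x))}$, $\omega$ the standard symplectic form, extended to functions such as polynomials; $\widetilde x_\mu$ are the linear functions given by $\widetilde x=\frac2\theta\omega(x,\cdot)$, for which $\partial_\mu\phi=[-\frac i2\widetilde x_\mu,\phi]_{\star_\theta}$ (commutator for $\star_\theta$). Repeated indices $\mu=1,\dots,m$ are summed. The field $\phi$ is a real field on $\mathbb R^m$, $\phi\in\mathcal D_{L^1}(\mathbb R^m)$ (smooth functions all of whose derivatives are in $L^1$). $\Omega$, $M$, $\lambda$ are the parameters of the theory. Superfunctions on $\mathbb R^{m|1}$ are $f(x,\xi)=f_0(x)+f_1(x)\xi$ with $\xi$ odd, $\xi^2=0$. The deformed product, with a real parameter $\alpha\notin\{-1,0\}$, is $$(f\star g)(x,\xi)=(f_0\star_\theta g_0)(x)+\frac{i\alpha\theta}{(1+\alpha)^2}(f_1\star_\theta g_1)(x)+\big((f_0\star_\theta g_1)(x)+(f_1\star_\theta g_0)(x)\big)\xi .$$ $[f,g]_\star$ is the graded commutator, $[f,g]_\star=f\star g-(-1)^{|f||g|}g\star f$ for homogeneous $f,g$ (functions of $x$ alone even, multiples of $\xi$ odd), extended bilinearly. $|f|^2=\overline f\cdot f$ is the undeformed pointwise product of superfunctions, with $\overline f=\overline{f_0}+\overline{f_1}\xi$.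 The trace is $\mathrm{tr}(f)=\int_{\mathbb R^m}dx\,f(x,0)=\int dx\,f_0(x)$.
   Formalization: The field φ is additionally assumed to have an integrable action density, i.e. S(φ) converges as a Lebesgue integral; for φ merely in D_{L^1} the harmonic term with x̃_μφ can make S(φ) undefined. *)

(* Defs.v *)
From HB Require Import structures.
From mathcomp Require Import all_boot all_order all_algebra.
From mathcomp Require Import complex.
From mathcomp Require Import all_classical all_reals all_analysis.

Set Implicit Arguments.
Unset Strict Implicit.
Unset Printing Implicit Defensive.
Import Order.TTheory GRing.Theory Num.Theory.
Import numFieldNormedType.Exports.
Local Open Scope classical_set_scope.
Local Open Scope ring_scope.

Section lebesgue_step.
Context (R : realType) (n : nat).
Local Notation RR := (measurableTypeR R).
Variable mu : {sigma_finite_measure set (n.-tuple RR) -> \bar R}.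

Definition tcons (p : RR * n.-tuple RR) : n.+1.-tuple RR :=
  [tuple of p.1 :: p.2].

Lemma measurable_tcons : measurable_fun [set: RR * n.-tuple RR] tcons.
Proof. by apply: measurable_cons. Qed.

Definition lebesgue_cons : set (n.+1.-tuple RR) -> \bar R :=
  pushforward (lebesgue_measure \x mu)%E tcons.

Let lebesgue_cons0 : lebesgue_cons set0 = 0%E.
Proof. by rewrite /lebesgue_cons /pushforward preimage_set0 measure0. Qed.

Let lebesgue_cons_ge0 A : (0 <= lebesgue_cons A)%E.
Proof. exact: measure_ge0 (lebesgue_measure \x mu)%E _. Qed.

Let lebesgue_cons_sigma_additive : semi_sigma_additive lebesgue_cons.
Proof.
move=> F mF tF mUF; rewrite /lebesgue_cons /pushforward preimage_bigcup.
apply: (@measure_semi_sigma_additive _ _ _ (lebesgue_measure \x mu)%E).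
- by move=> k; rewrite -[X in measurable X]setTI; exact: measurable_tcons.
- apply/trivIsetP => /= i j _ _ ij; rewrite -preimage_setI.
  by move/trivIsetP : tF => /(_ _ _ _ _ ij) ->//; rewrite preimage_set0.
- by rewrite -preimage_bigcup -[X in measurable X]setTI; exact: measurable_tcons.
Qed.

HB.instance Definition _ := isMeasure.Build _ _ _ lebesgue_cons
  lebesgue_cons0 lebesgue_cons_ge0 lebesgue_cons_sigma_additive.

Let lebesgue_cons_sigma_finite : sigma_finite setT lebesgue_cons.
Proof.
have /sigma_finiteP[F [TF ndF Foo]] := sigma_finiteT (@lebesgue_measure R).
have /sigma_finiteP[G [TG ndG Goo]] := sigma_finiteT mu.
pose uncons (t : n.+1.-tuple RR) : RR * n.-tuple RR :=
  (tnth t ord0, [tuple of behead t]).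
have unconsK : cancel tcons uncons.
  by case=> x t; congr pair; exact/val_inj.
have m_uncons : measurable_fun [set: n.+1.-tuple RR] uncons.
  apply/measurable_fun_pairP; split; first exact: measurable_tnth.
  exact: measurable_behead.
exists (fun k => uncons @^-1` (F k `*` G k)) => [|k].
  rewrite -preimage_bigcup (_ : \bigcup_i _ = setT) ?preimage_setT//.
  apply/seteqP; split=> // -[x y] _.
  have [i _ Fix] : (\bigcup_i F i) x by rewrite -TF.
  have [j _ Gjy] : (\bigcup_i G i) y by rewrite -TG.
  exists (maxn i j) => //; split=> /=.
    by move: x Fix; exact/subsetPset/ndF/leq_maxl.
  by move: y Gjy; exact/subsetPset/ndG/leq_maxr.
have [? ?] := Foo k; have [? ?] := Goo k; split.
  by rewrite -[X in measurable X]setTI; apply: m_uncons => //; exact: measurableX.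
rewrite /lebesgue_cons /pushforward -comp_preimage.
rewrite (_ : uncons \o tcons = id); last by apply/funext => p; exact: unconsK.
by rewrite preimage_id product_measure1E// lte_mul_pinfty// ge0_fin_numE.
Qed.

HB.instance Definition _ := @Measure_isSigmaFinite.Build _ _ _ lebesgue_cons
  lebesgue_cons_sigma_finite.

End lebesgue_step.

Fixpoint lebesgue_tuple (R : realType) (n : nat) :
    {sigma_finite_measure set (n.-tuple (measurableTypeR R)) -> \bar R} :=
  match n with
  | 0 => dirac ([tuple] : 0.-tuple (measurableTypeR R))
  | k.+1 => lebesgue_cons (lebesgue_tuple R k)
  end.

(* Points of R^n are row vectors: this type carries the norm and the derivatives
   of the library, while [n.-tuple R] carries its product sigma-algebra. *)
Definition rv_of_tuple (R : realType) (n : nat)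
  (t : n.-tuple (measurableTypeR R)) : 'rV[R]_n := \row_i tnth t i.

Section complex_integral.
Context d (T : measurableType d) (R : realType).
Variable mu : {measure set T -> \bar R}.

Definition Cintegrable (f : T -> R[i]) : Prop :=
  mu.-integrable setT (fun x => (complex.Re (f x))%:E) /\
  mu.-integrable setT (fun x => (complex.Im (f x))%:E).

Definition Cintegral (f : T -> R[i]) : R[i] :=
  Complex (\int[mu]_x complex.Re (f x)) (\int[mu]_x complex.Im (f x)).

End complex_integral.

Section functions_on_Rn.
Context (R : realType) (n : nat).

Definition integrableRn (f : 'rV[R]_n -> R[i]) : Prop :=
  Cintegrable (lebesgue_tuple R n) (f \o @rv_of_tuple R n).

Definition integralRn (f : 'rV[R]_n -> R[i]) : R[i] :=
  Cintegral (lebesgue_tuple R n) (f \o @rv_of_tuple R n).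

Definition partial (mu : 'I_n) (f : 'rV[R]_n -> R) : 'rV[R]_n -> R :=
  fun x => 'D_(delta_mx 0 mu) f x.

(* A function is smooth iff all its iterated partial derivatives exist and are
   (Frechet) differentiable everywhere. *)
Definition D_L1 (f : 'rV[R]_n -> R) : Prop :=
  forall s : seq 'I_n,
    (forall x, differentiable (foldr partial f s) x) /\
    (lebesgue_tuple R n).-integrable setT
      (fun t => (foldr partial f s (rv_of_tuple t))%:E).

Definition sqnorm (x : 'rV[R]_n) : R := \sum_i (x 0 i) ^+ 2.

Definition toC (f : 'rV[R]_n -> R) : 'rV[R]_n -> R[i] :=
  fun x => real_complex R (f x).

End functions_on_Rn.

Section moyal.
Context (R : realType) (k : nat).
Local Notation m := (k + k)%N.

(* The even dimension is m = k + k; the first k coordinates are conjugate to the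
   last k ones. *)
Definition omega (x y : 'rV[R]_m) : R :=
  \sum_(i < k) (x 0 (lshift k i) * y 0 (rshift k i) -
                x 0 (rshift k i) * y 0 (lshift k i)).

Definition expi (t : R) : R[i] := Complex (cos t) (sin t).

(* The double integral defining the Moyal product, with its integrand damped by
   a Gaussian of parameter [eps]. *)
Definition moyal_reg (theta eps : R) (f g : 'rV[R]_m -> R[i])
    (x : 'rV[R]_m) : R[i] :=
  real_complex R (((pi * theta) ^+ m)^-1) *
  Cintegral (lebesgue_tuple R m \x lebesgue_tuple R m)%E (fun p =>
    let y := rv_of_tuple p.1 in
    let z := rv_of_tuple p.2 in
    real_complex R (expR (- eps * (sqnorm y + sqnorm z))) *
    (f y * g z * expi (2 / theta * (omega x y + omega y z + omega z x)))).

(* The oscillatory integral is the limit of the damped ones.  When [f] and [g]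
   are integrable this is the plain Lebesgue integral, by dominated convergence;
   the limit also covers functions of polynomial growth, such as [xtilde] and
   [xtilde * phi] with [phi] in [D_L1]. *)
Definition moyal (theta : R) (f g : 'rV[R]_m -> R[i]) : 'rV[R]_m -> R[i] :=
  fun x =>
    Complex (lim (complex.Re (moyal_reg theta eps f g x) @[eps --> 0^'+]))
            (lim (complex.Im (moyal_reg theta eps f g x) @[eps --> 0^'+])).

Definition xtilde (theta : R) (mu : 'I_m) : 'rV[R]_m -> R :=
  fun x => 2 / theta * omega x (delta_mx 0 mu).

End moyal.

Notation "f ⋆[ theta ] g" := (moyal theta f g)
  (at level 40, left associativity, format "f  ⋆[ theta ]  g").

Section superfunctions.
Context (R : realType) (k : nat).
Local Notation m := (k + k)%N.

(* [f : superfun] stands for f.1(x) + f.2(x) xi, with xi odd and xi^2 = 0 *)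
Definition superfun : Type :=
  (('rV[R]_m -> R[i]) * ('rV[R]_m -> R[i]))%type.

Definition even_fun (f : 'rV[R]_m -> R[i]) : superfun := (f, 0).

Definition superconst (a b : R) : superfun :=
  (toC (cst a), toC (cst b)).

Definition super_mul (f g : superfun) : superfun :=
  (f.1 * g.1, f.1 * g.2 + f.2 * g.1).

Definition super_conj (f : superfun) : superfun :=
  (fun x => conjc (f.1 x), fun x => conjc (f.2 x)).

Definition super_abs2 (f : superfun) : superfun := super_mul (super_conj f) f.

Definition super_star (theta alpha : R) (f g : superfun) : superfun :=
  (f.1 ⋆[theta] g.1 +
     Complex 0 (alpha * theta / (1 + alpha) ^+ 2) *: (f.2 ⋆[theta] g.2),
   f.1 ⋆[theta] g.2 + f.2 ⋆[theta] g.1).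

Definition super_even (f : superfun) : superfun := (f.1, 0).

Definition super_odd (f : superfun) : superfun := (0, f.2).

(* graded commutator of homogeneous [f] and [g] of parities [p] and [q] *)
Definition super_hcomm (theta alpha : R) (p q : bool) (f g : superfun) :
    superfun :=
  super_star theta alpha f g - (-1) ^+ (p && q) *: super_star theta alpha g f.

Definition super_comm (theta alpha : R) (f g : superfun) : superfun :=
  super_hcomm theta alpha false false (super_even f) (super_even g) +
  super_hcomm theta alpha false true (super_even f) (super_odd g) +
  super_hcomm theta alpha true false (super_odd f) (super_even g) +
  super_hcomm theta alpha true true (super_odd f) (super_odd g).

Definition supertrace (f : superfun) : R[i] := integralRn f.1.

End superfunctions.

Section actions.
Context (R : realType) (k : nat).
Local Notation m := (k + k)%N.
Local Notation "r %:C" := (real_complex R r).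

(* For [phi] in [D_L1] every term below is integrable, except possibly the
   harmonic one: [xtilde * phi] need not even be square-integrable.  Finiteness
   of the action is therefore a separate condition,
   [integrableRn (harmonic_density theta Omega M lambda phi)]. *)
Definition harmonic_density (theta Omega M lambda : R) (phi : 'rV[R]_m -> R) :
    'rV[R]_m -> R[i] :=
  let phiC := toC phi in
  let dphi mu := toC (partial mu phi) in
  let xphi mu := toC (xtilde theta mu) * phiC in
  \sum_(mu < m) (1 / 2)%:C *: (dphi mu ⋆[theta] dphi mu) +
  \sum_(mu < m) (Omega ^+ 2 / 2)%:C *: (xphi mu ⋆[theta] xphi mu) +
  (M ^+ 2 / 2)%:C *: (phiC ⋆[theta] phiC) +
  lambda%:C *: (phiC ⋆[theta] phiC ⋆[theta] phiC ⋆[theta] phiC).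

Definition harmonic_action (theta Omega M lambda : R) (phi : 'rV[R]_m -> R) :
    R[i] :=
  integralRn (harmonic_density theta Omega M lambda phi).

Definition super_density (theta alpha : R) (eta : superfun R k) (M lambda : R)
    (phi : 'rV[R]_m -> R) : superfun R k :=
  let phieta := super_mul (even_fun (toC phi)) eta in
  let xeta mu := super_mul (even_fun (toC (xtilde theta mu))) eta in
  (1 / 2)%:C *: (\sum_(mu < m)
     super_abs2 (super_comm theta alpha (Complex 0 (- 1 / 2) *: xeta mu) phieta)) +
  (M ^+ 2 / 2)%:C *: super_abs2 phieta +
  lambda%:C *: super_abs2 (super_star theta alpha phieta phieta).

End actions.

(* Main.v *)
Require Import Defs.
From HB Require Import structures.
From mathcomp Require Import all_boot all_order all_algebra.
From mathcomp Require Import complex.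
From mathcomp Require Import all_classical all_reals all_analysis.
From mathcomp Require Import measurable_realfun ring lra.
Import Order.TTheory GRing.Theory Num.Theory.
Import numFieldNormedType.Exports.
Local Open Scope classical_set_scope.
Local Open Scope ring_scope.

Set Implicit Arguments.
Unset Strict Implicit.
Unset Printing Implicit Defensive.

(** With [eta = 1 + b xi], the graded commutator of [- i/2 xtilde eta] and
    [phi eta] has even part [d phi + kappa xtilde phi], where
    [kappa = b^2 alpha theta / (1 + alpha)^2]: the even-even commutator gives the
    derivative, and the odd-odd anticommutator gives [xtilde phi].  Likewise the
    even part of [(phi eta) * (phi eta)] is [(1 + i kappa) phi * phi].  One takes
    [kappa^2 = Omega^2] and [lambda' = lambda / (1 + Omega^2)]; the cross terms
    [xtilde phi d phi] are derivatives of [xtilde phi^2 / 2] and integrate to 0,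
    and the quartic terms agree by the trace property of the Moyal product.

    What remains is to replace Moyal squares by pointwise squares under the
    integral, although [xtilde phi] need not be integrable.  For a real
    integrable [f], the pairing of [f * f] with a suitable Gaussian equals the
    squared L2 norm of [f * g], where [g] is another Gaussian.  Fatou's lemma,
    first as the damping of [f] is removed and then as [g] tends to 1, shows that
    if a sum of Moyal squares is integrable then each function is square
    integrable, with one inequality between the integrals.  The reverse inequality holds
    because [f |-> f * g] is a contraction of L2, being dominated by the
    convolution with a heat kernel. *)

(** The obstacle is that [moyal] is a limit of Gaussian-damped integrals, taken here at functions
    such as [xtilde * phi] that may fail to be integrable, while the hypothesis controls only the
    whole density and not its separate terms. Moyal squares have no pointwise sign, so the sum
    cannot be split directly. Gaussians serve three purposes: they are the damping of the
    definition; they form an approximate unit of the star product, which plays the part of Fourier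
    inversion; and composing two of them gives a multiple of a third, which is what makes a square
    norm appear. For [phi] itself, decay comes from integrating by parts with [1 - d_i^2] in each
    variable, so that [f |-> f * phi] preserves integrability and the quartic term can be treated
    apart from the quadratic ones. Taking the even part of [eta] equal to 1 leaves [M] unchanged.
    After integration only [kappa^2] survives, so the sign of [alpha * theta] puts no constraint on
    [b]. *)

Local Notation Rintegrable mu f := (mu.-integrable setT (EFin \o f)).

(** * Real and complex integrals *)

Section real_integral.
Context d (T : measurableType d) (R : realType) (mu : {measure set T -> \bar R}).
Implicit Types f g : T -> R.

Lemma integrable_measurable f :
  Rintegrable mu f -> measurable_fun setT f.
Proof. by move=> /measurable_int/measurable_EFinP. Qed.

Lemma le_EFin_integrable f g : measurable_fun setT f ->
  Rintegrable mu g -> (forall x, `|f x| <= g x) ->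
  Rintegrable mu f.
Proof.
move=> mf ig fg; apply: le_integrable ig => //; first exact/measurable_EFinP.
by move=> x _ /=; rewrite lee_fin (le_trans (fg x))// ler_norm.
Qed.

Lemma EFin_integrableD f g : Rintegrable mu f ->
  Rintegrable mu g ->
  Rintegrable mu (fun x => f x + g x).
Proof. by move=> fi gi; have := integrableD measurableT fi gi. Qed.

Lemma EFin_integrableZ (r : R) f : Rintegrable mu f ->
  Rintegrable mu (fun x => r * f x).
Proof. by move=> fi; have := integrableZl measurableT r fi. Qed.

Lemma EFin_integrable_sum (I : eqType) (s : seq I) (f : I -> T -> R) :
  (forall i, i \in s -> Rintegrable mu (f i)) ->
  Rintegrable mu (fun x => \sum_(i <- s) f i x).
Proof.
elim: s => [|i s ih] fi.
  rewrite (_ : EFin \o _ = cst 0%E); first exact: integrable0.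
  by apply/funext => x /=; rewrite big_nil.
rewrite (_ : EFin \o _ = EFin \o (fun x => f i x + \sum_(i <- s) f i x)).
  apply: EFin_integrableD; first by apply: fi; rewrite mem_head.
  by apply: ih => j js; apply: fi; rewrite inE js orbT.
by apply/funext => x /=; rewrite big_cons.
Qed.

Lemma Rintegral_sumE (I : eqType) (s : seq I) (f : I -> T -> R) :
  (forall i, i \in s -> Rintegrable mu (f i)) ->
  \int[mu]_x (\sum_(i <- s) f i x) = \sum_(i <- s) \int[mu]_x f i x.
Proof.
elim: s => [|i s ih] fi.
  rewrite big_nil (_ : (fun x => _) = cst 0) ?Rintegral_cst ?mul0r//.
  by apply/funext => x /=; rewrite big_nil.
have fis j : j \in s -> Rintegrable mu (f j).
  by move=> js; apply: fi; rewrite inE js orbT.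
rewrite big_cons -ih// -RintegralD//.
- by apply: eq_Rintegral => x _; rewrite big_cons.
- by apply: fi; rewrite mem_head.
- exact: EFin_integrable_sum.
Qed.

Lemma EFin_Rintegral f : Rintegrable mu f ->
  (\int[mu]_x f x)%:E = (\int[mu]_x (f x)%:E)%E.
Proof. by move=> fi; rewrite /Rintegral fineK//; exact: integrable_fin_num. Qed.

Lemma ge0_EFin_integrable f : measurable_fun setT f -> (forall x, 0 <= f x) ->
  (\int[mu]_x (f x)%:E < +oo)%E -> Rintegrable mu f.
Proof.
move=> mf f0 foo; apply/integrableP; split; first exact/measurable_EFinP.
by under eq_integral do rewrite /= ger0_norm//.
Qed.

Lemma Rintegral_dct (f_ : nat -> T -> R) f g :
  (forall n, measurable_fun setT (f_ n)) ->
  Rintegrable mu g ->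
  (forall n x, `|f_ n x| <= g x) ->
  (forall x, f_ n x @[n --> \oo] --> f x) ->
  Rintegrable mu f /\
  (\int[mu]_x f_ n x) @[n --> \oo] --> \int[mu]_x f x.
Proof.
move=> mf_ ig fg ff.
have mf : measurable_fun setT f.
  by apply: (@measurable_fun_cvg _ _ _ _ f_) => // x _; exact: ff.
have [] := @dominated_convergence _ _ _ mu _ measurableT
  (fun n => EFin \o f_ n) (EFin \o f) (EFin \o g).
- by move=> n; exact/measurable_EFinP.
- exact/measurable_EFinP.
- by apply: aeW => x _ /=; apply/cvg_EFin; [exact: nearW|exact: ff].
- exact: ig.
- by apply: aeW => x n _ /=; rewrite lee_fin.
move=> fi _ cf; split=> //.
apply: (@fine_cvg _ _ _ _ (fun n => \int[mu]_x (f_ n x)%:E)%E).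
by rewrite EFin_Rintegral.
Qed.

(** Fatou's lemma with integrability of the limit in the conclusion: it is through this form that
    square integrability is obtained rather than assumed. *)
Lemma Rintegral_fatou (f_ : nat -> T -> R) f (a_ : nat -> R) (a : R) :
  (forall n, Rintegrable mu (f_ n)) ->
  (forall n x, 0 <= f_ n x) ->
  (forall n, \int[mu]_x f_ n x <= a_ n) -> a_ n @[n --> \oo] --> a ->
  (forall x, f_ n x @[n --> \oo] --> f x) ->
  Rintegrable mu f /\ \int[mu]_x f x <= a.
Proof.
move=> fi f0 fa aa ff.
have mf : measurable_fun setT f.
  by apply: (@measurable_fun_cvg _ _ _ _ f_) => // n; exact: integrable_measurable.
have ge0 x : 0 <= f x.
  rewrite -(cvg_lim (@Rhausdorff R) (ff x)); apply: limr_ge; first exact: cvgP (ff x).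
  exact: nearW.
have le : (\int[mu]_x (f x)%:E <= a%:E)%E.
  have := @fatou _ _ _ mu _ measurableT (fun n => EFin \o f_ n).
  move=> /(_ (fun n => measurable_int _ (fi n)) (fun n x _ => f0 n x)) H.
  rewrite (eq_integral (fun x => (f x)%:E)) in H; last first.
    move=> x _; have /cvg_limn_einf_sup[-> _] // : (EFin \o f_^~ x) n @[n --> \oo] --> (f x)%:E.
    by apply/cvg_EFin; [exact: nearW|exact: ff].
  apply: (le_trans H).
  rewrite limn_einf_lim.
  have -> : a%:E = limn (EFin \o a_).
    by apply/esym/cvg_lim => //; apply/cvg_EFin; [exact: nearW|exact: aa].
  apply: lee_lim; first exact: is_cvg_einfs.
    by apply: cvgP; apply/cvg_EFin; [exact: nearW|exact: aa].
  apply: nearW => n; apply: (@le_trans _ _ (\int[mu]_x (f_ n x)%:E)%E).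
    by apply: ereal_inf_lbound; exists n => /=.
  by rewrite -EFin_Rintegral// lee_fin.
split; first by apply: ge0_EFin_integrable => //; rewrite (le_lt_trans le)// ltry.
rewrite -lee_fin EFin_Rintegral//.
by apply: ge0_EFin_integrable => //; rewrite (le_lt_trans le)// ltry.
Qed.

End real_integral.

(** * Complex numbers through real and imaginary parts *)

Section complex_numbers.
Context (R : realType).
Implicit Types (z w : R[i]) (t s r : R).
Local Notation cnorm := (@Normc.normc R).

Lemma ReM z w :
  complex.Re (z * w) = complex.Re z * complex.Re w - complex.Im z * complex.Im w.
Proof. by case: z w => [a b] [c d]. Qed.

Lemma ImM z w :
  complex.Im (z * w) = complex.Re z * complex.Im w + complex.Im z * complex.Re w.
Proof. by case: z w => [a b] [c d]. Qed.

Lemma ReD z w : complex.Re (z + w) = complex.Re z + complex.Re w.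
Proof. by case: z w => [a b] [c d]. Qed.

Lemma ImD z w : complex.Im (z + w) = complex.Im z + complex.Im w.
Proof. by case: z w => [a b] [c d]. Qed.

Lemma ReB z w : complex.Re (z - w) = complex.Re z - complex.Re w.
Proof. by case: z w => [a b] [c d]. Qed.

Lemma ImB z w : complex.Im (z - w) = complex.Im z - complex.Im w.
Proof. by case: z w => [a b] [c d]. Qed.

Lemma complexP z w :
  complex.Re z = complex.Re w -> complex.Im z = complex.Im w -> z = w.
Proof. by case: z w => [a b] [c d] /= -> ->. Qed.

Lemma ReJ z : complex.Re (conjc z) = complex.Re z.
Proof. by case: z. Qed.

Lemma ImJ z : complex.Im (conjc z) = - complex.Im z.
Proof. by case: z. Qed.

Lemma conjcM z w : conjc (z * w) = conjc z * conjc w.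
Proof. exact: rmorphM. Qed.

Lemma conjcR r : conjc (real_complex R r) = real_complex R r.
Proof. exact: conjc_real. Qed.

Lemma cnorm_sqr z : cnorm z ^+ 2 = complex.Re z ^+ 2 + complex.Im z ^+ 2.
Proof. by case: z => a b /=; rewrite sqr_sqrtr// addr_ge0// sqr_ge0. Qed.

Lemma cnorm_ge0 z : 0 <= cnorm z.
Proof. by case: z => a b /=; exact: sqrtr_ge0. Qed.

Lemma cnormM z w : cnorm (z * w) = cnorm z * cnorm w.
Proof. exact: Normc.normcM. Qed.

Lemma cnormD z w : cnorm (z + w) <= cnorm z + cnorm w.
Proof. exact: le_normcD. Qed.

Lemma cnormN z : cnorm (- z) = cnorm z.
Proof. by case: z => a b /=; rewrite !sqrrN. Qed.

Lemma cnormR r : cnorm (real_complex R r) = `|r|.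
Proof. by rewrite /= expr0n addr0 sqrtr_sqr. Qed.

Lemma cnormJ z : cnorm (conjc z) = cnorm z.
Proof. by case: z => a b /=; rewrite sqrrN. Qed.

Lemma normr_Re_le z : `|complex.Re z| <= cnorm z.
Proof.
rewrite -(ler_pXn2r (n := 2)) ?nnegrE ?cnorm_ge0// cnorm_sqr real_normK ?num_real//.
by rewrite lerDl sqr_ge0.
Qed.

Lemma normr_Im_le z : `|complex.Im z| <= cnorm z.
Proof.
rewrite -(ler_pXn2r (n := 2)) ?nnegrE ?cnorm_ge0// cnorm_sqr real_normK ?num_real//.
by rewrite lerDr sqr_ge0.
Qed.

Lemma cnorm_le z : cnorm z <= `|complex.Re z| + `|complex.Im z|.
Proof.
rewrite -(ler_pXn2r (n := 2)) ?nnegrE ?cnorm_ge0 ?addr_ge0// cnorm_sqr.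
rewrite sqrrD !real_normK ?num_real// -addrA lerD2l lerDr mulrn_wge0//.
Qed.

Lemma mulcJ z : z * conjc z = real_complex R (cnorm z ^+ 2).
Proof.
by rewrite cnorm_sqr; case: z => a b; apply: complexP => /=; ring.
Qed.

Lemma expiD t s : expi (t + s) = expi t * expi s.
Proof.
apply: complexP; rewrite ?ReM ?ImM /= ?cosD ?sinD //; ring.
Qed.

Lemma expi0 : expi (0 : R) = 1.
Proof. by rewrite /expi cos0 sin0. Qed.

Lemma expiN t : expi (- t) = conjc (expi t).
Proof. by rewrite /expi /= cosN sinN. Qed.

Lemma cnorm_expi t : cnorm (expi t) = 1.
Proof. by rewrite /= cos2Dsin2 sqrtr1. Qed.

Lemma mulrzC (a b : R) :
  real_complex R (a * b) = real_complex R a * real_complex R b.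
Proof. exact: rmorphM. Qed.

(** Convergence is split into components because [moyal] and [Cintegral] are themselves defined
    componentwise. *)
Definition ccvg (u : nat -> R[i]) (l : R[i]) : Prop :=
  (complex.Re (u n) @[n --> \oo] --> complex.Re l) /\
  (complex.Im (u n) @[n --> \oo] --> complex.Im l).

Lemma ccvg_cst l : ccvg (fun=> l) l.
Proof. by split; exact: cvg_cst. Qed.

Lemma ccvgD (u v : nat -> R[i]) l l' :
  ccvg u l -> ccvg v l' -> ccvg (fun n => u n + v n) (l + l').
Proof.
move=> [u1 u2] [v1 v2]; split; rewrite ?ReD ?ImD.
  by under eq_cvg do rewrite ReD; exact: cvgD.
by under eq_cvg do rewrite ImD; exact: cvgD.
Qed.

Lemma ccvgM (u v : nat -> R[i]) l l' :
  ccvg u l -> ccvg v l' -> ccvg (fun n => u n * v n) (l * l').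
Proof.
move=> [u1 u2] [v1 v2]; split; rewrite ?ReM ?ImM.
  under eq_cvg do rewrite ReM; apply: cvgB; exact: cvgM.
under eq_cvg do rewrite ImM; apply: cvgD; exact: cvgM.
Qed.

Lemma ccvgR (u : nat -> R) (l : R) :
  u n @[n --> \oo] --> l -> ccvg (fun n => real_complex R (u n)) (real_complex R l).
Proof. by move=> ul; split => //=; exact: cvg_cst. Qed.

Lemma ccvgJ (u : nat -> R[i]) l :
  ccvg u l -> ccvg (fun n => conjc (u n)) (conjc l).
Proof.
move=> [u1 u2]; split; rewrite ?ReJ ?ImJ.
  by under eq_cvg do rewrite ReJ.
by under eq_cvg do rewrite ImJ; exact: cvgN.
Qed.

Lemma ccvgZ z (u : nat -> R[i]) l :
  ccvg u l -> ccvg (fun n => z * u n) (z * l).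
Proof. by move=> ul; apply: ccvgM => //; exact: ccvg_cst. Qed.

Lemma ccvg_unique (u : nat -> R[i]) l l' : ccvg u l -> ccvg u l' -> l = l'.
Proof.
move=> [u1 u2] [v1 v2]; apply: complexP.
  exact: cvg_unique u1 v1.
exact: cvg_unique u2 v2.
Qed.

Lemma cvg_cnorm_sqr (u : nat -> R[i]) l :
  ccvg u l -> cnorm (u n) ^+ 2 @[n --> \oo] --> cnorm l ^+ 2.
Proof.
move=> [u1 u2]; rewrite cnorm_sqr; under eq_cvg do rewrite cnorm_sqr.
by apply: cvgD; rewrite expr2; under eq_cvg do rewrite expr2; exact: cvgM.
Qed.

Lemma squeeze_ccvg (u : nat -> R[i]) l (v : nat -> R) :
  (forall n, cnorm (u n - l) <= v n) -> v n @[n --> \oo] --> (0:R) -> ccvg u l.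
Proof.
move=> uv v0; split; apply/subr_cvg0; apply: norm_cvg0.
  apply: (@squeeze_cvgr _ _ _ _ (cst 0) _ _ _ _ _ v0); last exact: cvg_cst.
  by apply: nearW => n; rewrite normr_ge0/= (le_trans _ (uv n))// -ReB normr_Re_le.
apply: (@squeeze_cvgr _ _ _ _ (cst 0) _ _ _ _ _ v0); last exact: cvg_cst.
by apply: nearW => n; rewrite normr_ge0/= (le_trans _ (uv n))// -ImB normr_Im_le.
Qed.

Lemma ccvg_bounded (u : nat -> R[i]) l (C : R) :
  ccvg u l -> (forall n, cnorm (u n) <= C) -> cnorm l <= C.
Proof.
move=> ul uC.
have C0 : 0 <= C by rewrite (le_trans (cnorm_ge0 (u 0%N))).
rewrite -(ler_pXn2r (n := 2)) ?nnegrE ?cnorm_ge0//.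
have := cvg_cnorm_sqr ul => H; rewrite -(cvg_lim (@Rhausdorff R) H).
apply: limr_le; first exact: cvgP H.
by apply: nearW => n; rewrite ler_pXn2r ?nnegrE ?cnorm_ge0.
Qed.

End complex_numbers.

Section complex_measurable.
Context d (T : measurableType d) (R : realType).
Implicit Types f g : T -> R[i].
Local Notation cnorm := (@Normc.normc R).

Definition Cmeasurable f : Prop :=
  measurable_fun setT (fun x => complex.Re (f x)) /\
  measurable_fun setT (fun x => complex.Im (f x)).

Lemma CmeasurableD f g : Cmeasurable f -> Cmeasurable g ->
  Cmeasurable (fun x => f x + g x).
Proof.
move=> [f1 f2] [g1 g2]; split.
  by under eq_fun do rewrite ReD; exact: measurable_funD.
by under eq_fun do rewrite ImD; exact: measurable_funD.
Qed.

Lemma CmeasurableM f g : Cmeasurable f -> Cmeasurable g ->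
  Cmeasurable (fun x => f x * g x).
Proof.
move=> [f1 f2] [g1 g2]; split.
  by under eq_fun do rewrite ReM; apply: measurable_funB; exact: measurable_funM.
by under eq_fun do rewrite ImM; apply: measurable_funD; exact: measurable_funM.
Qed.

Lemma Cmeasurable_cst z : Cmeasurable (fun=> z).
Proof. by split; exact: measurable_cst. Qed.

Lemma CmeasurableJ f : Cmeasurable f -> Cmeasurable (fun x => conjc (f x)).
Proof.
move=> [f1 f2]; split; first by under eq_fun do rewrite ReJ.
by under eq_fun do rewrite ImJ; exact: measurable_funN.
Qed.

Lemma CmeasurableR (h : T -> R) : measurable_fun setT h ->
  Cmeasurable (fun x => real_complex R (h x)).
Proof. by move=> mh; split => //=; exact: measurable_cst. Qed.

Lemma Cmeasurable_expi (h : T -> R) : measurable_fun setT h ->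
  Cmeasurable (fun x => expi (h x)).
Proof.
move=> mh; split => /=; apply: measurableT_comp mh.
  by apply: continuous_measurable_fun; exact: continuous_cos.
by apply: continuous_measurable_fun; exact: continuous_sin.
Qed.

Lemma measurable_cnorm f : Cmeasurable f -> measurable_fun setT (fun x => cnorm (f x)).
Proof.
move=> [f1 f2].
rewrite (_ : (fun x => _) = (@Num.sqrt R) \o
   (fun x => complex.Re (f x) ^+ 2 + complex.Im (f x) ^+ 2)); last first.
  by apply/funext => x /=; rewrite -cnorm_sqr sqrtr_sqr ger0_norm ?cnorm_ge0.
apply: measurableT_comp.
  by apply: continuous_measurable_fun; exact: sqrt_continuous.
by apply: measurable_funD; exact: measurable_funX.
Qed.

End complex_measurable.

Lemma Cmeasurable_comp d1 d2 (T1 : measurableType d1) (T2 : measurableType d2)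
  (R : realType) (h : T1 -> T2) (f : T2 -> R[i]) :
  measurable_fun setT h -> Cmeasurable f -> Cmeasurable (fun x => f (h x)).
Proof. by move=> mh [f1 f2]; split; [exact: measurableT_comp f1 mh|exact: measurableT_comp f2 mh]. Qed.

(** * Complex-valued integrals *)

Section complex_integral_theory.
Context d (T : measurableType d) (R : realType) (mu : {measure set T -> \bar R}).
Implicit Types f g : T -> R[i].
Local Notation cnorm := (@Normc.normc R).

Lemma Cintegrable_measurable f : Cintegrable mu f -> Cmeasurable f.
Proof. by move=> [f1 f2]; split; [exact: integrable_measurable f1|exact: integrable_measurable f2]. Qed.

Lemma le_Cintegrable f (g : T -> R) : Cmeasurable f ->
  Rintegrable mu g -> (forall x, cnorm (f x) <= g x) ->
  Cintegrable mu f.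
Proof.
move=> [f1 f2] gi fg; split.
  by apply: (le_EFin_integrable f1 gi) => x; rewrite (le_trans (normr_Re_le _)).
by apply: (le_EFin_integrable f2 gi) => x; rewrite (le_trans (normr_Im_le _)).
Qed.

Lemma Cintegrable_cnorm f : Cintegrable mu f ->
  Rintegrable mu (fun x => cnorm (f x)).
Proof.
move=> fi; have mf := Cintegrable_measurable fi; case: fi => f1 f2.
apply: (@le_EFin_integrable _ _ _ mu _ (fun x => `|complex.Re (f x)| + `|complex.Im (f x)|)).
- exact: measurable_cnorm.
- by apply: EFin_integrableD; exact: integrable_norm.
- by move=> x; rewrite ger0_norm ?cnorm_ge0// cnorm_le.
Qed.

Lemma CintegrableR (h : T -> R) : Rintegrable mu h ->
  Cintegrable mu (fun x => real_complex R (h x)).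
Proof. by move=> hi; split => //=; exact: integrable0. Qed.

Lemma CintegrableD f g : Cintegrable mu f -> Cintegrable mu g ->
  Cintegrable mu (fun x => f x + g x).
Proof.
move=> [f1 f2] [g1 g2]; split.
  by under eq_fun do rewrite ReD; exact: EFin_integrableD.
by under eq_fun do rewrite ImD; exact: EFin_integrableD.
Qed.

Lemma CintegrableZ z f : Cintegrable mu f -> Cintegrable mu (fun x => z * f x).
Proof.
move=> fi; apply: (@le_Cintegrable _ (fun x => cnorm z * cnorm (f x))).
- by apply: CmeasurableM; [exact: Cmeasurable_cst|exact: Cintegrable_measurable].
- by apply: EFin_integrableZ; exact: Cintegrable_cnorm.
- by move=> x; rewrite cnormM.
Qed.

Lemma CintegrableJ f : Cintegrable mu f -> Cintegrable mu (fun x => conjc (f x)).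
Proof.
move=> fi; apply: (@le_Cintegrable _ (fun x => cnorm (f x))).
- by apply: CmeasurableJ; exact: Cintegrable_measurable.
- exact: Cintegrable_cnorm.
- by move=> x; rewrite cnormJ.
Qed.

Lemma Cintegrable_sum (I : eqType) (s : seq I) (f : I -> T -> R[i]) :
  (forall i, i \in s -> Cintegrable mu (f i)) ->
  Cintegrable mu (fun x => \sum_(i <- s) f i x).
Proof.
elim: s => [|i s ih] fi.
  rewrite (_ : (fun x => _) = (fun=> real_complex R 0)); first exact: CintegrableR (integrable0 _ _).
  by apply/funext => x; rewrite big_nil.
rewrite (_ : (fun x => _) = (fun x => f i x + \sum_(i <- s) f i x)).
  apply: CintegrableD; first by apply: fi; rewrite mem_head.
  by apply: ih => j js; apply: fi; rewrite inE js orbT.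
by apply/funext => x; rewrite big_cons.
Qed.

Lemma Cintegrable_bM (b : T -> R[i]) f (C : R) : Cmeasurable b ->
  (forall x, cnorm (b x) <= C) -> Cintegrable mu f ->
  Cintegrable mu (fun x => b x * f x).
Proof.
move=> mb bC fi; apply: (@le_Cintegrable _ (fun x => C * cnorm (f x))).
- by apply: CmeasurableM => //; exact: Cintegrable_measurable.
- by apply: EFin_integrableZ; exact: Cintegrable_cnorm.
- by move=> x; rewrite cnormM ler_wpM2r ?cnorm_ge0.
Qed.

Lemma CintegralD f g : Cintegrable mu f -> Cintegrable mu g ->
  Cintegral mu (fun x => f x + g x) = Cintegral mu f + Cintegral mu g.
Proof.
move=> [f1 f2] [g1 g2]; apply: complexP => /=.
  by under eq_Rintegral do rewrite ReD; rewrite RintegralD.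
by under eq_Rintegral do rewrite ImD; rewrite RintegralD.
Qed.

Lemma CintegralZ z f : Cintegrable mu f ->
  Cintegral mu (fun x => z * f x) = z * Cintegral mu f.
Proof.
case: z => a b [f1 f2]; apply: complexP => /=; rewrite ?ReM ?ImM /=.
  under eq_Rintegral do rewrite ReM.
  rewrite RintegralB//; first by rewrite !RintegralZl.
  - exact: EFin_integrableZ.
  - exact: EFin_integrableZ.
under eq_Rintegral do rewrite ImM.
rewrite RintegralD//; first by rewrite !RintegralZl.
- exact: EFin_integrableZ.
- exact: EFin_integrableZ.
Qed.

Lemma CintegralB f g : Cintegrable mu f -> Cintegrable mu g ->
  Cintegral mu (fun x => f x - g x) = Cintegral mu f - Cintegral mu g.
Proof.
move=> fi gi; rewrite -[in RHS]mulN1r -CintegralZ// -CintegralD//.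
  by congr Cintegral; apply/funext => x; rewrite mulN1r.
exact: CintegrableZ.
Qed.

Lemma Cintegral_sum (I : eqType) (s : seq I) (f : I -> T -> R[i]) :
  (forall i, i \in s -> Cintegrable mu (f i)) ->
  Cintegral mu (fun x => \sum_(i <- s) f i x) = \sum_(i <- s) Cintegral mu (f i).
Proof.
elim: s => [|i s ih] fi.
  rewrite big_nil; apply: complexP => /=.
    under eq_Rintegral do rewrite big_nil.
    by rewrite /= (_ : (fun x => _) = cst 0)// Rintegral_cst ?mul0r.
  under eq_Rintegral do rewrite big_nil.
  by rewrite /= (_ : (fun x => _) = cst 0)// Rintegral_cst ?mul0r.
have fis j : j \in s -> Cintegrable mu (f j).
  by move=> js; apply: fi; rewrite inE js orbT.
rewrite big_cons -ih// -CintegralD//.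
- by congr Cintegral; apply/funext => x; rewrite big_cons.
- by apply: fi; rewrite mem_head.
- exact: Cintegrable_sum.
Qed.

Lemma CintegralJ f : Cintegrable mu f ->
  Cintegral mu (fun x => conjc (f x)) = conjc (Cintegral mu f).
Proof.
move=> [f1 f2]; apply: complexP => /=.
  by apply: eq_Rintegral => x _; rewrite ReJ.
rewrite -mulN1r -RintegralZl//; apply: eq_Rintegral => x _.
by rewrite ImJ mulN1r.
Qed.

Lemma CintegralR (h : T -> R) :
  Cintegral mu (fun x => real_complex R (h x)) = real_complex R (\int[mu]_x h x).
Proof.
apply: complexP => //=.
by rewrite (_ : (fun x => _) = cst 0)// Rintegral_cst ?mul0r.
Qed.

(** Bounding the two components separately would lose a constant. Multiplying [f] by the conjugate
    of its integral [z] makes [|z|^2] the real part of an integral, whose integrand is dominated by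
    [|z| * |f|]. *)
Lemma cnorm_Cintegral_le f : Cintegrable mu f ->
  cnorm (Cintegral mu f) <= \int[mu]_x cnorm (f x).
Proof.
move=> fi; set z := Cintegral mu f.
have [z0|z0] := eqVneq (cnorm z) 0.
  by rewrite z0 Rintegral_ge0// => x _; exact: cnorm_ge0.
have zgt0 : 0 < cnorm z by rewrite lt_neqAle eq_sym z0 cnorm_ge0.
rewrite -(ler_pM2l zgt0) -expr2.
have -> : cnorm z ^+ 2 = complex.Re (Cintegral mu (fun x => conjc z * f x)).
  by rewrite CintegralZ// mulrC mulcJ.
rewrite -RintegralZl//; last exact: Cintegrable_cnorm.
apply: le_Rintegral => //.
- by have [] := CintegrableZ (conjc z) fi.
- by apply: EFin_integrableZ; exact: Cintegrable_cnorm.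
- move=> x _; rewrite (le_trans (ler_norm _))// (le_trans (normr_Re_le _))//.
  by rewrite cnormM cnormJ.
Qed.

Lemma Cintegral_dct (f_ : nat -> T -> R[i]) f (g : T -> R) :
  (forall n, Cmeasurable (f_ n)) -> Rintegrable mu g ->
  (forall n x, cnorm (f_ n x) <= g x) ->
  (forall x, ccvg (f_ ^~ x) (f x)) ->
  Cintegrable mu f /\ ccvg (fun n => Cintegral mu (f_ n)) (Cintegral mu f).
Proof.
move=> mf gi fg ff.
have [||||f1 c1] := @Rintegral_dct _ _ _ mu (fun n x => complex.Re (f_ n x))
    (fun x => complex.Re (f x)) g.
- by move=> n; have [] := mf n.
- exact: gi.
- by move=> n x; rewrite (le_trans (normr_Re_le _)).
- by move=> x; have [] := ff x.
have [||||f2 c2] := @Rintegral_dct _ _ _ mu (fun n x => complex.Im (f_ n x))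
    (fun x => complex.Im (f x)) g.
- by move=> n; have [] := mf n.
- exact: gi.
- by move=> n x; rewrite (le_trans (normr_Im_le _)).
- by move=> x; have [] := ff x.
by split; split.
Qed.

End complex_integral_theory.

(** * Fubini's theorem for real and complex integrals *)

Section fubini_theory.
Context d1 d2 (T1 : measurableType d1) (T2 : measurableType d2) (R : realType).
Variables (m1 : {sigma_finite_measure set T1 -> \bar R}).
Variables (m2 : {sigma_finite_measure set T2 -> \bar R}).
Local Notation cnorm := (@Normc.normc R).

Lemma measurable_Rintegral_l (f : T1 * T2 -> R) : measurable_fun setT f ->
  measurable_fun setT (fun x => \int[m2]_y f (x, y)).
Proof.
move=> mf; apply: measurableT_comp => //.
rewrite (_ : (fun x => _) = (fubini_F m2 (EFin \o f)^\+ \- fubini_F m2 (EFin \o f)^\-)%E).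
  apply: emeasurable_funB.
    apply: measurable_fun_fubini_tonelli_F => //.
    by apply: measurable_funepos; exact/measurable_EFinP.
  apply: measurable_fun_fubini_tonelli_F => //.
  by apply: measurable_funeneg; exact/measurable_EFinP.
apply/funext => x; rewrite [LHS]integralE.
by congr (_ - _)%E; apply: eq_integral => y _; rewrite ?funeposE ?funenegE.
Qed.

Lemma measurable_Rintegral_r (f : T1 * T2 -> R) : measurable_fun setT f ->
  measurable_fun setT (fun y => \int[m1]_x f (x, y)).
Proof.
move=> mf; apply: measurableT_comp => //.
rewrite (_ : (fun x => _) = (fubini_G m1 (EFin \o f)^\+ \- fubini_G m1 (EFin \o f)^\-)%E).
  apply: emeasurable_funB.
    apply: measurable_fun_fubini_tonelli_G => //.
    by apply: measurable_funepos; exact/measurable_EFinP.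
  apply: measurable_fun_fubini_tonelli_G => //.
  by apply: measurable_funeneg; exact/measurable_EFinP.
apply/funext => x; rewrite [LHS]integralE.
by congr (_ - _)%E; apply: eq_integral => y _; rewrite ?funeposE ?funenegE.
Qed.

Lemma Cmeasurable_Cintegral_l (f : T1 * T2 -> R[i]) : Cmeasurable f ->
  Cmeasurable (fun x => Cintegral m2 (fun y => f (x, y))).
Proof. by move=> [f1 f2]; split => /=; [exact: measurable_Rintegral_l f1|exact: measurable_Rintegral_l f2]. Qed.

Lemma integrable_fubini_G_of (f : T1 * T2 -> R) :
  Rintegrable (m1 \x m2)%E f ->
  m2.-integrable setT (fubini_G m1 (EFin \o f)).
Proof.
move=> fi; have mf := integrable_measurable fi; apply/integrableP; split.
  exact: measurable_fubini_G fi.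
have mabs : measurable_fun setT (fun p => `|(f p)%:E|%E).
  by apply: measurableT_comp => //; exact/measurable_EFinP.
apply: le_lt_trans ((integrable21ltyP _ _ (measurable_int _ fi)).1 fi).
apply: ge0_le_integral => //.
- by apply: measurableT_comp => //; exact: measurable_fubini_G fi.
- exact: (measurable_fun_fubini_tonelli_G (fun p => `|(f p)%:E|%E)).
- move=> y _; apply: le_abse_integral => //.
  by apply/measurable_EFinP; exact: measurableT_comp.
Qed.

(** The inner integral may be infinite or undefined on a null set, where [fine] replaces it by a
    real number; hence the comparison almost everywhere. *)
Lemma Rintegral_fubini_l (f : T1 * T2 -> R) :
  Rintegrable (m1 \x m2)%E f ->
  \int[(m1 \x m2)%E]_p f p = \int[m1]_x \int[m2]_y f (x, y).
Proof.
move=> fi; rewrite /Rintegral -(integral12_prod_meas1 fi); congr fine.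
apply: ae_eq_integral => //.
- exact: measurable_fubini_F fi.
- apply/measurable_EFinP; apply: measurable_Rintegral_l.
  exact: integrable_measurable fi.
- have := integrable_ae measurableT (integrable_fubini_F fi).
  by apply: filterS => x /= /(_ I) h _; rewrite fineK.
Qed.

Lemma Rintegral_fubini_r (f : T1 * T2 -> R) :
  Rintegrable (m1 \x m2)%E f ->
  \int[(m1 \x m2)%E]_p f p = \int[m2]_y \int[m1]_x f (x, y).
Proof.
move=> fi; rewrite /Rintegral -(integral21_prod_meas1 fi); congr fine.
apply: ae_eq_integral => //.
- exact: measurable_fubini_G fi.
- apply/measurable_EFinP; apply: measurable_Rintegral_r.
  exact: integrable_measurable fi.
- have := integrable_ae measurableT (integrable_fubini_G_of fi).
  by apply: filterS => x /= /(_ I) h _; rewrite fineK.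
Qed.

Lemma Rintegrable_fubini_l (f : T1 * T2 -> R) :
  Rintegrable (m1 \x m2)%E f ->
  Rintegrable m1 (fun x => \int[m2]_y f (x, y)).
Proof.
move=> fi; have gi := integrable_fubini_F fi.
apply/integrableP; split.
  apply/measurable_EFinP; apply: measurable_Rintegral_l.
  exact: integrable_measurable fi.
have /integrableP[_] := gi; congr (_ < _)%E; apply: ae_eq_integral => //.
- by apply: measurableT_comp => //; exact: measurable_fubini_F fi.
- apply: measurableT_comp => //; apply/measurable_EFinP; apply: measurable_Rintegral_l.
  exact: integrable_measurable fi.
- have := integrable_ae measurableT gi.
  by apply: filterS => x /(_ I) h _; rewrite /comp /Rintegral fineK.
Qed.

Lemma Rintegrable_fubini_r (f : T1 * T2 -> R) :
  Rintegrable (m1 \x m2)%E f ->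
  Rintegrable m2 (fun y => \int[m1]_x f (x, y)).
Proof.
move=> fi; have gi := integrable_fubini_G_of fi.
apply/integrableP; split.
  apply/measurable_EFinP; apply: measurable_Rintegral_r.
  exact: integrable_measurable fi.
have /integrableP[_] := gi; congr (_ < _)%E; apply: ae_eq_integral => //.
- by apply: measurableT_comp => //; exact: measurable_fubini_G fi.
- apply: measurableT_comp => //; apply/measurable_EFinP; apply: measurable_Rintegral_r.
  exact: integrable_measurable fi.
- have := integrable_ae measurableT gi.
  by apply: filterS => x /(_ I) h _; rewrite /comp /Rintegral fineK.
Qed.

Lemma Cintegral_fubini_l (f : T1 * T2 -> R[i]) : Cintegrable (m1 \x m2)%E f ->
  Cintegral (m1 \x m2)%E f = Cintegral m1 (fun x => Cintegral m2 (fun y => f (x, y))).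
Proof.
by move=> [f1 f2]; apply: complexP => /=; rewrite Rintegral_fubini_l.
Qed.

Lemma Cintegral_fubini_r (f : T1 * T2 -> R[i]) : Cintegrable (m1 \x m2)%E f ->
  Cintegral (m1 \x m2)%E f = Cintegral m2 (fun y => Cintegral m1 (fun x => f (x, y))).
Proof.
by move=> [f1 f2]; apply: complexP => /=; rewrite Rintegral_fubini_r.
Qed.

Lemma Cintegral_exchange (f : T1 * T2 -> R[i]) : Cintegrable (m1 \x m2)%E f ->
  Cintegral m1 (fun x => Cintegral m2 (fun y => f (x, y))) =
  Cintegral m2 (fun y => Cintegral m1 (fun x => f (x, y))).
Proof. by move=> fi; rewrite -Cintegral_fubini_l// Cintegral_fubini_r. Qed.

Lemma Cintegrable_fubini_l (f : T1 * T2 -> R[i]) : Cintegrable (m1 \x m2)%E f ->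
  Cintegrable m1 (fun x => Cintegral m2 (fun y => f (x, y))).
Proof. by move=> [f1 f2]; split => /=; [exact: Rintegrable_fubini_l f1|exact: Rintegrable_fubini_l f2]. Qed.

Lemma Cintegrable_fubini_r (f : T1 * T2 -> R[i]) : Cintegrable (m1 \x m2)%E f ->
  Cintegrable m2 (fun y => Cintegral m1 (fun x => f (x, y))).
Proof. by move=> [f1 f2]; split => /=; [exact: Rintegrable_fubini_r f1|exact: Rintegrable_fubini_r f2]. Qed.

(* Schur test *)
Lemma integrable_kernel_r (G : T1 * T2 -> R) (f : T2 -> R) (C : R) :
  measurable_fun setT G -> (forall p, 0 <= G p) ->
  (forall y, (\int[m1]_x (G (x, y))%:E <= C%:E)%E) ->
  Rintegrable m2 f ->
  Rintegrable (m1 \x m2)%E (fun p => f p.2 * G p).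
Proof.
move=> mG G0 GC fi; have mf := integrable_measurable fi.
have mp : measurable_fun setT (fun p : T1 * T2 => f p.2 * G p).
  apply: measurable_funM => //; exact: measurableT_comp.
apply/integrable21ltyP; first exact/measurable_EFinP.
have mG1 y : measurable_fun setT (fun x => (G (x, y))%:E).
  by apply/measurable_EFinP; exact: measurableT_comp.
apply: (@le_lt_trans _ _ (\int[m2]_y (C%:E * `|f y|%:E))%E).
  apply: ge0_le_integral => //.
  - by move=> y _; apply: integral_ge0 => x _.
  - apply: (measurable_fun_fubini_tonelli_G (abse \o (EFin \o (fun p => f p.2 * G p)))) => //=.
    by apply: measurableT_comp => //; exact/measurable_EFinP.
  - by apply/measurable_EFinP; apply: measurable_funM => //; exact: measurableT_comp.
  move=> y _ /=.
  under eq_integral do rewrite normrM (ger0_norm (G0 _)) EFinM.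
  rewrite ge0_integralZl_EFin//; last by move=> x _; rewrite lee_fin.
  by rewrite muleC lee_wpmul2r.
rewrite integralZl//; last exact: (integrable_norm fi).
by rewrite -(EFin_Rintegral (integrable_norm fi)) -EFinM ltry.
Qed.

Lemma integrable_tensor (f : T1 -> R) (g : T2 -> R) :
  Rintegrable m1 f -> Rintegrable m2 g ->
  Rintegrable (m1 \x m2)%E (fun p => f p.1 * g p.2).
Proof.
move=> fi gi; have mf := integrable_measurable fi; have mg := integrable_measurable gi.
apply/integrable12ltyP; first apply/measurable_EFinP.
  by apply: measurable_funM; exact: measurableT_comp.
under eq_integral => x _.
  under eq_integral do rewrite /= normrM EFinM.
  rewrite integralZl//; last exact: (integrable_norm gi).
  over.
rewrite -(EFin_Rintegral (integrable_norm gi)).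
rewrite (_ : (fun x => _) = (fun x => (\int[m2]_x `|g x|)%:E * (EFin \o (Num.norm \o f)) x)%E); last first.
  by apply/funext => x; rewrite muleC.
rewrite integralZl//; last exact: integrable_norm.
by rewrite -(EFin_Rintegral (integrable_norm fi)) ltry.
Qed.

Lemma Cintegrable_tensor (f : T1 -> R[i]) (g : T2 -> R[i]) :
  Cintegrable m1 f -> Cintegrable m2 g ->
  Cintegrable (m1 \x m2)%E (fun p => f p.1 * g p.2).
Proof.
move=> fi gi.
apply: (@le_Cintegrable _ _ _ _ _ (fun p => cnorm (f p.1) * cnorm (g p.2))).
- apply: CmeasurableM.
    by apply: (@Cmeasurable_comp _ _ _ _ _ fst f) => //; exact: Cintegrable_measurable fi.
  by apply: (@Cmeasurable_comp _ _ _ _ _ snd g) => //; exact: Cintegrable_measurable gi.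
- exact: integrable_tensor (Cintegrable_cnorm fi) (Cintegrable_cnorm gi).
- by move=> p; rewrite cnormM.
Qed.

End fubini_theory.

(** * Translation invariance and Gaussian integrals *)

Section measure_preserving.
Context d (T : measurableType d) (R : realType) (mu : {measure set T -> \bar R}).

(** Invariance is stated on nonnegative integrals rather than on measures of preimages, so that it
    can be proved by induction on the dimension through Tonelli's theorem. *)
Definition measure_preserving (phi : T -> T) : Prop :=
  measurable_fun setT phi /\
  forall f : T -> \bar R, measurable_fun setT f -> (forall x, (0 <= f x)%E) ->
    (\int[mu]_x f (phi x) = \int[mu]_x f x)%E.

Context (phi : T -> T) (mp : measure_preserving phi).
Let mphi : measurable_fun setT phi. Proof. by have [] := mp. Qed.

Lemma preserving_integrable (f : T -> R) : Rintegrable mu f ->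
  Rintegrable mu (fun x => f (phi x)).
Proof.
move=> fi; have mf := integrable_measurable fi.
apply/integrableP; split; first by apply/measurable_EFinP; exact: measurableT_comp.
have /integrableP[_] := fi; congr (_ < _)%E; apply/esym.
have [_ /(_ (fun x => `|(f x)%:E|%E))] := mp; apply => //.
by apply: measurableT_comp => //; exact/measurable_EFinP.
Qed.

Lemma preserving_Rintegral (f : T -> R) : measurable_fun setT f ->
  \int[mu]_x f (phi x) = \int[mu]_x f x.
Proof.
move=> mf; rewrite /Rintegral; congr fine; rewrite integralE [RHS]integralE.
have [_ H] := mp.
congr (_ - _)%E.
  rewrite -(H (EFin \o f)^\+%E) //.
    by apply: eq_integral => x _; rewrite !funeposE.
  by apply: measurable_funepos; exact/measurable_EFinP.
rewrite -(H (EFin \o f)^\-%E) //.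
  by apply: eq_integral => x _; rewrite !funenegE.
by apply: measurable_funeneg; exact/measurable_EFinP.
Qed.

Lemma preserving_Cintegral (f : T -> R[i]) : Cmeasurable f ->
  Cintegral mu (fun x => f (phi x)) = Cintegral mu f.
Proof.
by move=> [f1 f2]; apply: complexP => /=; [exact: preserving_Rintegral f1|exact: preserving_Rintegral f2].
Qed.

End measure_preserving.

Section lebesgue_translation.
Context (R : realType).
Local Notation leb := (@lebesgue_measure R).

(** The pushforward under a translation has the same value as Lebesgue measure on half-open
    intervals, and these values determine the measure. *)
Lemma lebesgue_translation (a : R) :
  measure_preserving leb (fun x : measurableTypeR R => (a + x : measurableTypeR R)).
Proof.
set tr := (fun x : measurableTypeR R => (a + x : measurableTypeR R)).
have mt : measurable_fun setT tr.
  by apply: measurable_funD => //; exact: measurable_cst.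
split => // f mf f0.
rewrite -(@ge0_integral_pushforward _ _ _ _ _ tr mt leb setT f) //.
apply: (@eq_measure_integral _ _ _ setT leb
  (measure_function_pushforward__canonical__measure_function_Measure leb mt)) => A mA _.
apply/esym; apply: lebesgue_measure_unique => // X [[p q] _ <-] /=.
rewrite /pushforward /=.
rewrite (_ : _ @^-1` _ = `]p - a, q - a]%classic); last first.
  by apply/seteqP; split => x /=; rewrite !in_itv/= ltrBlDl lerBrDl.
rewrite !lebesgue_measure_itv /= !lte_fin ltrD2r; case: ifPn => // _.
by rewrite -!EFinB opprB addrA addrNK.
Qed.

End lebesgue_translation.

(** * Lebesgue measure on tuples *)

Section tuples.
Context (R : realType).
Local Notation RR := (measurableTypeR R).

Lemma integral_lebesgue_cons n (f : n.+1.-tuple RR -> \bar R) :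
  measurable_fun setT f -> (forall x, (0 <= f x)%E) ->
  (\int[lebesgue_tuple R n.+1]_t f t =
   \int[(@lebesgue_measure R \x lebesgue_tuple R n)%E]_p f (tcons p))%E.
Proof.
move=> mf f0.
rewrite -(@ge0_integral_pushforward _ _ _ _ _ (@tcons R n) _ _ setT f) //.
exact: measurable_tcons.
Qed.

Lemma integrable_lebesgue_cons n (f : n.+1.-tuple RR -> R) :
  measurable_fun setT f ->
  (@lebesgue_measure R \x lebesgue_tuple R n)%E.-integrable setT
     (EFin \o (fun p => f (tcons p))) ->
  Rintegrable (lebesgue_tuple R n.+1) f.
Proof.
move=> mf fi; apply/integrableP; split; first exact/measurable_EFinP.
rewrite integral_lebesgue_cons//; last first.
  by apply: measurableT_comp => //; exact/measurable_EFinP.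
by have /integrableP[_] := fi.
Qed.

Lemma Rintegral_lebesgue_cons n (f : n.+1.-tuple RR -> R) :
  measurable_fun setT f ->
  \int[lebesgue_tuple R n.+1]_t f t =
  \int[(@lebesgue_measure R \x lebesgue_tuple R n)%E]_p f (tcons p).
Proof.
move=> mf; rewrite /Rintegral; congr fine; rewrite integralE [RHS]integralE.
congr (_ - _)%E; rewrite integral_lebesgue_cons//.
- by apply: eq_integral => x _; rewrite !funeposE.
- by apply: measurable_funepos; exact/measurable_EFinP.
- by apply: eq_integral => x _; rewrite !funenegE.
- by apply: measurable_funeneg; exact/measurable_EFinP.
Qed.

Definition taddl n (a t : n.-tuple RR) : n.-tuple RR :=
  [tuple tnth a i + tnth t i | i < n].

Lemma measurable_taddl n (a : n.-tuple RR) : measurable_fun setT (taddl a).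
Proof.
apply/measurable_fun_tnthP => i.
rewrite (_ : _ \o _ = fun t => tnth a i + tnth t i); last first.
  by apply/funext => t /=; rewrite tnth_mktuple.
apply: measurable_funD; first exact: measurable_cst.
exact: measurable_tnth.
Qed.

Lemma taddl_tcons n (a : n.+1.-tuple RR) x t :
  taddl a (tcons (x, t)) =
  tcons (tnth a ord0 + x, taddl [tuple of behead a] t).
Proof.
apply/eq_from_tnth => i; rewrite tnth_mktuple.
case: (unliftP ord0 i) => [j|] ->.
  rewrite /tcons /= !tnthS tnth_mktuple tnth_behead; congr (tnth a _ + _).
  by apply/val_inj; rewrite /= inordK// ltnS.
by rewrite /tcons /= !tnth0.
Qed.

(** One coordinate at a time: the tail is translated inside the inner integral by induction, the
    head by the one-dimensional case. In dimension 0 there is only one point. *)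
Lemma lebesgue_tuple_translation n (a : n.-tuple RR) :
  measure_preserving (lebesgue_tuple R n) (taddl a).
Proof.
elim: n a => [|n ih] a; split; [exact: measurable_taddl| |exact: measurable_taddl|] => f mf f0.
  by congr integral; apply/funext => t; congr f; rewrite (tuple0 t) (tuple0 (taddl _ _)).
have mfc : measurable_fun setT (fun p => f (tcons p)).
  by apply: measurableT_comp => //; exact: measurable_tcons.
have mfa : measurable_fun setT (fun t => f (taddl a t)).
  by apply: measurableT_comp => //; exact: measurable_taddl.
have mfac : measurable_fun setT (fun p => f (taddl a (tcons p))).
  by apply: measurableT_comp mfa _; exact: measurable_tcons.
rewrite !integral_lebesgue_cons// !fubini_tonelli1//.
pose g x := (\int[lebesgue_tuple R n]_t f (tcons (x, t)))%E.
transitivity (\int[lebesgue_measure]_x g (tnth a ord0 + x)%R)%E.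
  apply: eq_integral => x _; rewrite /fubini_F.
  under eq_integral do rewrite taddl_tcons.
  have [_ /(_ (fun t => f (tcons (tnth a ord0 + x, t))))] := ih [tuple of behead a].
  by apply => //; apply: measurableT_comp mfc _.
have [_ ->] := lebesgue_translation (tnth a ord0) => //.
  exact: measurable_fun_fubini_tonelli_F (fun p => f (tcons p)) _ _.
by move=> x; apply: integral_ge0.
Qed.

End tuples.

Section product_integrals.
Context (R : realType).
Local Notation RR := (measurableTypeR R).

Lemma Cintegrable_lebesgue_cons n (f : n.+1.-tuple RR -> R[i]) :
  Cmeasurable f ->
  Cintegrable (@lebesgue_measure R \x lebesgue_tuple R n)%E (fun p => f (tcons p)) ->
  Cintegrable (lebesgue_tuple R n.+1) f.
Proof.
by move=> [m1 m2] [f1 f2]; split; [exact: integrable_lebesgue_cons m1 f1|exact: integrable_lebesgue_cons m2 f2].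
Qed.

Lemma Cintegral_lebesgue_cons n (f : n.+1.-tuple RR -> R[i]) :
  Cmeasurable f ->
  Cintegral (lebesgue_tuple R n.+1) f =
  Cintegral (@lebesgue_measure R \x lebesgue_tuple R n)%E (fun p => f (tcons p)).
Proof.
by move=> [m1 m2]; apply: complexP => /=; [exact: Rintegral_lebesgue_cons m1|exact: Rintegral_lebesgue_cons m2].
Qed.

Lemma Cmeasurable_prod d (T : measurableType d) n (g : 'I_n -> T -> R[i]) :
  (forall i, Cmeasurable (g i)) -> Cmeasurable (fun t => \prod_(i < n) g i t).
Proof.
move=> mg; elim: n g mg => [|n ih] g mg.
  under eq_fun do rewrite big_ord0; exact: Cmeasurable_cst.
under eq_fun do rewrite big_ord_recl.
by apply: CmeasurableM => //; exact: ih.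
Qed.

Lemma Cintegral_cst_tuple0 (z : R[i]) :
  Cintegrable (lebesgue_tuple R 0) (fun=> z) /\ Cintegral (lebesgue_tuple R 0) (fun=> z) = z.
Proof.
have I0 (r : R) : Rintegrable (lebesgue_tuple R 0) (fun=> r).
  apply/integrableP; split; first exact/measurable_EFinP/measurable_cst.
  by rewrite integral_dirac//= ?diracT ?mul1e ?ltry//; exact: measurable_cst.
split; first by split; exact: I0.
have E (r : R) : \int[lebesgue_tuple R 0]_t r = r.
  rewrite Rintegral_cst// -[RHS]mulr1; congr (_ * _).
  by apply: (congr1 fine (_ : _ = 1%E)); exact: diracT.
by case: z => a b; apply: complexP; exact: E.
Qed.

(** Reduces the Fourier integral of a Gaussian and the integrability of [weight] to one variable. *)
Lemma Cintegral_prod n (g : 'I_n -> RR -> R[i]) :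
  (forall i, Cintegrable (@lebesgue_measure R) (g i)) ->
  Cintegrable (lebesgue_tuple R n) (fun t => \prod_(i < n) g i (tnth t i)) /\
  Cintegral (lebesgue_tuple R n) (fun t => \prod_(i < n) g i (tnth t i)) =
  \prod_(i < n) Cintegral (@lebesgue_measure R) (g i).
Proof.
elim: n g => [|n ih] g gi.
  under eq_fun do rewrite big_ord0; rewrite big_ord0; exact: Cintegral_cst_tuple0.
have [ih1 ih2] := ih (fun i => g (lift ord0 i)) (fun i => gi _).
have mp : Cmeasurable (fun t : n.+1.-tuple RR => \prod_(i < n.+1) g i (tnth t i)).
  apply: Cmeasurable_prod => i.
  apply: (@Cmeasurable_comp _ _ _ _ _ (fun t : n.+1.-tuple RR => tnth t i) (g i)).
    exact: measurable_tnth.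
  exact: Cintegrable_measurable (gi i).
have E : (fun p : RR * n.-tuple RR => \prod_(i < n.+1) g i (tnth (tcons p) i)) =
         (fun p => g ord0 p.1 * \prod_(i < n) g (lift ord0 i) (tnth p.2 i)).
  apply/funext => -[x t]; rewrite big_ord_recl /tcons /= tnth0; congr (_ * _).
  by apply: eq_bigr => i _; rewrite tnthS.
have it : Cintegrable (@lebesgue_measure R \x lebesgue_tuple R n)%E
    (fun p => g ord0 p.1 * \prod_(i < n) g (lift ord0 i) (tnth p.2 i)).
  exact: Cintegrable_tensor (gi ord0) ih1.
split; first by apply: Cintegrable_lebesgue_cons => //; rewrite E.
rewrite Cintegral_lebesgue_cons// E Cintegral_fubini_l//=.
under [X in Cintegral _ X]eq_fun do rewrite CintegralZ// ih2 mulrC.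
by rewrite CintegralZ// big_ord_recl mulrC.
Qed.

End product_integrals.

Section flows.
Context d (T : measurableType d) (R : realType).
Context (mu : {sigma_finite_measure set T -> \bar R}).
Local Notation RR := (measurableTypeR R).
Local Notation leb := (@lebesgue_measure R).

(* Fubini on [0, 1] x T: the integral of G o phi_1 - G vanishes by invariance *)
Lemma integral_flow_derivative (phi : R -> T -> T) (G G' : T -> R) :
  measurable_fun setT (fun p : RR * T => phi p.1 p.2) ->
  (forall s, measure_preserving mu (phi s)) ->
  Rintegrable mu G -> Rintegrable mu G' ->
  (forall x, G (phi 1 x) - G x = \int[leb]_(s in `[0, 1]) G' (phi s x)) ->
  \int[mu]_x G' x = 0.
Proof.
move=> mphi pphi iG iG' GG'.
have mG' := integrable_measurable iG'.
have mI : measurable_fun setT (\1_(`[0, 1]%classic) : RR -> R).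
  exact: measurable_indic.
pose H (p : RR * T) : R := \1_(`[0, 1]%classic) p.1 * G' (phi p.1 p.2).
have mH : measurable_fun setT H.
  apply: measurable_funM; first exact: (measurableT_comp mI).
  exact: (measurableT_comp mG').
have iI : Rintegrable leb (\1_(`[0, 1]%classic) : RR -> R).
  exact: integrable_indic_itv.
have iH : Rintegrable (leb \x mu)%E H.
  apply/integrable12ltyP; first exact/measurable_EFinP.
  have -> : (\int[leb]_s \int[mu]_x `|(EFin \o H) (s, x)|)%E =
     (\int[leb]_s ((\int[mu]_x `|G' x|)%R * \1_(`[0%R, 1%R]%classic) s)%:E)%E.
    apply: eq_integral => s _; rewrite /H /=.
    under eq_integral do rewrite normrM EFinM.
    rewrite ge0_integralZl_EFin//; last first.
      apply/measurable_EFinP; apply: measurableT_comp => //; apply: measurableT_comp => //.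
      by have [] := pphi s.
    have [_ /(_ (fun x => `|(G' x)%:E|%E)) /= ->] := pphi s => //; last first.
      by apply/measurable_EFinP; exact: measurableT_comp.
    rewrite EFinM muleC -(EFin_Rintegral (integrable_norm iG')) /= ger0_norm//.
  under eq_integral do rewrite EFinM.
  by rewrite integralZl// -(EFin_Rintegral iI) -EFinM ltry.
pose I := \int[mu]_x G' x.
have E1 : \int[mu]_x \int[leb]_s H (s, x) = 0.
  transitivity (\int[mu]_x (G (phi 1 x) - G x)).
    apply: eq_Rintegral => x _; rewrite GG' [RHS]Rintegral_mkcond; apply: eq_Rintegral => s _.
    by rewrite /H patchE /= indicE; case: ifPn => _; rewrite ?mul1r ?mul0r.
  rewrite RintegralB//; last exact: preserving_integrable iG.
  by rewrite (preserving_Rintegral (pphi 1)) ?subrr//; exact: integrable_measurable iG.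
have E2 : \int[leb]_s \int[mu]_x H (s, x) = I.
  transitivity (\int[leb]_s (I * \1_(`[0, 1]%classic) s)).
    apply: eq_Rintegral => s _; rewrite /H /= (@RintegralZl _ _ _ mu setT (fun x => G' (phi s x)))//; last exact: preserving_integrable iG'.
    by rewrite (preserving_Rintegral (pphi s))// mulrC.
  rewrite RintegralZl// /Rintegral integral_indic//= setIT lebesgue_measure_itv/= lte_fin ltr01.
  by rewrite oppr0 addr0 mulr1.
by rewrite -/I -E2 -Rintegral_fubini_l// Rintegral_fubini_r.
Qed.

End flows.

(** * One-variable calculus and Gaussian integrals *)

Section ftc.
Context (R : realType).
Local Notation leb := (@lebesgue_measure R).

Lemma FTC_unit (g g' : R -> R) : (forall s : R, is_derive s 1 g (g' s)) ->
  continuous g' -> g 1 - g 0 = \int[leb]_(s in `[0, 1]) g' s.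
Proof.
move=> dg cg'.
have cg : continuous g.
  by move=> s; apply/differentiable_continuous/derivable1_diffP; have := dg s => -[].
rewrite /Rintegral (@continuous_FTC2 _ g' g 0 1)//.
- exact: continuous_subspaceT.
- split.
  + by move=> s _; have := dg s => -[].
  + exact/cvg_at_right_filter/cg.
  + exact/cvg_at_left_filter/cg.
- by move=> s _; rewrite derive1E; have := dg s => -[].
Qed.

(** Integrability of [g] and [g'] takes the place of boundary terms at infinity, through invariance
    under the flow [x |-> s + x]. *)
Lemma integral_derivative0 (g g' : R -> R) :
  (forall s : R, is_derive s 1 g (g' s)) -> continuous g' ->
  Rintegrable leb g -> Rintegrable leb g' ->
  \int[leb]_x g' x = 0.
Proof.
move=> dg cg' ig ig'.
apply: (@integral_flow_derivative _ _ _ leb (fun s x => s + x) g g') => //.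
- by apply: measurable_funD.
- by move=> s; exact: lebesgue_translation.
move=> x; have D : forall s : R, is_derive s 1 (fun s => g (s + x)) (g' (s + x)).
  move=> s; have d1 : is_derive s 1 (fun s => s + x) 1.
    by rewrite -[X in is_derive _ _ _ X]addr0; exact: is_deriveD.
  by have := @is_derive1_comp _ g (fun s => s + x) s _ _ (dg (s + x)) d1; rewrite mulr1.
have C : continuous (fun s : R => g' (s + x)).
  move=> s; apply: (@cvg_comp _ _ _ (fun s : R => s + x) g' _ _ _ _ (cg' (s + x))).
  by apply: cvgD; [exact: cvg_id|exact: cvg_cst].
by have := @FTC_unit _ _ D C; rewrite add0r.
Qed.

Lemma mul_expRN_le1 (y : R) : y * expR (- y) <= 1.
Proof.
rewrite expRN ler_pdivrMr ?expR_gt0// mul1r (le_trans _ (expR_ge1Dx _))//.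
by rewrite lerDr.
Qed.

(** The normal density of variance [1 / (2a)] has integral 1; its normalising constant is the value
    of the Gaussian integral. *)
Lemma integrable_gauss (a : R) : 0 < a ->
  Rintegrable leb (fun x => expR (- a * x ^+ 2)) /\
  \int[leb]_x expR (- a * x ^+ 2) = Num.sqrt (pi / a).
Proof.
move=> a0; pose s := Num.sqrt (a *+ 2)^-1.
have s2 : s ^+ 2 = (a *+ 2)^-1 by rewrite sqr_sqrtr// invr_ge0 mulrn_wge0// ltW.
have s0 : s != 0 by rewrite sqrtr_eq0 -ltNge invr_gt0 pmulrn_lgt0.
pose c := Num.sqrt (s ^+ 2 * pi *+ 2).
have c0 : 0 < c by rewrite sqrtr_gt0 pmulrn_lgt0// mulr_gt0 ?pi_gt0// exprn_even_gt0.
have E : (fun x => expR (- a * x ^+ 2)) = (fun x => c * normal_pdf 0 s x).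
  apply/funext => x.
  have -> : normal_pdf 0 s x = c^-1 * normal_fun 0 s x by rewrite /normal_pdf (negbTE s0).
  rewrite mulVKf ?gt_eqF// /normal_fun subr0 s2; congr expR; field; exact: lt0r_neq0.
have I : Rintegrable leb (normal_pdf 0 s) by exact: integrable_normal_pdf.
rewrite E; split; first exact: EFin_integrableZ.
rewrite RintegralZl//; rewrite /Rintegral integral_normal_pdf mulr1 /c s2; congr Num.sqrt.
field; exact: lt0r_neq0.
Qed.

Lemma integrable_gauss_abs (a : R) : 0 < a ->
  Rintegrable leb (fun x => `|x| * expR (- a * x ^+ 2)).
Proof.
move=> a0; have a20 : 0 < a / 2 by rewrite divr_gt0.
have [I _] := integrable_gauss a20.
apply: (le_EFin_integrable _ (EFin_integrableZ (1 + (a / 2)^-1) I)).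
  apply: measurable_funM; first exact: normr_measurable.
  apply: measurableT_comp; first exact: measurable_expR.
  apply: measurable_funM => //; exact: measurable_funX.
move=> x; rewrite ger0_norm ?mulr_ge0 ?expR_ge0//.
(* The Gaussian is split into two halves: one absorbs the growth [1 + x^2], the other remains
   integrable. *)
have -> : expR (- a * x ^+ 2) = expR (- (a / 2 * x ^+ 2)) * expR (- (a / 2) * x ^+ 2).
  by rewrite -expRD; congr expR; field.
rewrite mulrA ler_wpM2r ?expR_ge0//.
have x1 : `|x| <= 1 + x ^+ 2.
  rewrite -(real_normK (num_real x)); have := sqr_ge0 (`|x| - 1); have := normr_ge0 x; nra.
apply: (le_trans (ler_wpM2r (expR_ge0 _) x1)).
rewrite mulrDl mul1r lerD//; first by rewrite expR_le1 oppr_le0 mulr_ge0 ?sqr_ge0 ?ltW.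
have := mul_expRN_le1 (a / 2 * x ^+ 2).
by rewrite -mulrA -ler_pdivlMl// mulr1.
Qed.

Lemma is_derive_gauss_sin (a c t x : R) :
  is_derive x 1 (fun x => expR (- a * x ^+ 2) * sin (c * x + t))
    (- (2 * a) * (x * expR (- a * x ^+ 2) * sin (c * x + t)) +
     c * (expR (- a * x ^+ 2) * cos (c * x + t))).
Proof.
have d1 : is_derive x 1 (fun x => - a * x ^+ 2) (- a * (2 * x)).
  have := is_deriveZ (- a) (is_deriveX 2 (is_derive_id x (1:R))).
  by rewrite /GRing.scale /= expr1 mulr1.
have d2 : is_derive x 1 (fun x => c * x + t) c.
  have := is_deriveD (is_deriveZ c (is_derive_id x (1:R))) (is_derive_cst t x (1:R)).
  by rewrite addr0 /GRing.scale /= mulr1.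
have e1 := @is_derive1_comp _ expR (fun x => - a * x ^+ 2) x _ _ (is_derive_expR _) d1.
have e2 := @is_derive1_comp _ sin (fun x => c * x + t) x _ _ (is_derive_sin _) d2.
have := is_deriveM e1 e2; rewrite /GRing.scale /=.
by congr is_derive; ring.
Qed.

Lemma is_derive_gauss_cos (a c t x : R) :
  is_derive c 1 (fun c => expR (- a * x ^+ 2) * cos (c * x + t))
    (- (x * expR (- a * x ^+ 2) * sin (c * x + t))).
Proof.
have d2 : is_derive c 1 (fun c => c * x + t) x.
  have := is_deriveD (is_deriveZ x (is_derive_id c (1:R))) (is_derive_cst t c (1:R)).
  rewrite addr0 /GRing.scale /= mulr1.
  by congr is_derive; apply/funext => y /=; rewrite mulrC.
have e2 := @is_derive1_comp _ cos (fun c => c * x + t) c _ _ (is_derive_cos _) d2.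
have := is_deriveZ (expR (- a * x ^+ 2)) e2; rewrite /GRing.scale /=.
by congr is_derive; ring.
Qed.

Lemma measurable_gauss (a : R) : measurable_fun setT (fun x : measurableTypeR R => expR (- a * x ^+ 2)).
Proof.
apply: measurableT_comp; first exact: measurable_expR.
by apply: measurable_funM => //; exact: measurable_funX.
Qed.

Lemma measurable_affine (c t : R) : measurable_fun setT (fun x : measurableTypeR R => c * x + t).
Proof. by apply: measurable_funD => //; exact: measurable_funM. Qed.

Lemma measurable_cos : measurable_fun setT (@cos R).
Proof. by apply: continuous_measurable_fun; exact: continuous_cos. Qed.

Lemma measurable_sin : measurable_fun setT (@sin R).
Proof. by apply: continuous_measurable_fun; exact: continuous_sin. Qed.

Lemma integrable_gauss_cos (a c t : R) : 0 < a ->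
  Rintegrable leb (fun x => expR (- a * x ^+ 2) * cos (c * x + t)).
Proof.
move=> a0; have [I _] := integrable_gauss a0; apply: (le_EFin_integrable _ I).
  apply: measurable_funM; first exact: measurable_gauss.
  exact: measurableT_comp measurable_cos (measurable_affine c t).
move=> x; rewrite normrM ger0_norm ?expR_ge0// ler_piMr ?expR_ge0//.
by rewrite ler_norml cos_geN1 cos_le1.
Qed.

Lemma integrable_gauss_sin (a c t : R) : 0 < a ->
  Rintegrable leb (fun x => expR (- a * x ^+ 2) * sin (c * x + t)).
Proof.
move=> a0; have [I _] := integrable_gauss a0; apply: (le_EFin_integrable _ I).
  apply: measurable_funM; first exact: measurable_gauss.
  exact: measurableT_comp measurable_sin (measurable_affine c t).
move=> x; rewrite normrM ger0_norm ?expR_ge0// ler_piMr ?expR_ge0//.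
by rewrite ler_norml sin_geN1 sin_le1.
Qed.

Lemma integrable_xgauss_sin (a c t : R) : 0 < a ->
  Rintegrable leb (fun x => x * expR (- a * x ^+ 2) * sin (c * x + t)).
Proof.
move=> a0; have I := integrable_gauss_abs a0; apply: (le_EFin_integrable _ I).
  apply: measurable_funM; first by apply: measurable_funM => //; exact: measurable_gauss.
  exact: measurableT_comp measurable_sin (measurable_affine c t).
move=> x; rewrite 2!normrM (ger0_norm (expR_ge0 _)) ler_piMr ?mulr_ge0 ?expR_ge0//.
by rewrite ler_norml sin_geN1 sin_le1.
Qed.

Lemma continuous_affine (c t : R) : continuous (fun x : R => c * x + t).
Proof.
move=> x; apply: cvgD; last exact: cvg_cst.
by apply: cvgM; [exact: cvg_cst|exact: cvg_id].
Qed.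

Lemma continuous_gauss (a : R) : continuous (fun x : R => expR (- a * x ^+ 2)).
Proof.
move=> x; apply: continuous_cvg; first exact: continuous_expR.
by apply: cvgM; [exact: cvg_cst|exact: exprn_continuous].
Qed.

Lemma integral_gauss_cos (a c t : R) : 0 < a ->
  \int[leb]_x (expR (- a * x ^+ 2) * cos (c * x + t)) =
  cos t * Num.sqrt (pi / a) * expR (- c ^+ 2 / (4 * a)).
Proof.
move=> a0; pose F c := \int[leb]_x (expR (- a * x ^+ 2) * cos (c * x + t)).
(* The derivative of [exp(- a x^2) sin(u x + t)] integrates to 0, which trades the factor [x] for
   [u / (2a)]. *)
have parts u : \int[leb]_x (x * expR (- a * x ^+ 2) * sin (u * x + t)) = u / (2 * a) * F u.
  have := @integral_derivative0 _ _ (is_derive_gauss_sin a u t).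
  rewrite RintegralD//; first rewrite !RintegralZl//.
  - move=> H; have {}H : - (2 * a) * (\int[leb]_x (x * expR (- a * x ^+ 2) * sin (u * x + t))) + u * F u = 0.
      apply: H.
      + move=> x; apply: cvgD; apply: cvgM; try exact: cvg_cst.
          apply: cvgM; first by apply: cvgM; [exact: cvg_id|exact: continuous_gauss].
          by apply: continuous_cvg; [exact: continuous_sin|exact: continuous_affine].
        apply: cvgM; first exact: continuous_gauss.
        by apply: continuous_cvg; [exact: continuous_cos|exact: continuous_affine].
      + exact: integrable_gauss_sin.
      + apply: EFin_integrableD; apply: EFin_integrableZ; first exact: integrable_xgauss_sin.
        exact: integrable_gauss_cos.
    have a2 : 2 * a != 0 by rewrite mulf_neq0// gt_eqF.
    by apply: (mulfI a2); rewrite mulrA mulrCA divff// mulr1; lra.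
  - exact: integrable_xgauss_sin.
  - exact: integrable_gauss_cos.
  - by apply: EFin_integrableZ; exact: integrable_xgauss_sin.
  - by apply: EFin_integrableZ; exact: integrable_gauss_cos.
(* the transform solves a linear differential equation *)
have dF (u : R) : is_derive u 1 F (- (u / (2 * a)) * F u).
  have I0 : `]u - 1, u + 1[%classic u by rewrite /= in_itv/= ltrBlDr ltrDl ltr01.
  have D (v : R) (x : R) : `]u - 1, u + 1[%classic v -> [set: R] x ->
      derivable ((fun c x => expR (- a * x ^+ 2) * cos (c * x + t))^~ x) v 1.
    by move=> _ _; have [] := is_derive_gauss_cos a v t x.
  have p1 v x : partial1of2 (fun c x => expR (- a * x ^+ 2) * cos (c * x + t)) v x =
      - (x * expR (- a * x ^+ 2) * sin (v * x + t)).
    by rewrite partial1of2E; have [] := is_derive_gauss_cos a v t x.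
  have G (v : R) (x : R) : `]u - 1, u + 1[%classic v -> [set: R] x ->
      `|partial1of2 (fun c x => expR (- a * x ^+ 2) * cos (c * x + t)) v x| <= `|x| * expR (- a * x ^+ 2).
    move=> _ _; rewrite p1 normrN 2!normrM (ger0_norm (expR_ge0 _)) ler_piMr ?mulr_ge0 ?expR_ge0//.
    by rewrite ler_norml sin_geN1 sin_le1.
  have i1 (v : R) : `]u - 1, u + 1[%classic v ->
     Rintegrable leb (fun x => expR (- a * x ^+ 2) * cos (v * x + t)).
    by move=> _; exact: integrable_gauss_cos.
  have G0 (x : measurableTypeR R) : 0 <= `|x| * expR (- a * x ^+ 2) by rewrite mulr_ge0 ?expR_ge0.
  apply: DeriveDef.
    exact: (@derivable_under_integral _ _ _ leb _ setT measurableT u _ _ I0 i1 D _ G0 (integrable_gauss_abs a0) G).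
  rewrite -derive1E (@differentiation_under_integral _ _ _ leb _ setT measurableT u _ _ I0 i1 D _ G0 (integrable_gauss_abs a0) G).
  rewrite mulNr -parts -mulN1r -RintegralZl//; last exact: integrable_xgauss_sin.
  by apply: eq_Rintegral => x _; rewrite p1 mulN1r.
(* Integrating factor of the equation: [K] is constant, so its value at [c] is the one at 0, where
   the integral is the plain Gaussian integral times [cos t]. *)
pose K u := F u * expR (u ^+ 2 / (4 * a)).
have dK (u : R) : is_derive u 1 K 0.
  have d1 : is_derive u 1 (fun u => u ^+ 2 / (4 * a)) (u / (2 * a)).
    have := is_deriveZ (4 * a)^-1 (is_deriveX 2 (is_derive_id u (1:R))).
    rewrite /GRing.scale /= expr1 mulr1; congr is_derive.
      by apply/funext => v; exact: mulrC.
    field; exact: lt0r_neq0.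
  have e1 := @is_derive1_comp _ expR (fun u => u ^+ 2 / (4 * a)) u _ _ (is_derive_expR _) d1.
  have := is_deriveM (dF u) e1; rewrite /GRing.scale /=.
  congr is_derive; ring.
have := is_derive_0_is_cst c 0 dK; rewrite /K expr0n/= mul0r expR0 mulr1 => E.
rewrite mulNr expRN; apply: (mulIf (lt0r_neq0 (expR_gt0 (c ^+ 2 / (4 * a))))).
rewrite divfK ?gt_eqF ?expR_gt0// [LHS]E.
have [I J] := integrable_gauss a0.
rewrite -J -RintegralZl//; apply: eq_Rintegral => x _.
by rewrite mul0r add0r mulrC.
Qed.

Lemma Cintegral_gauss (a c : R) : 0 < a ->
  Cintegrable leb (fun x => real_complex R (expR (- a * x ^+ 2)) * expi (c * x)) /\
  Cintegral leb (fun x => real_complex R (expR (- a * x ^+ 2)) * expi (c * x)) =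
  real_complex R (Num.sqrt (pi / a) * expR (- c ^+ 2 / (4 * a))).
Proof.
move=> a0.
have ReE x : complex.Re (real_complex R (expR (- a * x ^+ 2)) * expi (c * x)) =
    expR (- a * x ^+ 2) * cos (c * x + 0).
  by rewrite ReM /= mul0r subr0 addr0.
(* The sine is the cosine delayed by a quarter period; this is what the phase [t] of
   [integral_gauss_cos] is for. *)
have ImE x : complex.Im (real_complex R (expR (- a * x ^+ 2)) * expi (c * x)) =
    expR (- a * x ^+ 2) * cos (c * x + - (pi / 2)).
  by rewrite ImM /= mul0r addr0 cosD cosN sinN cos_pihalf sin_pihalf; ring.
split; first split.
- by under eq_fun do rewrite ReE; exact: integrable_gauss_cos.
- by under eq_fun do rewrite ImE; exact: integrable_gauss_cos.
rewrite /Cintegral.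
under eq_Rintegral do rewrite ReE.
under [X in Complex _ X]eq_Rintegral do rewrite ImE.
by rewrite !integral_gauss_cos// cos0 mul1r cosN cos_pihalf !mul0r.
Qed.

End ftc.

(** * Functions on Euclidean space *)

Section row_vectors.
Context (R : realType) (n : nat).
Local Notation RR := (measurableTypeR R).
Local Notation V := ('rV[R]_n).
Local Notation T := (n.-tuple RR).
Local Notation mu := (lebesgue_tuple R n).
Local Notation leb := (@lebesgue_measure R).
Local Notation rv := (@rv_of_tuple R n).

Definition tuple_of_rv (x : V) : T := [tuple x 0 i | i < n].

Lemma rv_of_tuple_add (a : V) (t : T) : rv (taddl (tuple_of_rv a) t) = a + rv t.
Proof. by apply/rowP => i; rewrite !mxE !tnth_mktuple. Qed.

Lemma measurable_coord i : measurable_fun setT (fun t : T => rv t 0 i).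
Proof. by under eq_fun do rewrite mxE; exact: measurable_tnth. Qed.

Lemma measurable_sqnorm d (S : measurableType d) (h : S -> V) :
  (forall i, measurable_fun setT (fun s => h s 0 i)) ->
  measurable_fun setT (fun s => sqnorm (h s)).
Proof. by move=> mh; apply: measurable_sum => i; exact: measurable_funX. Qed.

Lemma sqnorm_ge0 (x : V) : 0 <= sqnorm x.
Proof. by apply: sumr_ge0 => i _; exact: sqr_ge0. Qed.

Lemma coord_sqnorm_le (x : V) i : x 0 i ^+ 2 <= sqnorm x.
Proof. by rewrite /sqnorm (bigD1 i)//= lerDl sumr_ge0// => j _; exact: sqr_ge0. Qed.

Lemma normr_coord_le (x : V) i : `|x 0 i| <= 1 + sqnorm x.
Proof.
have := coord_sqnorm_le x i; rewrite -(real_normK (num_real (x 0 i))).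
have := sqr_ge0 (`|x 0 i| - 1); have := normr_ge0 (x 0 i); nra.
Qed.

Lemma sqnormN (x : V) : sqnorm (- x) = sqnorm x.
Proof. by apply: eq_bigr => i _; rewrite mxE sqrrN. Qed.

Lemma sqnormD_le (x y : V) : sqnorm (x + y) <= 2 * sqnorm x + 2 * sqnorm y.
Proof.
rewrite /sqnorm !mulr_sumr -big_split/=; apply: ler_sum => i _; rewrite !mxE.
have := sqr_ge0 (x 0 i - y 0 i); nra.
Qed.

Lemma sqnorm0 : sqnorm (0 : V) = 0.
Proof. by rewrite /sqnorm big1// => i _; rewrite mxE expr0n. Qed.

Lemma translation_Cintegral (f : V -> R[i]) (a : V) : Cmeasurable (f \o rv) ->
  Cintegral mu (fun t => f (a + rv t)) = Cintegral mu (f \o rv).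
Proof.
move=> mf; rewrite -(preserving_Cintegral (lebesgue_tuple_translation (tuple_of_rv a)) mf).
by congr Cintegral; apply/funext => t /=; rewrite rv_of_tuple_add.
Qed.

Lemma translation_Rintegral (f : V -> R) (a : V) : measurable_fun setT (f \o rv) ->
  \int[mu]_t f (a + rv t) = \int[mu]_t f (rv t).
Proof.
move=> mf; rewrite -(preserving_Rintegral (lebesgue_tuple_translation (tuple_of_rv a)) mf).
by apply: eq_Rintegral => t _ /=; rewrite rv_of_tuple_add.
Qed.

Lemma translation_integrable (f : V -> R) a : Rintegrable mu (f \o rv) ->
  Rintegrable mu (fun t => f (a + rv t)).
Proof.
move=> fi.
have := preserving_integrable (lebesgue_tuple_translation (tuple_of_rv a)) fi.
by under eq_fun do rewrite /= rv_of_tuple_add.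
Qed.

Definition gauss (a : R) (x : V) : R := expR (- a * sqnorm x).

Definition damp (a : R) (phi : V -> R) : V -> R := fun x => gauss a x * phi x.

Lemma gauss_prod (a : R) (x : V) : gauss a x = \prod_(i < n) expR (- a * x 0 i ^+ 2).
Proof. by rewrite /gauss /sqnorm mulr_sumr expR_sum. Qed.

Lemma gauss_ge0 (a : R) (x : V) : 0 <= gauss a x. Proof. exact: expR_ge0. Qed.

Lemma gauss_le1 (a : R) (x : V) : 0 <= a -> gauss a x <= 1.
Proof. by move=> a0; rewrite expR_le1 mulNr oppr_le0 mulr_ge0// sqnorm_ge0. Qed.

Lemma gaussD (a b : R) (x : V) : gauss (a + b) x = gauss a x * gauss b x.
Proof. by rewrite /gauss -expRD; congr expR; ring. Qed.

Lemma gaussN (a : R) (x : V) : gauss a (- x) = gauss a x.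
Proof. by rewrite /gauss sqnormN. Qed.

Lemma measurable_gauss_comp (a : R) d (S : measurableType d) (h : S -> V) :
  (forall i, measurable_fun setT (fun s => h s 0 i)) ->
  measurable_fun setT (fun s => gauss a (h s)).
Proof.
move=> mh; apply: measurableT_comp; first exact: measurable_expR.
by apply: measurable_funM => //; exact: measurable_sqnorm.
Qed.

Lemma expi_sum (I : eqType) (s : seq I) (f : I -> R) :
  expi (\sum_(i <- s) f i) = \prod_(i <- s) expi (f i).
Proof.
by elim: s => [|i s ih]; rewrite ?big_nil ?expi0// !big_cons expiD ih.
Qed.

Lemma Cintegral_gauss_rv (a : R) (w : V) : 0 < a ->
  Cintegrable mu (fun t => real_complex R (gauss a (rv t)) * expi (\sum_i w 0 i * rv t 0 i)) /\
  Cintegral mu (fun t => real_complex R (gauss a (rv t)) * expi (\sum_i w 0 i * rv t 0 i)) =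
  real_complex R (Num.sqrt (pi / a) ^+ n * expR (- sqnorm w / (4 * a))).
Proof.
move=> a0.
have [] := @Cintegral_prod R n (fun i x => real_complex R (expR (- a * x ^+ 2)) * expi (w 0 i * x)).
  by move=> i; have [] := Cintegral_gauss (w 0 i) a0.
have -> : (fun t => real_complex R (gauss a (rv t)) * expi (\sum_i w 0 i * rv t 0 i)) =
  (fun t : T => \prod_(i < n) (real_complex R (expR (- a * tnth t i ^+ 2)) * expi (w 0 i * tnth t i))).
  apply/funext => t; rewrite big_split/= gauss_prod expi_sum rmorph_prod.
  by congr (_ * _); apply: eq_bigr => i _; rewrite mxE.
move=> I ->; split => //.
under eq_bigr do rewrite (Cintegral_gauss _ a0).2.
rewrite -rmorph_prod/=; apply: (congr1 (real_complex R)).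
rewrite big_split/= prodr_const card_ord; congr (_ * _).
by rewrite -expR_sum /sqnorm -sumrN mulr_suml.
Qed.

Lemma gauss_integrable (a : R) : 0 < a ->
  Rintegrable mu (fun t => gauss a (rv t)) /\
  \int[mu]_t gauss a (rv t) = Num.sqrt (pi / a) ^+ n.
Proof.
move=> a0; have [[I _] J] := Cintegral_gauss_rv 0 a0.
have E : (fun t => real_complex R (gauss a (rv t)) * expi (\sum_i (0:V) 0 i * rv t 0 i)) =
    (fun t => real_complex R (gauss a (rv t))).
  apply/funext => t; rewrite big1 ?expi0 ?mulr1// => i _.
  by rewrite mxE mul0r.
split; first by move: I; under eq_fun do rewrite (congr1 (@^~ _) E).
by move: J; rewrite E CintegralR sqnorm0 oppr0 mul0r expR0 mulr1 => -[].
Qed.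

(** A product of Cauchy profiles: integrable in every dimension, and for [c = 1] the reciprocal of
    the symbol of [\prod_i (1 - d_i^2)], hence the natural rate of decay for Fourier integrals of
    [D_L1] functions. *)
Definition weight (c : R) (x : V) : R := \prod_(i < n) (1 + (c * x 0 i) ^+ 2)^-1.

Lemma weight_ge0 (c : R) (x : V) : 0 <= weight c x.
Proof.
by apply: prodr_ge0 => i _; rewrite invr_ge0 addr_ge0// sqr_ge0.
Qed.

Lemma weightN (c : R) (x : V) : weight c (- x) = weight c x.
Proof. by apply: eq_bigr => i _; rewrite mxE mulrN sqrrN. Qed.

Lemma continuous_oneDsqrV_scale (c : R) : continuous (fun x : R => (1 + (c * x) ^+ 2)^-1).
Proof.
move=> x; apply: cvgV; first by rewrite gt_eqF// ltr_pwDl// sqr_ge0.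
apply: cvgD; first exact: cvg_cst.
by apply: cvgM; apply: cvgM; try exact: cvg_cst; exact: cvg_id.
Qed.

Lemma measurable_weight (c : R) d (S : measurableType d) (h : S -> V) :
  (forall i, measurable_fun setT (fun s => h s 0 i)) ->
  measurable_fun setT (fun s => weight c (h s)).
Proof.
move=> mh; apply: measurable_prod => i _.
apply: (@measurableT_comp _ _ _ _ _ _ (fun x : R => (1 + (c * x) ^+ 2)^-1)) => //.
by apply: continuous_measurable_fun; exact: continuous_oneDsqrV_scale.
Qed.

Lemma integrable_oneDsqrV (c : R) : c != 0 ->
  Rintegrable leb (fun x => (1 + (c * x) ^+ 2)^-1).
Proof.
move=> c0.
have I1 : Rintegrable leb (fun x : R => (oneDsqr x)^-1).
  apply: ge0_EFin_integrable.
  - by apply: continuous_measurable_fun; exact: continuous_oneDsqrV.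
  - by move=> x; rewrite invr_ge0 (le_trans ler01)// oneDsqr_ge1.
  rewrite ge0_symfun_integralT.
  - rewrite (_ : [set x | _] = `[0, +oo[%classic); last first.
      by apply/seteqP; split => x /=; rewrite in_itv/= andbT.
    by rewrite integral0y_oneDsqr -EFinM ltry.
  - by move=> x; rewrite invr_ge0 (le_trans ler01)// oneDsqr_ge1.
  - exact: continuous_oneDsqrV.
  - by move=> x; rewrite /= /oneDsqr sqrrN.
have c20 : 0 < c ^+ 2 by rewrite exprn_even_gt0.
(* Comparison with the profile for [c = 1]: [1 + x^2] is at most [(1 + c^-2)] times
   [1 + (c x)^2]. *)
apply: (le_EFin_integrable _ (EFin_integrableZ (1 + (c ^+ 2)^-1) I1)).
  by apply: continuous_measurable_fun; exact: continuous_oneDsqrV_scale.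
move=> x; have p1 : 0 < 1 + (c * x) ^+ 2 by rewrite ltr_pwDl// sqr_ge0.
have p2 : 0 < 1 + x ^+ 2 by rewrite ltr_pwDl// sqr_ge0.
have p3 : 0 <= (1 + (c * x) ^+ 2)^-1 by rewrite invr_ge0 ltW.
rewrite (ger0_norm p3) /oneDsqr ler_pdivlMr// ler_pdivrMl//.
rewrite -subr_ge0.
have -> : (1 + (c * x) ^+ 2) * (1 + (c ^+ 2)^-1) - (1 + x ^+ 2) = (c ^+ 2)^-1 + c ^+ 2 * x ^+ 2.
  by field.
by rewrite addr_ge0 ?invr_ge0 ?(ltW c20)// mulr_ge0 ?sqr_ge0.
Qed.

Lemma weight_integrable (c : R) : c != 0 ->
  Rintegrable mu (fun t => weight c (rv t)).
Proof.
move=> c0.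
have [[I _] _] := @Cintegral_prod R n (fun i x => real_complex R ((1 + (c * x) ^+ 2)^-1))
  (fun i => CintegrableR (integrable_oneDsqrV c0)).
move: I; congr (_.-integrable _ _); apply/funext => t /=; congr EFin.
rewrite -rmorph_prod/=; apply: eq_bigr => i _; by rewrite mxE.
Qed.

End row_vectors.

(** * Integration by parts along coordinate axes *)

Section directional_derivatives.
Context (R : realType) (n : nat).
Local Notation RR := (measurableTypeR R).
Local Notation V := ('rV[R]_n).
Local Notation T := (n.-tuple RR).
Local Notation mu := (lebesgue_tuple R n).
Local Notation rv := (@rv_of_tuple R n).
Implicit Types (G H : V -> R).

(** A derivative along lines only, so that one-variable rules apply and products of a [D_L1]
    function with Gaussians or linear functions can be differentiated without placing them in
    [D_L1]. *)
Definition has_partial (i : 'I_n) G G' : Prop :=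
  forall x, is_derive (0 : R) 1 (fun s : R => G (x + s *: delta_mx 0 i)) (G' x).

Definition line_continuous (i : 'I_n) G : Prop :=
  forall x, continuous (fun s : R => G (x + s *: delta_mx 0 i)).

Lemma has_partial_at i G G' x (s : R) : has_partial i G G' ->
  is_derive s 1 (fun s : R => G (x + s *: delta_mx 0 i)) (G' (x + s *: delta_mx 0 i)).
Proof.
move=> GG'; pose y := x + s *: delta_mx 0 i.
have d1 : is_derive s 1 (fun r : R => r - s) 1.
  by rewrite -[X in is_derive _ _ _ X]subr0; exact: is_deriveB.
have d2 : is_derive (s - s) 1 (fun r : R => G (y + r *: delta_mx 0 i)) (G' y).
  by rewrite subrr; exact: GG'.
have := @is_derive1_comp _ (fun r : R => G (y + r *: delta_mx 0 i)) (fun r : R => r - s) s _ _ d2 d1.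
rewrite mulr1; congr is_derive; apply/funext => r /=; congr G.
by rewrite /y -addrA -scalerDl; congr (_ + _ *: _); ring.
Qed.

Lemma has_partial_line_continuous i G G' : has_partial i G G' -> line_continuous i G.
Proof.
move=> GG' x s; apply/differentiable_continuous/derivable1_diffP.
by have [] := has_partial_at x s GG'.
Qed.

Lemma has_partialM i G G' H H' : has_partial i G G' -> has_partial i H H' ->
  has_partial i (fun x => G x * H x) (fun x => G' x * H x + G x * H' x).
Proof.
move=> GG' HH' x; have := is_deriveM (GG' x) (HH' x).
by rewrite scale0r addr0 /GRing.scale /=; congr is_derive; rewrite addrC mulrC.
Qed.

Lemma line_continuousD i G H : line_continuous i G -> line_continuous i H ->
  line_continuous i (fun x => G x + H x).
Proof. by move=> cG cH x s; apply: cvgD; [exact: cG|exact: cH]. Qed.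

Lemma line_continuousM i G H : line_continuous i G -> line_continuous i H ->
  line_continuous i (fun x => G x * H x).
Proof. by move=> cG cH x s; apply: cvgM; [exact: cG|exact: cH]. Qed.

Lemma line_continuous_cst i (r : R) : line_continuous i (fun=> r).
Proof. by move=> x s; exact: cvg_cst. Qed.

Lemma line_continuous_comp i G (f : R -> R) : continuous f -> line_continuous i G ->
  line_continuous i (fun x => f (G x)).
Proof.
move=> cf cG x s.
by apply: (@cvg_comp _ _ _ (fun s : R => G (x + s *: delta_mx 0 i)) f _ _ _ (cG x s)); exact: cf.
Qed.

Lemma has_partial_comp i G G' (f f' : R -> R) :
  (forall y : R, is_derive y 1 f (f' y)) -> has_partial i G G' ->
  has_partial i (fun x => f (G x)) (fun x => f' (G x) * G' x).
Proof.
move=> ff' GG' x.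
have := @is_derive1_comp _ f (fun s : R => G (x + s *: delta_mx 0 i)) 0 _ _ (ff' _) (GG' x).
by rewrite scale0r addr0.
Qed.

Lemma has_partial_affine i (L : V -> R) (w : R) :
  (forall x s, L (x + s *: delta_mx 0 i) = L x + s * w) ->
  has_partial i L (fun=> w).
Proof.
move=> Lw x.
rewrite (_ : (fun s : R => _) = (fun s : R => L x + s * w)); last by apply/funext => s; exact: Lw.
have d1 := is_deriveD (is_derive_cst (L x) (0:R) (1:R)) (is_deriveZ w (is_derive_id (0:R) (1:R))).
move: d1; rewrite /GRing.scale /= mulr1 add0r; congr is_derive; apply/funext => s.
by congr (_ + _); exact: mulrC.
Qed.

Lemma integral_partial0 i G G' : has_partial i G G' -> line_continuous i G' ->
  Rintegrable mu (G \o rv) -> Rintegrable mu (G' \o rv) ->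
  \int[mu]_t G' (rv t) = 0.
Proof.
move=> GG' cG' iG iG'.
pose phi (s : R) t := taddl (tuple_of_rv (s *: (delta_mx 0 i : V))) t.
apply: (@integral_flow_derivative _ _ _ mu phi (G \o rv) (G' \o rv)) => //.
- apply/measurable_fun_tnthP => j.
  rewrite (_ : _ \o _ = fun p : RR * T => p.1 * (delta_mx 0 i : V) 0 j + tnth p.2 j); last first.
    by apply/funext => -[s t]; rewrite /phi /= !tnth_mktuple mxE.
  apply: measurable_funD; first exact: measurable_funM.
  by apply: (@measurableT_comp _ _ _ _ _ _ (fun t : T => tnth t j)) => //; exact: measurable_tnth.
- by move=> s; exact: lebesgue_tuple_translation.
move=> t; rewrite /phi /= rv_of_tuple_add scale1r.
have D (s : R) := has_partial_at (rv t) s GG'.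
rewrite [X in G X - _]addrC.
have := FTC_unit D (cG' (rv t)); rewrite scale1r scale0r addr0 => ->.
by apply: eq_Rintegral => s _ /=; rewrite rv_of_tuple_add addrC.
Qed.

(** The axis derivatives of [g * cos L] and of [g * sin L] both integrate to 0; the two real
    identities are the components of the complex one. Serves both for Fourier decay and for
    multiplication by [xtilde]. *)
Lemma integration_by_parts_expi i (g g' L : V -> R) (w : R) :
  has_partial i g g' -> line_continuous i g' ->
  Rintegrable mu (g \o rv) -> Rintegrable mu (g' \o rv) ->
  measurable_fun setT (L \o rv) ->
  (forall x s, L (x + s *: delta_mx 0 i) = L x + s * w) ->
  Cintegral mu (fun t => real_complex R (g' (rv t)) * expi (L (rv t))) =
  Complex 0 (- w) * Cintegral mu (fun t => real_complex R (g (rv t)) * expi (L (rv t))).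
Proof.
move=> gg' cg' ig ig' mL Lw.
have hL := has_partial_affine Lw.
have cL := has_partial_line_continuous hL.
have cg := has_partial_line_continuous gg'.
have hc := has_partialM gg' (has_partial_comp (@is_derive_cos R) hL).
have hs := has_partialM gg' (has_partial_comp (@is_derive_sin R) hL).
have ccos := line_continuous_comp (@continuous_cos R) cL.
have csin := line_continuous_comp (@continuous_sin R) cL.
have mcos : measurable_fun setT (fun t => cos (L (rv t))) by exact: measurableT_comp (@measurable_cos R) mL.
have msin : measurable_fun setT (fun t => sin (L (rv t))) by exact: measurableT_comp (@measurable_sin R) mL.
have bcos (h : V -> R) : Rintegrable mu (h \o rv) ->
    Rintegrable mu (fun t => h (rv t) * cos (L (rv t))).
  move=> ih; apply: (le_EFin_integrable _ (integrable_norm ih)).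
    by apply: measurable_funM => //; exact: integrable_measurable ih.
  by move=> t; rewrite normrM ler_piMr// ler_norml cos_geN1 cos_le1.
have bsin (h : V -> R) : Rintegrable mu (h \o rv) ->
    Rintegrable mu (fun t => h (rv t) * sin (L (rv t))).
  move=> ih; apply: (le_EFin_integrable _ (integrable_norm ih)).
    by apply: measurable_funM => //; exact: integrable_measurable ih.
  by move=> t; rewrite normrM ler_piMr// ler_norml sin_geN1 sin_le1.
have ec t : g (rv t) * (- sin (L (rv t)) * w) = - w * (g (rv t) * sin (L (rv t))) by ring.
have es t : g (rv t) * (cos (L (rv t)) * w) = w * (g (rv t) * cos (L (rv t))) by ring.
have ic := bcos _ ig; have is_ := bsin _ ig; have ic' := bcos _ ig'; have is' := bsin _ ig'.
have Ic : \int[mu]_t (g' (rv t) * cos (L (rv t))) = w * \int[mu]_t (g (rv t) * sin (L (rv t))).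
  have : \int[mu]_t (g' (rv t) * cos (L (rv t)) + g (rv t) * (- sin (L (rv t)) * w)) = 0.
    apply: (@integral_partial0 i _ _ hc) => //.
    - apply: line_continuousD; first exact: line_continuousM.
      apply: line_continuousM => //; apply: line_continuousM; last exact: line_continuous_cst.
      by move=> x s; apply: cvgN; exact: csin.
    - apply: EFin_integrableD => //; under eq_fun do rewrite /= ec; exact: EFin_integrableZ.
  under eq_Rintegral do rewrite ec.
  rewrite RintegralD//; last exact: EFin_integrableZ.
  by rewrite RintegralZl// mulNr => /eqP; rewrite subr_eq0 => /eqP.
have Is : \int[mu]_t (g' (rv t) * sin (L (rv t))) = - w * \int[mu]_t (g (rv t) * cos (L (rv t))).
  have : \int[mu]_t (g' (rv t) * sin (L (rv t)) + g (rv t) * (cos (L (rv t)) * w)) = 0.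
    apply: (@integral_partial0 i _ _ hs) => //.
    - apply: line_continuousD; first exact: line_continuousM.
      by apply: line_continuousM => //; apply: line_continuousM => //; exact: line_continuous_cst.
    - apply: EFin_integrableD => //; under eq_fun do rewrite /= es; exact: EFin_integrableZ.
  under eq_Rintegral do rewrite es.
  rewrite RintegralD//; last exact: EFin_integrableZ.
  by rewrite RintegralZl// mulNr => /eqP; rewrite addr_eq0 => /eqP.
have Re1 (h : V -> R) t : complex.Re (real_complex R (h (rv t)) * expi (L (rv t))) = h (rv t) * cos (L (rv t)).
  by rewrite ReM /= mul0r subr0.
have Im1 (h : V -> R) t : complex.Im (real_complex R (h (rv t)) * expi (L (rv t))) = h (rv t) * sin (L (rv t)).
  by rewrite ImM /= mul0r addr0.
rewrite /Cintegral.
under eq_Rintegral do rewrite Re1.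
under [X in Complex _ X]eq_Rintegral do rewrite Im1.
under [X in _ * Complex X _]eq_Rintegral do rewrite Re1.
under [X in _ * Complex _ X]eq_Rintegral do rewrite Im1.
by apply: complexP; rewrite ?ReM ?ImM /= ?Ic ?Is; ring.
Qed.

End directional_derivatives.

(** * Fourier decay of [D_L1] functions *)

Section D_L1_theory.
Context (R : realType) (n : nat).
Local Notation V := ('rV[R]_n).
Local Notation mu := (lebesgue_tuple R n).
Local Notation rv := (@rv_of_tuple R n).
Local Notation cnorm := (@Normc.normc R).
Implicit Types (phi psi : V -> R).

Lemma D_L1_partial i phi : D_L1 phi -> D_L1 (partial i phi).
Proof. by move=> Dphi s; have := Dphi (rcons s i); rewrite foldr_rcons. Qed.

Lemma D_L1_differentiable phi x : D_L1 phi -> differentiable phi x.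
Proof. by move=> /(_ [::]) []. Qed.

Lemma D_L1_continuous phi : D_L1 phi -> continuous phi.
Proof. by move=> Dphi x; apply: differentiable_continuous; exact: D_L1_differentiable. Qed.

Lemma D_L1_integrable phi : D_L1 phi -> Rintegrable mu (phi \o rv).
Proof. by move=> /(_ [::]) []. Qed.

Lemma line_continuous_continuous i phi : continuous phi -> line_continuous i phi.
Proof.
move=> cphi x s.
apply: (@cvg_comp _ _ _ (fun s : R => x + s *: delta_mx 0 i) phi); last exact: cphi.
by apply: cvgD; [exact: cvg_cst|apply: cvgZ; [exact: cvg_id|exact: cvg_cst]].
Qed.

Lemma D_L1_has_partial i phi : D_L1 phi -> has_partial i phi (partial i phi).
Proof.
move=> Dphi x.
have E : (fun h : R => h^-1 *: ((fun s : R => phi (x + s *: delta_mx 0 i)) (h *: 1 + 0) -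
    phi (x + 0 *: delta_mx 0 i))) = (fun h : R => h^-1 *: (phi (h *: delta_mx 0 i + x) - phi x)).
  by apply/funext => h; rewrite addr0 scale0r addr0 [x + _]addrC [h *: 1]mulr1.
apply: DeriveDef.
  rewrite /derivable /= E.
  exact: (diff_derivable (D_L1_differentiable x Dphi)).
by rewrite /derive /= E.
Qed.

Lemma D_L1B phi psi : D_L1 phi -> D_L1 psi -> D_L1 (fun x => phi x - psi x).
Proof.
move=> Dphi Dpsi s.
have E : foldr (@partial R n) (fun x => phi x - psi x) s = (fun x => foldr (@partial R n) phi s x - foldr (@partial R n) psi s x).
  elim: s => [//|i s ih] /=; rewrite ih; apply/funext => x; rewrite /partial.
  have d1 : derivable (foldr (@partial R n) phi s) x (delta_mx 0 i) by exact: diff_derivable ((Dphi s).1 x).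
  have d2 : derivable (foldr (@partial R n) psi s) x (delta_mx 0 i) by exact: diff_derivable ((Dpsi s).1 x).
  exact: deriveB d1 d2.
have [d1 i1] := Dphi s; have [d2 i2] := Dpsi s.
rewrite E; split; first by move=> x; exact: differentiableB.
have := integrableB measurableT i1 i2; congr (_.-integrable _ _).
Qed.

(** The witness [psi] is [\prod_(i <- s) (1 - d_i^2)] applied to [phi]. Unlike [d_i] alone,
    [1 - d_i^2] has the symbol [1 + w_i^2], which never vanishes and can be divided out. The same
    [psi] serves for all frequencies. *)
Lemma D_L1_fourier_weight (s : seq 'I_n) phi : D_L1 phi ->
  exists2 psi, D_L1 psi &
    forall (L : V -> R) (w : V), measurable_fun setT (L \o rv) ->
      (forall i x (r : R), L (x + r *: delta_mx 0 i) = L x + r * w 0 i) ->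
      Cintegral mu (fun t => real_complex R (psi (rv t)) * expi (L (rv t))) =
      real_complex R (\prod_(i <- s) (1 + w 0 i ^+ 2)) *
      Cintegral mu (fun t => real_complex R (phi (rv t)) * expi (L (rv t))).
Proof.
move=> Dphi; elim: s => [|i s [psi Dpsi ih]].
  by exists phi => // L w _ _; rewrite big_nil mul1r.
have D1 := D_L1_partial i Dpsi; have D2 := D_L1_partial i D1.
exists (fun x => psi x - partial i (partial i psi) x); first exact: D_L1B.
move=> L w mL Lw.
have I (f : V -> R) : D_L1 f -> Cintegrable mu (fun t => real_complex R (f (rv t)) * expi (L (rv t))).
  move=> /D_L1_integrable fi.
  under eq_fun do rewrite mulrC.
  apply: (@Cintegrable_bM _ _ _ _ _ _ 1); last exact: CintegrableR.
    exact: Cmeasurable_expi.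
  by move=> t; rewrite cnorm_expi.
under [X in Cintegral _ X]eq_fun do rewrite rmorphB mulrBl.
rewrite CintegralB; [|exact: I..].
have P f : D_L1 f -> Cintegral mu (fun t => real_complex R (partial i f (rv t)) * expi (L (rv t))) =
    Complex 0 (- w 0 i) * Cintegral mu (fun t => real_complex R (f (rv t)) * expi (L (rv t))).
  move=> Df; apply: (@integration_by_parts_expi _ _ i) => //.
  - exact: D_L1_has_partial.
  - by apply: line_continuous_continuous; exact: D_L1_continuous (D_L1_partial i Df).
  - exact: D_L1_integrable.
  - exact: D_L1_integrable (D_L1_partial i Df).
rewrite (P _ D1) (P _ Dpsi) mulrA (ih L w)// big_cons.
rewrite mulrzC; set F := Cintegral _ _; set p := real_complex R (\prod_(j <- s) _).
have -> : Complex 0 (- w 0 i) * Complex 0 (- w 0 i) = - real_complex R (w 0 i ^+ 2).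
  by apply: complexP => /=; ring.
rewrite rmorphD rmorph1; ring.
Qed.

(** The constant is the L1 norm of the function [psi] obtained with every coordinate taken once, so
    it depends neither on the frequency [w] nor on the constant term of [L]. *)
Lemma D_L1_fourier_decay phi : D_L1 phi ->
  exists2 C, 0 <= C & forall (L : V -> R) (w : V), measurable_fun setT (L \o rv) ->
      (forall i x (r : R), L (x + r *: delta_mx 0 i) = L x + r * w 0 i) ->
      cnorm (Cintegral mu (fun t => real_complex R (phi (rv t)) * expi (L (rv t)))) <=
      C * weight 1 w.
Proof.
move=> Dphi; have [psi Dpsi H] := D_L1_fourier_weight (index_enum 'I_n) Dphi.
exists (\int[mu]_t `|psi (rv t)|); first by apply: Rintegral_ge0.
move=> L w mL Lw; have {}H := H L w mL Lw.
have p0 : 0 < \prod_i (1 + w 0 i ^+ 2).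
  by apply: prodr_gt0 => i _; rewrite ltr_pwDl// sqr_ge0.
have -> : weight 1 w = (\prod_i (1 + w 0 i ^+ 2))^-1.
  by rewrite /weight prodfV; congr (_^-1); apply: eq_bigr => i _; rewrite mul1r.
rewrite ler_pdivlMr// -[X in _ * X](ger0_norm (ltW p0)) -cnormR mulrC -cnormM -H.
apply: (le_trans (cnorm_Cintegral_le _)).
  under eq_fun do rewrite mulrC.
  apply: (@Cintegrable_bM _ _ _ _ _ _ 1); last exact: CintegrableR (D_L1_integrable Dpsi).
    exact: Cmeasurable_expi.
  by move=> t; rewrite cnorm_expi.
by under eq_Rintegral do rewrite cnormM cnorm_expi mulr1 cnormR.
Qed.

End D_L1_theory.

(** * The star product of integrable functions *)

Section symplectic_form.
Context (R : realType) (k : nat).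
Local Notation m := (k + k)%N.
Local Notation V := ('rV[R]_m).
Implicit Types x y z : V.

Lemma omegaC x y : omega y x = - omega x y.
Proof. by rewrite /omega -sumrN; apply: eq_bigr => i _; ring. Qed.

Lemma omegaDl x y z : omega (x + y) z = omega x z + omega y z.
Proof. by rewrite /omega -big_split; apply: eq_bigr => i _ /=; rewrite !mxE; ring. Qed.

Lemma omegaDr x y z : omega z (x + y) = omega z x + omega z y.
Proof. by rewrite /omega -big_split; apply: eq_bigr => i _ /=; rewrite !mxE; ring. Qed.

Lemma omegaZl (r : R) x y : omega (r *: x) y = r * omega x y.
Proof. by rewrite /omega mulr_sumr; apply: eq_bigr => i _ /=; rewrite !mxE; ring. Qed.

Lemma omegaZr (r : R) x y : omega x (r *: y) = r * omega x y.
Proof. by rewrite omegaC omegaZl omegaC mulrN opprK. Qed.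

Lemma omegaNl x y : omega (- x) y = - omega x y.
Proof. by rewrite -scaleN1r omegaZl mulN1r. Qed.

Lemma omegaxx x : omega x x = 0.
Proof. by rewrite /omega big1// => i _; ring. Qed.

Lemma measurable_omega d (S : measurableType d) (f g : S -> V) :
  (forall i, measurable_fun setT (fun s => f s 0 i)) ->
  (forall i, measurable_fun setT (fun s => g s 0 i)) ->
  measurable_fun setT (fun s => omega (f s) (g s)).
Proof.
move=> mf mg; apply: measurable_sum => i.
by apply: measurable_funB; exact: measurable_funM.
Qed.

(** The coefficients of the linear form [omega x]. They are the coordinates of [x] permuted up to
    sign, so phases take the usual Fourier form while [sqnorm] and [weight] are preserved. *)
Definition symplectic_row (x : V) : V := \row_i omega x (delta_mx 0 i).

Lemma omega_delta_lshift x (i : 'I_k) :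
  omega x (delta_mx 0 (lshift k i)) = - x 0 (rshift k i).
Proof.
rewrite /omega (bigD1 i)//= big1 ?addr0 => [|j ji].
  by rewrite !mxE /= !eqxx eq_rlshift /=; ring.
by rewrite !mxE /= eq_rlshift (inj_eq (@lshift_inj _ _)) (negbTE ji) /=; ring.
Qed.

Lemma omega_delta_rshift x (i : 'I_k) :
  omega x (delta_mx 0 (rshift k i)) = x 0 (lshift k i).
Proof.
rewrite /omega (bigD1 i)//= big1 ?addr0 => [|j ji].
  by rewrite !mxE /= !eqxx eq_lrshift /=; ring.
by rewrite !mxE /= eq_lrshift (inj_eq (@rshift_inj _ _)) (negbTE ji) /=; ring.
Qed.

Lemma sqnorm_symplectic_row x : sqnorm (symplectic_row x) = sqnorm x.
Proof.
rewrite /sqnorm !big_split_ord /= addrC; congr (_ + _); apply: eq_bigr => i _; rewrite !mxE.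
  by rewrite omega_delta_rshift.
by rewrite omega_delta_lshift sqrrN.
Qed.

Lemma weight_symplectic_row c x : weight c (symplectic_row x) = weight c x.
Proof.
rewrite /weight !big_split_ord /= mulrC; congr (_ * _); apply: eq_bigr => i _; rewrite !mxE.
  by rewrite omega_delta_rshift.
by rewrite omega_delta_lshift mulrN sqrrN.
Qed.

Lemma omega_symplectic_row x y : omega x y = \sum_i symplectic_row x 0 i * y 0 i.
Proof.
rewrite big_split_ord /= /omega -big_split; apply: eq_bigr => i _ /=.
by rewrite !mxE omega_delta_lshift omega_delta_rshift; ring.
Qed.

End symplectic_form.

Section star_product.
Context (R : realType) (k : nat) (theta : R).
Local Notation m := (k + k)%N.
Local Notation RR := (measurableTypeR R).
Local Notation V := ('rV[R]_m).
Local Notation T := (m.-tuple RR).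
Local Notation mu := (lebesgue_tuple R m).
Local Notation rv := (@rv_of_tuple R m).
Local Notation cnorm := (@Normc.normc R).
Local Notation "r %:C" := (real_complex R r).
Implicit Types (x y z : V) (f g q : V -> R[i]).

Definition phase x y z : R[i] := expi (2 / theta * (omega x y + omega y z + omega z x)).

Definition moyal_cst : R := ((pi * theta) ^+ m)^-1.

(** Up to [moyal_cst], the integral kernel of [f |-> star f g]: a Fourier integral of [g] at a
    frequency proportional to the symplectic row of [y - x], times a phase. By cyclic symmetry of
    [phase] it also gives [g |-> star f g], with the kernel of [f] and the arguments exchanged. *)
Definition kern g x y : R[i] := Cintegral mu (fun t => g (rv t) * phase x y (rv t)).

Definition star f g x : R[i] :=
  moyal_cst%:C * Cintegral (mu \x mu)%E (fun p =>
    f (rv p.1) * g (rv p.2) * phase x (rv p.1) (rv p.2)).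

Lemma cnorm_phase x y z : cnorm (phase x y z) = 1.
Proof. exact: cnorm_expi. Qed.

Lemma phase_rot x y z : phase x y z = phase y z x.
Proof. by rewrite /phase; congr expi; congr (_ * _); ring. Qed.

Lemma phaseJ x y z : conjc (phase x y z) = phase x z y.
Proof.
rewrite /phase -expiN (omegaC z x) (omegaC y z) (omegaC x y); congr expi; ring.
Qed.

Lemma Cmeasurable_phase d (S : measurableType d) (hx hy hz : S -> V) :
  (forall i, measurable_fun setT (fun s => hx s 0 i)) ->
  (forall i, measurable_fun setT (fun s => hy s 0 i)) ->
  (forall i, measurable_fun setT (fun s => hz s 0 i)) ->
  Cmeasurable (fun s => phase (hx s) (hy s) (hz s)).
Proof.
move=> mx my mz; apply: Cmeasurable_expi; apply: measurable_funM => //.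
by apply: measurable_funD; [apply: measurable_funD|]; exact: measurable_omega.
Qed.

Lemma measurable_coord1 d (S : measurableType d) i :
  measurable_fun setT (fun p : T * S => rv p.1 0 i).
Proof. by apply: (@measurableT_comp _ _ _ _ _ _ (fun t : T => rv t 0 i)) => //; exact: measurable_coord. Qed.

Lemma measurable_coord2 d (S : measurableType d) i :
  measurable_fun setT (fun p : S * T => rv p.2 0 i).
Proof. by apply: (@measurableT_comp _ _ _ _ _ _ (fun t : T => rv t 0 i)) => //; exact: measurable_coord. Qed.

Lemma measurable_coordB d (S : measurableType d) (hx hy : S -> V) i :
  (forall i, measurable_fun setT (fun s => hx s 0 i)) ->
  (forall i, measurable_fun setT (fun s => hy s 0 i)) ->
  measurable_fun setT (fun s => (hx s - hy s) 0 i).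
Proof.
move=> mx my; rewrite (_ : (fun s => _) = (fun s => hx s 0 i - hy s 0 i)).
  exact: measurable_funB.
by apply/funext => s; rewrite [LHS]mxE [X in _ + X]mxE.
Qed.

Lemma integrableRn_measurable f : integrableRn f -> Cmeasurable (f \o rv).
Proof. exact: Cintegrable_measurable. Qed.

Lemma Cmeasurable_fst d (S : measurableType d) f : Cmeasurable (f \o rv) ->
  Cmeasurable (fun p : T * S => f (rv p.1)).
Proof. by move=> mf; apply: (@Cmeasurable_comp _ _ _ _ _ fst (f \o rv)). Qed.

Lemma Cmeasurable_snd d (S : measurableType d) f : Cmeasurable (f \o rv) ->
  Cmeasurable (fun p : S * T => f (rv p.2)).
Proof. by move=> mf; apply: (@Cmeasurable_comp _ _ _ _ _ snd (f \o rv)). Qed.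

Lemma integrable_phase g x y : integrableRn g ->
  Cintegrable mu (fun t => g (rv t) * phase x y (rv t)).
Proof.
move=> ig; under eq_fun do rewrite mulrC.
apply: (@Cintegrable_bM _ _ _ _ _ (g \o rv) 1) => //.
  by apply: Cmeasurable_phase => i; try exact: measurable_cst; exact: measurable_coord.
by move=> t; rewrite cnorm_phase.
Qed.

Lemma cnorm_kern_le g x y : integrableRn g ->
  cnorm (kern g x y) <= \int[mu]_t cnorm (g (rv t)).
Proof.
move=> ig; apply: (le_trans (cnorm_Cintegral_le (integrable_phase x y ig))).
by under eq_Rintegral do rewrite cnormM cnorm_phase mulr1.
Qed.

Lemma Cmeasurable_kern d (S : measurableType d) (hx hy : S -> V) g :
  Cmeasurable (g \o rv) ->
  (forall i, measurable_fun setT (fun s => hx s 0 i)) ->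
  (forall i, measurable_fun setT (fun s => hy s 0 i)) ->
  Cmeasurable (fun s => kern g (hx s) (hy s)).
Proof.
move=> mg mx my.
apply: (@Cmeasurable_Cintegral_l _ _ _ _ _ mu (fun p : S * T => g (rv p.2) * phase (hx p.1) (hy p.1) (rv p.2))).
apply: CmeasurableM; first exact: Cmeasurable_snd.
apply: Cmeasurable_phase => i; last exact: measurable_coord2.
  by apply: (@measurableT_comp _ _ _ _ _ _ (fun s => hx s 0 i)).
by apply: (@measurableT_comp _ _ _ _ _ _ (fun s => hy s 0 i)).
Qed.

Lemma Cmeasurable_kern_r g x : integrableRn g -> Cmeasurable (fun t => kern g x (rv t)).
Proof.
move=> gi; apply: Cmeasurable_kern; first exact: integrableRn_measurable.
  by move=> i; exact: measurable_cst.
exact: measurable_coord.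
Qed.

Lemma Cmeasurable_kern_l g x : integrableRn g -> Cmeasurable (fun t => kern g (rv t) x).
Proof.
move=> gi; apply: Cmeasurable_kern; first exact: integrableRn_measurable.
  exact: measurable_coord.
by move=> i; exact: measurable_cst.
Qed.

Lemma integrable_mul_kern_r f g x : integrableRn f -> integrableRn g ->
  Cintegrable mu (fun t => f (rv t) * kern g x (rv t)).
Proof.
move=> fi gi; under eq_fun do rewrite mulrC.
apply: Cintegrable_bM fi; first exact: Cmeasurable_kern_r.
by move=> t; exact: cnorm_kern_le.
Qed.

Lemma integrable_mul_kern_l f g x : integrableRn f -> integrableRn g ->
  Cintegrable mu (fun t => f (rv t) * kern g (rv t) x).
Proof.
move=> fi gi; under eq_fun do rewrite mulrC.
apply: Cintegrable_bM fi; first exact: Cmeasurable_kern_l.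
by move=> t; exact: cnorm_kern_le.
Qed.

Lemma integrable_star_integrand f g x : integrableRn f -> integrableRn g ->
  Cintegrable (mu \x mu)%E (fun p => f (rv p.1) * g (rv p.2) * phase x (rv p.1) (rv p.2)).
Proof.
move=> fi gi; under eq_fun do rewrite mulrC.
apply: (@Cintegrable_bM _ _ _ _ _ (fun p : T * T => f (rv p.1) * g (rv p.2)) 1).
- apply: Cmeasurable_phase => i; first exact: measurable_cst.
    exact: measurable_coord1.
  exact: measurable_coord2.
- by move=> p; rewrite cnorm_phase.
- exact: (@Cintegrable_tensor _ _ _ _ _ mu mu (f \o rv) (g \o rv)).
Qed.

Lemma starE_l f g x : integrableRn f -> integrableRn g ->
  star f g x = moyal_cst%:C * Cintegral mu (fun t => f (rv t) * kern g x (rv t)).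
Proof.
move=> fi gi; rewrite /star Cintegral_fubini_l; last exact: integrable_star_integrand.
congr (_ * Cintegral _ _); apply/funext => t /=.
under [X in Cintegral _ X]eq_fun do rewrite -mulrA.
by rewrite CintegralZ//; exact: integrable_phase.
Qed.

Lemma starE_r f g x : integrableRn f -> integrableRn g ->
  star f g x = moyal_cst%:C * Cintegral mu (fun t => g (rv t) * kern f (rv t) x).
Proof.
move=> fi gi; rewrite /star Cintegral_fubini_r; last exact: integrable_star_integrand.
congr (_ * Cintegral _ _); apply/funext => t /=.
under [X in Cintegral _ X]eq_fun do rewrite [f _ * _]mulrC -mulrA -phase_rot -phase_rot phase_rot phase_rot -phase_rot.
by rewrite CintegralZ//; exact: integrable_phase.
Qed.

Lemma cnorm_star_le f g x : integrableRn f -> integrableRn g ->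
  cnorm (star f g x) <= `|moyal_cst| * (\int[mu]_t cnorm (f (rv t)) * \int[mu]_t cnorm (g (rv t))).
Proof.
move=> fi gi; rewrite starE_l// cnormM cnormR ler_wpM2l//.
have ii := integrable_mul_kern_r x fi gi.
apply: (le_trans (cnorm_Cintegral_le ii)).
rewrite mulrC -RintegralZl//; last exact: Cintegrable_cnorm fi.
apply: le_Rintegral => //.
- exact: Cintegrable_cnorm.
- by apply: EFin_integrableZ; exact: Cintegrable_cnorm fi.
- by move=> t _; rewrite cnormM mulrC ler_wpM2r ?cnorm_ge0// cnorm_kern_le.
Qed.

Lemma Cmeasurable_star f g : integrableRn f -> integrableRn g ->
  Cmeasurable (star f g \o rv).
Proof.
move=> fi gi; rewrite /comp; under eq_fun do rewrite starE_l//.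
apply: CmeasurableM; first exact: Cmeasurable_cst.
apply: (@Cmeasurable_Cintegral_l _ _ _ _ _ mu
  (fun p : T * T => f (rv p.2) * kern g (rv p.1) (rv p.2))).
apply: CmeasurableM; first by apply: Cmeasurable_snd; exact: integrableRn_measurable.
apply: Cmeasurable_kern; first exact: integrableRn_measurable.
  exact: measurable_coord1.
exact: measurable_coord2.
Qed.

(** Both sides are the double integral of [kern g x y * q x * f y], read in the two orders: cyclic
    symmetry of [phase] makes the same kernel appear, and its boundedness makes Fubini apply. *)
Lemma integral_star_mul f g q : integrableRn f -> integrableRn g -> integrableRn q ->
  integralRn (fun x => star f g x * q x) = integralRn (fun x => f x * star g q x).
Proof.
move=> fi gi qi.
have I : Cintegrable (mu \x mu)%E
    (fun p => kern g (rv p.1) (rv p.2) * (q (rv p.1) * f (rv p.2))).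
  apply: (@Cintegrable_bM _ _ _ _ _ (fun p : T * T => q (rv p.1) * f (rv p.2))
     (\int[mu]_t cnorm (g (rv t)))).
  - apply: Cmeasurable_kern; first exact: integrableRn_measurable.
      exact: measurable_coord1.
    exact: measurable_coord2.
  - by move=> p; exact: cnorm_kern_le.
  - exact: (@Cintegrable_tensor _ _ _ _ _ mu mu (q \o rv) (f \o rv)).
have E1 t : star f g (rv t) * q (rv t) =
    moyal_cst%:C * Cintegral mu (fun s => kern g (rv t) (rv s) * (q (rv t) * f (rv s))).
  rewrite starE_l// -mulrA mulrC [_ * q _]mulrC mulrC; congr (_ * _).
  rewrite -CintegralZ; last exact: integrable_mul_kern_r.
  by congr Cintegral; apply/funext => s; ring.
have E2 s : f (rv s) * star g q (rv s) =
    moyal_cst%:C * Cintegral mu (fun t => kern g (rv t) (rv s) * (q (rv t) * f (rv s))).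
  rewrite starE_r// mulrCA; congr (_ * _).
  rewrite -CintegralZ; last exact: integrable_mul_kern_l.
  by congr Cintegral; apply/funext => t; ring.
rewrite /integralRn /comp.
under eq_fun do rewrite E1.
under [in RHS]eq_fun do rewrite E2.
have I1 : Cintegrable mu (fun t => Cintegral mu (fun s =>
    kern g (rv t) (rv s) * (q (rv t) * f (rv s)))) := Cintegrable_fubini_l I.
have I2 : Cintegrable mu (fun s => Cintegral mu (fun t =>
    kern g (rv t) (rv s) * (q (rv t) * f (rv s)))) := Cintegrable_fubini_r I.
etransitivity; first exact: (CintegralZ (moyal_cst%:C) I1).
etransitivity; last by apply/esym; exact: (CintegralZ (moyal_cst%:C) I2).
exact: (congr1 (fun w => moyal_cst%:C * w) (Cintegral_exchange I)).
Qed.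

Lemma integrableRnJ f : integrableRn f -> integrableRn (fun x => conjc (f x)).
Proof. by move=> fi; exact: CintegrableJ fi. Qed.

Lemma starJ f g x : integrableRn f -> integrableRn g ->
  conjc (star f g x) = star (fun x => conjc (g x)) (fun x => conjc (f x)) x.
Proof.
move=> fi gi; rewrite starE_l// starE_r; [|exact: integrableRnJ..].
rewrite conjcM conjcR; congr (_ * _).
rewrite -CintegralJ; last exact: integrable_mul_kern_r.
congr Cintegral; apply/funext => t; rewrite conjcM; congr (_ * _).
rewrite /kern -CintegralJ; last exact: integrable_phase.
congr Cintegral; apply/funext => s; rewrite conjcM phaseJ; congr (_ * _).
by rewrite phase_rot phase_rot -phase_rot phase_rot.
Qed.

(** The damping factor is a product over the two variables. Every statement about [moyal] thereby
    becomes one about [star] of damped functions. *)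
Lemma moyal_regE (eps : R) f g x :
  moyal_reg theta eps f g x =
  star (fun y => (gauss eps y)%:C * f y) (fun z => (gauss eps z)%:C * g z) x.
Proof.
rewrite /moyal_reg /star; congr (_ * Cintegral _ _); apply/funext => p /=.
rewrite mulrDr expRD rmorphM/= /gauss /phase; ring.
Qed.

Lemma star_cvg (f_ g_ : nat -> V -> R[i]) f g (F G : V -> R) x :
  (forall n, Cmeasurable (f_ n \o rv)) -> (forall n, Cmeasurable (g_ n \o rv)) ->
  Rintegrable mu (F \o rv) -> Rintegrable mu (G \o rv) ->
  (forall n x, cnorm (f_ n x) <= F x) -> (forall n x, cnorm (g_ n x) <= G x) ->
  (forall x, ccvg (f_ ^~ x) (f x)) -> (forall x, ccvg (g_ ^~ x) (g x)) ->
  ccvg (fun n => star (f_ n) (g_ n) x) (star f g x).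
Proof.
move=> mf mg iF iG fF gG ff gg; apply: ccvgZ.
have [] := @Cintegral_dct _ _ _ (mu \x mu)%E
  (fun n p => f_ n (rv p.1) * g_ n (rv p.2) * phase x (rv p.1) (rv p.2))
  (fun p => f (rv p.1) * g (rv p.2) * phase x (rv p.1) (rv p.2))
  (fun p => F (rv p.1) * G (rv p.2)) => //.
- move=> n; apply: CmeasurableM; first apply: CmeasurableM.
  + exact: Cmeasurable_fst.
  + exact: Cmeasurable_snd.
  + apply: Cmeasurable_phase => i; first exact: measurable_cst.
      exact: measurable_coord1.
    exact: measurable_coord2.
- exact: (@integrable_tensor _ _ _ _ _ mu mu (F \o rv) (G \o rv)).
- move=> n p; rewrite !cnormM cnorm_phase mulr1; apply: ler_pM; rewrite ?cnorm_ge0//.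
- move=> p; apply: ccvgM; last exact: ccvg_cst.
  by apply: ccvgM.
Qed.

(** The one-sided limit is tested along positive sequences tending to 0, the form in which dominated
    convergence applies. *)
Lemma moyal_cvg f g x l :
  (forall u : nat -> R, (forall n, 0 < u n) -> u n @[n --> \oo] --> (0 : R) ->
    ccvg (fun n => moyal_reg theta (u n) f g x) l) ->
  moyal theta f g x = l.
Proof.
move=> H; apply: complexP => /=; apply: cvg_lim => //; apply/cvg_at_rightP => u [u0 uc];
  by have [] := H u u0 uc.
Qed.

Lemma gauss_cvg (u : nat -> R) x : u n @[n --> \oo] --> (0 : R) ->
  ccvg (fun n => (gauss (u n) x)%:C) 1.
Proof.
move=> u0; rewrite -[X in ccvg _ X](rmorph1 (real_complex R)); apply: ccvgR.
rewrite -(expR0 R); apply: continuous_cvg; first exact: continuous_expR.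
have H : - u n * sqnorm x @[n --> \oo] --> - 0 * sqnorm x.
  by apply: cvgM; [exact: cvgN|exact: cvg_cst].
by rewrite oppr0 mul0r in H.
Qed.

Lemma measurable_gauss_shift (a : R) x : measurable_fun setT (fun t => gauss a (rv t - x)).
Proof.
apply: measurable_gauss_comp => i.
by apply: measurable_coordB => j; [exact: measurable_coord|exact: measurable_cst].
Qed.

Lemma damp_cvg (u : nat -> R) (phi : V -> R) x : u n @[n --> \oo] --> (0 : R) ->
  ccvg (fun n => toC (damp (u n) phi) x) (toC phi x).
Proof.
move=> uc; rewrite -[X in ccvg _ X]mul1r /toC /damp; under [X in ccvg X _]eq_fun do rewrite mulrzC.
by apply: ccvgM; [exact: gauss_cvg|exact: ccvg_cst].
Qed.

Lemma Cmeasurable_gaussM (a : R) f : Cmeasurable (f \o rv) ->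
  Cmeasurable (fun t => (gauss a (rv t))%:C * f (rv t)).
Proof.
move=> mf; apply: CmeasurableM => //; apply: CmeasurableR.
apply: measurable_gauss_comp; exact: measurable_coord.
Qed.

Lemma cnorm_gaussM_le (a : R) f x : 0 <= a -> cnorm ((gauss a x)%:C * f x) <= cnorm (f x).
Proof.
move=> a0; rewrite cnormM cnormR ger0_norm ?gauss_ge0// ler_piMl ?cnorm_ge0//.
exact: gauss_le1.
Qed.

Lemma moyal_star f g x : integrableRn f -> integrableRn g ->
  moyal theta f g x = star f g x.
Proof.
move=> fi gi; apply: moyal_cvg => u u0 uc.
under [X in ccvg X _]eq_fun do rewrite moyal_regE.
apply: (@star_cvg _ _ _ _ (fun x => cnorm (f x)) (fun x => cnorm (g x))).
- by move=> n; apply: Cmeasurable_gaussM; exact: integrableRn_measurable.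
- by move=> n; apply: Cmeasurable_gaussM; exact: integrableRn_measurable.
- exact: Cintegrable_cnorm fi.
- exact: Cintegrable_cnorm gi.
- by move=> n y; apply: cnorm_gaussM_le; exact: ltW.
- by move=> n y; apply: cnorm_gaussM_le; exact: ltW.
- by move=> y; rewrite -[X in ccvg _ X]mul1r; apply: ccvgM; [exact: gauss_cvg|exact: ccvg_cst].
- by move=> y; rewrite -[X in ccvg _ X]mul1r; apply: ccvgM; [exact: gauss_cvg|exact: ccvg_cst].
Qed.

(** The kernel of starring with [g] is dominated by an integrable convolution kernel. *)
Definition decaying g : Prop :=
  exists2 C, 0 <= C & forall x y, cnorm (kern g x y) <= C * weight (2 / theta) (x - y).

Hypothesis theta0 : theta != 0.

Lemma D_L1_integrableRn (phi : V -> R) : D_L1 phi -> integrableRn (toC phi).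
Proof. by move=> /D_L1_integrable; exact: CintegrableR. Qed.

(** As a function of its last argument the phase is affine with frequency [(2 / theta)] times the
    symplectic row of [y - x], so [kern] is covered by the Fourier decay of [phi]. *)
Lemma D_L1_decaying (phi : V -> R) : D_L1 phi -> decaying (toC phi).
Proof.
move=> /D_L1_fourier_decay[C C0 H]; exists C => // x y.
have -> : weight (2 / theta) (x - y) = weight 1 (symplectic_row ((2 / theta) *: (y - x))).
  rewrite weight_symplectic_row -weightN opprB /weight; apply: eq_bigr => i _.
  by rewrite mul1r !mxE.
apply: (H (fun z => 2 / theta * (omega x y + omega y z + omega z x))).
  apply: measurable_funM => //; apply: measurable_funD; first apply: measurable_funD => //.
    by apply: measurable_omega => i; [exact: measurable_cst|exact: measurable_coord].
  by apply: measurable_omega => i; [exact: measurable_coord|exact: measurable_cst].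
move=> i z r; rewrite mxE omegaZl omegaDl omegaNl !omegaDr !omegaDl omegaZr omegaZl.
rewrite (omegaC x (delta_mx 0 i)); ring.
Qed.

(** [cnorm_star_le] bounds the product pointwise but does not integrate it; the decay of [kern g]
    does, through the Schur test with a translate of [weight]. *)
Lemma decaying_integrable f g : integrableRn f -> integrableRn g -> decaying g ->
  integrableRn (star f g) /\
  Cintegrable (mu \x mu)%E (fun p => f (rv p.2) * kern g (rv p.1) (rv p.2)).
Proof.
move=> fi gi [C C0 H].
have th : 2 / theta != 0 by rewrite mulf_neq0// invr_neq0.
have mw : measurable_fun setT (fun p : T * T => C * weight (2 / theta) (rv p.1 - rv p.2)).
  apply: measurable_funM => //; apply: measurable_weight => i.
  apply: measurable_coordB => j; first exact: measurable_coord1.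
  exact: measurable_coord2.
have I : Cintegrable (mu \x mu)%E (fun p => f (rv p.2) * kern g (rv p.1) (rv p.2)).
  apply: (@le_Cintegrable _ _ _ _ _ (fun p => cnorm (f (rv p.2)) * (C * weight (2 / theta) (rv p.1 - rv p.2)))).
  - apply: CmeasurableM; first by apply: Cmeasurable_snd; exact: integrableRn_measurable.
    apply: Cmeasurable_kern; first exact: integrableRn_measurable.
      exact: measurable_coord1.
    exact: measurable_coord2.
  - apply: (@integrable_kernel_r _ _ _ _ _ mu mu
      (fun p => C * weight (2 / theta) (rv p.1 - rv p.2)) (fun t => cnorm (f (rv t)))
      (C * \int[mu]_t weight (2 / theta) (rv t))) => //.
    + by move=> p; rewrite mulr_ge0// weight_ge0.
    + move=> s.
      have J := EFin_integrableZ C (translation_integrable (- rv s) (weight_integrable m th)).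
      rewrite -RintegralZl//; last exact: weight_integrable.
      rewrite -(translation_Rintegral (f := fun x => C * weight (2 / theta) x) (- rv s)); last first.
        apply: measurable_funM => //; apply: measurable_weight; exact: measurable_coord.
      rewrite EFin_Rintegral//.
      by under eq_integral do rewrite addrC.
    + exact: Cintegrable_cnorm fi.
  - by move=> p; rewrite cnormM ler_wpM2l ?cnorm_ge0.
split => //.
rewrite /integrableRn /comp; under eq_fun do rewrite starE_l//.
apply: CintegrableZ; exact: (Cintegrable_fubini_l I).
Qed.

End star_product.

(** * Gaussians and the trace property *)

Section gaussian_kernel.
Context (R : realType) (k : nat).
Local Notation m := (k + k)%N.
Local Notation V := ('rV[R]_m).
Local Notation mu := (lebesgue_tuple R m).
Local Notation rv := (@rv_of_tuple R m).
Local Notation cnorm := (@Normc.normc R).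
Local Notation "r %:C" := (real_complex R r).
Implicit Types (x y z : V) (f g h : V -> R[i]) (A : R).

(** The heat kernel at time [1 / (4A)] in dimension [2k], whence the exponent [k]; it concentrates
    at the origin as [A] grows. *)
Definition heat (A : R) (u : V) : R := (A / pi) ^+ k * gauss A u.

Lemma heat_ge0 A x : 0 < A -> 0 <= heat A x.
Proof. by move=> A0; rewrite mulr_ge0 ?gauss_ge0// exprn_ge0// divr_ge0// ?(ltW (pi_gt0 R))// ltW. Qed.

Lemma heatN A x : heat A (- x) = heat A x.
Proof. by rewrite /heat gaussN. Qed.

Lemma heatB A x y : heat A (x - y) = heat A (y - x).
Proof. by rewrite -heatN opprB. Qed.

Lemma measurable_heat A d (S : measurableType d) (h : S -> V) :
  (forall i, measurable_fun setT (fun s => h s 0 i)) ->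
  measurable_fun setT (fun s => heat A (h s)).
Proof. by move=> mh; apply: measurable_funM => //; exact: measurable_gauss_comp. Qed.

Lemma measurable_heat_shift (A : R) x : measurable_fun setT (fun t => heat A (rv t - x)).
Proof.
apply: measurable_heat => i.
by apply: measurable_coordB => j; [exact: measurable_coord|exact: measurable_cst].
Qed.

Lemma sqrt_addn (a : R) : 0 <= a -> Num.sqrt a ^+ m = a ^+ k.
Proof. by move=> a0; rewrite exprD -exprMn -expr2 sqr_sqrtr. Qed.

Lemma heat_integrable A x : 0 < A ->
  Rintegrable mu (fun t => heat A (rv t - x)) /\
  \int[mu]_t heat A (rv t - x) = 1.
Proof.
move=> A0; have [I J] := gauss_integrable m A0.
have I1 : Rintegrable mu (heat A \o rv) by exact: EFin_integrableZ.
split.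
  have := translation_integrable (- x) I1.
  by under eq_fun do rewrite /= addrC.
have := translation_Rintegral (f := heat A) (- x) (integrable_measurable I1).
under eq_Rintegral do rewrite addrC.
move=> ->; rewrite /heat RintegralZl// J sqrt_addn; last by rewrite divr_ge0 ?(ltW (pi_gt0 R))// ltW.
rewrite -exprMn (_ : A / pi * (pi / A) = 1) ?expr1n//.
by rewrite mulrA divfK ?divff// lt0r_neq0// pi_gt0.
Qed.

(** Writing [A = (A - 1) + 1] keeps one fixed unit Gaussian to integrate against, and makes the rest
    small at squared distance at least [d] from the origin. *)
Lemma heat_le (A d : R) x : 1 <= A -> 0 <= d -> d <= sqnorm x ->
  heat A x <= (A / pi) ^+ k * expR (- ((A - 1) * d)) * gauss 1 x.
Proof.
move=> A1 d0 dx; have A0 : 0 < A by rewrite (lt_le_trans _ A1).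
rewrite /heat -mulrA ler_wpM2l//; first by rewrite exprn_ge0// divr_ge0// ?(ltW (pi_gt0 R))// ltW.
rewrite -{1}(subrK 1 A) gaussD ler_wpM2r ?gauss_ge0//.
by rewrite /gauss ler_expR mulNr lerN2 ler_wpM2l// subr_ge0.
Qed.

Lemma heat_tail_cvg (A_ : nat -> R) (d : R) : 0 < d -> (forall n, 0 < A_ n) ->
  (A_ n)^-1 @[n --> \oo] --> (0 : R) ->
  (A_ n / pi) ^+ k * expR (- ((A_ n - 1) * d)) @[n --> \oo] --> (0 : R).
Proof.
move=> d0 A0 Aoo.
have pi0 := pi_gt0 R.
(* From [exp y >= y^(k+1) / (k+1)!] at [y = (A - 1) d], which is at least [A d / 2] once [A >= 2].
   One power more than in [A^k] leaves a bound [c / A]. *)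
pose c := (k.+1)`!%:R * ((2 / d) ^+ k.+1) * pi^-1 ^+ k : R.
have cA : c * (A_ n)^-1 @[n --> \oo] --> (0 : R).
  by rewrite -[X in _ --> X](mulr0 c); apply: cvgM => //; exact: cvg_cst.
apply: (@squeeze_cvgr _ _ _ _ (cst 0) _ _ _ _ _ cA); last exact: cvg_cst.
have /cvgrPdist_le/(_ 2^-1 ltac:(by rewrite invr_gt0)) := Aoo; apply: filterS => n.
rewrite sub0r normrN ger0_norm ?invr_ge0 ?(ltW (A0 n))// => A2 /=.
have {}A2 : 2 <= A_ n by rewrite -[leLHS]invrK -[leRHS]invrK lef_pV2// posrE invr_gt0.
have p0 : 0 <= A_ n / pi by rewrite divr_ge0 ?(ltW pi0)// ltW.
rewrite mulr_ge0 ?exprn_ge0 ?expR_ge0//=.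
set y := (A_ n - 1) * d.
have yA : A_ n * d / 2 <= y by rewrite /y; nra.
have yp : 0 < A_ n * d / 2 by rewrite divr_gt0// mulr_gt0.
have y0 : 0 < y by rewrite (lt_le_trans yp).
have f0 : 0 < (k.+1)`!%:R :> R by rewrite ltr0n fact_gt0.
have ey : (A_ n * d / 2) ^+ k.+1 / (k.+1)`!%:R <= expR y.
  rewrite (le_trans _ (expR_ge1Dxn k (ltW y0)))//.
  rewrite (le_trans _ (ler_wpDl _ (lexx _)))// ler_pM2r ?invr_gt0//.
  by rewrite lerXn2r// nnegrE ltW.
rewrite expRN.
have e1 : 0 < (A_ n * d / 2) ^+ k.+1 / (k.+1)`!%:R by rewrite divr_gt0// exprn_gt0.
have e2 : (expR y)^-1 <= ((A_ n * d / 2) ^+ k.+1 / (k.+1)`!%:R)^-1.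
  by rewrite lef_pV2// posrE expR_gt0.
apply: (le_trans (ler_wpM2l (exprn_ge0 _ p0) e2)).
rewrite le_eqVlt; apply/orP; left; apply/eqP.
rewrite /c !exprMn !exprS !exprVn; field.
by rewrite !expf_neq0 ?gt_eqF ?A0// ?lt0r_neq0.
Qed.

Definition ccontinuous_at (h : V -> R[i]) x : Prop :=
  (complex.Re (h y) @[y --> x] --> complex.Re (h x)) /\
  (complex.Im (h y) @[y --> x] --> complex.Im (h x)).

Lemma ccontinuousM g h x : ccontinuous_at g x -> ccontinuous_at h x ->
  ccontinuous_at (fun y => g y * h y) x.
Proof.
move=> [g1 g2] [h1 h2]; split.
  by rewrite ReM; under eq_cvg do rewrite ReM; apply: (@cvgB _ _ _ (nbhs x)); apply: (@cvgM _ _ (nbhs x)).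
by rewrite ImM; under eq_cvg do rewrite ImM; apply: (@cvgD _ _ _ (nbhs x)); apply: (@cvgM _ _ (nbhs x)).
Qed.

Lemma ccontinuousR (h : V -> R) x : {for x, continuous h} ->
  ccontinuous_at (fun y => (h y)%:C) x.
Proof.
move=> ch; have c0 : (0 : R) @[y --> x] --> (0 : R).
  exact: (@cvg_cst R (0 : R) V (nbhs x) _).
by split; [exact: ch|exact: c0].
Qed.

Lemma ccontinuous_expi (h : V -> R) x : {for x, continuous h} ->
  ccontinuous_at (fun y => expi (h y)) x.
Proof.
move=> ch; split.
  exact: (@cvg_comp _ _ _ h (@cos R) _ _ _ ch (@continuous_cos R (h x))).
exact: (@cvg_comp _ _ _ h (@sin R) _ _ _ ch (@continuous_sin R (h x))).
Qed.

Lemma ccontinuous_near h x (e : R) : ccontinuous_at h x -> 0 < e ->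
  exists2 d, 0 < d & forall y, sqnorm (y - x) < d -> cnorm (h y - h x) <= e.
Proof.
move=> [h1 h2] e0; have e20 : 0 < e / 2 by rewrite divr_gt0.
have /cvgrPdist_le/(_ _ e20)/nbhs_ballP[r1 /= r10 H1] := h1.
have /cvgrPdist_le/(_ _ e20)/nbhs_ballP[r2 /= r20 H2] := h2.
pose r := Num.min r1 r2.
have r0 : 0 < r by rewrite lt_min r10.
exists (r ^+ 2); first exact: exprn_gt0.
move=> y yx.
have B i : `|x 0 i - y 0 i| < r.
  rewrite -(ltr_pXn2r (n := 2))// ?nnegrE ?ltW// real_normK ?num_real//.
  apply: le_lt_trans yx; rewrite -sqrrN opprB.
  by have := coord_sqnorm_le (y - x) i; rewrite !mxE.
have b1 : ball x r1 y.
  by split => // i j; rewrite (ord1 i) /ball/= (lt_le_trans (B j))// ge_min lexx.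
have b2 : ball x r2 y.
  by split => // i j; rewrite (ord1 i) /ball/= (lt_le_trans (B j))// ge_min lexx orbT.
have := H1 _ b1; have := H2 _ b2 => /= n2 n1.
apply: (le_trans (cnorm_le _)); rewrite ReB ImB (splitr e) lerD// distrC//.
Qed.

(** An approximate identity for functions that need only be integrable against one Gaussian, so that
    it reaches [xtilde * phi]. The integrals are known to exist once [A_ n >= 1], hence the eventual
    statement. *)
Lemma heat_approx (A_ : nat -> R) h x : (forall n, 0 < A_ n) ->
  (A_ n)^-1 @[n --> \oo] --> (0 : R) ->
  Cintegrable mu (fun t => (gauss 1 (rv t - x))%:C * h (rv t)) ->
  Cmeasurable (h \o rv) -> ccontinuous_at h x ->
  (\forall n \near \oo, Cintegrable mu (fun t => h (rv t) * (heat (A_ n) (rv t - x))%:C)) /\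
  ccvg (fun n => Cintegral mu (fun t => h (rv t) * (heat (A_ n) (rv t - x))%:C)) (h x).
Proof.
move=> A0 Aoo ih mh ch.
have pi0 := pi_gt0 R.
have A1 : \forall n \near \oo, 1 <= A_ n.
  have /cvgrPdist_le/(_ 1 ltr01) := Aoo; apply: filterS => n.
  rewrite sub0r normrN ger0_norm ?invr_ge0 ?(ltW (A0 n))// => A2.
  by rewrite -[leLHS]invr1 -[leRHS]invrK lef_pV2// posrE// invr_gt0.
pose G t := gauss 1 (rv t - x) * cnorm (h (rv t)).
have iG : Rintegrable mu G.
  have := Cintegrable_cnorm ih; under eq_fun do rewrite cnormM cnormR ger0_norm ?gauss_ge0//.
  by [].
pose G0 t := gauss 1 (rv t - x).
have iG0 : Rintegrable mu G0.
  have [I _] := gauss_integrable m (@ltr01 R).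
  by have := translation_integrable (- x) I; under eq_fun do rewrite /= addrC.
pose tail d n := (A_ n / pi) ^+ k * expR (- ((A_ n - 1) * d)).
have tail0 d n : 0 <= tail d n.
  by rewrite mulr_ge0 ?expR_ge0// exprn_ge0// divr_ge0 ?(ltW pi0) ?(ltW (A0 n)).
have mint n : Cmeasurable (fun t => h (rv t) * (heat (A_ n) (rv t - x))%:C).
  by apply: CmeasurableM => //; apply: CmeasurableR; exact: measurable_heat_shift.
have I1 n : 1 <= A_ n -> Cintegrable mu (fun t => h (rv t) * (heat (A_ n) (rv t - x))%:C).
  move=> An; apply: (@le_Cintegrable _ _ _ _ _ (fun t => tail 0 n * G t)) => //.
    exact: EFin_integrableZ.
  move=> t; rewrite cnormM cnormR ger0_norm ?heat_ge0// mulrC /G mulrA ler_wpM2r ?cnorm_ge0//.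
  by apply: heat_le => //; exact: sqnorm_ge0.
split; first by apply: filterS A1 => n; exact: I1.
apply: (@squeeze_ccvg _ _ _ (fun n => cnorm (Cintegral mu (fun t => h (rv t) * (heat (A_ n) (rv t - x))%:C) - h x))) => //.
apply/cvgrPdist_le => e e0; have e20 : 0 < e / 2 by rewrite divr_gt0.
have [d d0 H] := ccontinuous_near ch e20.
pose K := \int[mu]_t (G t + cnorm (h x) * G0 t).
have iK : Rintegrable mu (fun t => G t + cnorm (h x) * G0 t).
  by apply: EFin_integrableD => //; exact: EFin_integrableZ.
have tK : tail d n * K @[n --> \oo] --> (0 : R).
  rewrite -[X in _ --> X](mul0r K); apply: cvgM; last exact: cvg_cst.
  exact: heat_tail_cvg.
have /cvgrPdist_le/(_ _ e20) := tK; apply: filterS2 A1 => n An.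
rewrite !sub0r !normrN (ger0_norm (cnorm_ge0 _)) => tn.
have [iN JN] := heat_integrable x (A0 n).
have E : Cintegral mu (fun t => h (rv t) * (heat (A_ n) (rv t - x))%:C) - h x =
   Cintegral mu (fun t => (h (rv t) - h x) * (heat (A_ n) (rv t - x))%:C).
  under [in RHS]eq_fun do rewrite mulrBl.
  rewrite (CintegralB (I1 n An)); last by apply: CintegrableZ; exact: CintegrableR.
  by rewrite CintegralZ ?CintegralR ?JN ?mulr1//; exact: CintegrableR.
rewrite E.
have I2 : Cintegrable mu (fun t => (h (rv t) - h x) * (heat (A_ n) (rv t - x))%:C).
  under eq_fun do rewrite mulrBl -mulNr.
  by apply: CintegrableD; [exact: I1|apply: CintegrableZ; exact: CintegrableR].
apply: (le_trans (cnorm_Cintegral_le I2)).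
have iR : Rintegrable mu (fun t => e / 2 * heat (A_ n) (rv t - x) +
    tail d n * (G t + cnorm (h x) * G0 t)).
  by apply: EFin_integrableD; exact: EFin_integrableZ.
apply: (@le_trans _ _ (\int[mu]_t (e / 2 * heat (A_ n) (rv t - x) +
    tail d n * (G t + cnorm (h x) * G0 t)))).
  apply: le_Rintegral => //; first exact: Cintegrable_cnorm.
  move=> t _; rewrite cnormM cnormR ger0_norm ?heat_ge0//.
  (* Near [x] continuity gives [e / 2] against a kernel of mass 1; away from [x], [heat_le] gives
     the vanishing factor [tail d n] times a fixed integrable function. *)
  have [dlt|dge] := ltP (sqnorm (rv t - x)) d.
    rewrite -[leLHS]addr0 lerD//; first by rewrite ler_wpM2r ?heat_ge0// H.
    by rewrite mulr_ge0// addr_ge0// mulr_ge0 ?cnorm_ge0 ?gauss_ge0.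
  rewrite -[leLHS]add0r lerD//; first by rewrite mulr_ge0 ?heat_ge0// ltW.
  rewrite (_ : _ + _ = (cnorm (h (rv t)) + cnorm (h x)) * G0 t); last by rewrite /G /G0; ring.
  rewrite [leRHS]mulrCA; apply: ler_pM; rewrite ?cnorm_ge0 ?heat_ge0//.
    by rewrite (le_trans (cnormD _ _))// cnormN.
  exact: heat_le An (ltW d0) dge.
rewrite RintegralD//; [|exact: EFin_integrableZ..].
rewrite (@RintegralZl _ _ _ mu setT (fun t => heat (A_ n) (rv t - x)))// JN mulr1.
rewrite (@RintegralZl _ _ _ mu setT (fun t => G t + cnorm (h x) * G0 t))//.
rewrite [leRHS](splitr e) lerD2l; apply: le_trans tn; exact: ler_norm.
Qed.

End gaussian_kernel.

(** * Gaussians as an approximate unit of the star product *)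

Section gaussian_star.
Context (R : realType) (k : nat) (theta : R) (theta0 : theta != 0).
Local Notation m := (k + k)%N.
Local Notation V := ('rV[R]_m).
Local Notation mu := (lebesgue_tuple R m).
Local Notation rv := (@rv_of_tuple R m).
Local Notation cnorm := (@Normc.normc R).
Local Notation "r %:C" := (real_complex R r).
Local Notation phase := (phase theta).
Local Notation kern := (kern theta).
Local Notation star := (star theta).
Implicit Types (x y z : V) (f g h : V -> R[i]).

(* Starring with a Gaussian is convolution with a heat kernel, twisted by this
   phase, which is 1 on the diagonal. *)
Definition twist x y : R[i] := expi (2 / theta * omega x y).

Definition gaussC (a : R) : V -> R[i] := fun x => (gauss a x)%:C.

Lemma integrableRn_gaussC (a : R) : 0 < a -> integrableRn (gaussC a).
Proof. by move=> a0; have [I _] := gauss_integrable m a0; exact: CintegrableR I. Qed.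

Lemma kern_gauss (a : R) x y : 0 < a ->
  kern (gaussC a) x y =
  twist x y * ((pi / a) ^+ k * expR (- (sqnorm (y - x) / (theta ^+ 2 * a))))%:C.
Proof.
move=> a0; pose w := symplectic_row ((2 / theta) *: (y - x)).
have [I J] := Cintegral_gauss_rv w a0.
have pE t : gaussC a (rv t) * phase x y (rv t) =
    twist x y * ((gauss a (rv t))%:C * expi (\sum_i w 0 i * rv t 0 i)).
  rewrite mulrCA; congr (_ * _); rewrite /phase /twist -expiD; congr expi.
  rewrite -omega_symplectic_row omegaZl omegaDl omegaNl (omegaC x (rv t)); ring.
have -> : kern (gaussC a) x y = twist x y *
    Cintegral mu (fun t => (gauss a (rv t))%:C * expi (\sum_i w 0 i * rv t 0 i)).
  by rewrite /kern; under [X in Cintegral _ X]eq_fun do rewrite pE; exact: CintegralZ.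
rewrite J; congr (_ * _%:C); rewrite sqrt_addn; last by rewrite divr_ge0// ltW// pi_gt0.
congr (_ * expR _).
have -> : sqnorm w = (2 / theta) ^+ 2 * sqnorm (y - x).
  by rewrite sqnorm_symplectic_row /sqnorm mulr_sumr; apply: eq_bigr => i _; rewrite mxE exprMn.
by field; rewrite theta0 lt0r_neq0.
Qed.

(** Fourier duality inverts the width: as the Gaussian of parameter [a] flattens to the constant 1,
    its kernel concentrates on the diagonal. *)
Definition rate (a : R) : R := (theta ^+ 2 * a)^-1.

Lemma rate_gt0 (a : R) : 0 < a -> 0 < rate a.
Proof. by move=> a0; rewrite invr_gt0 mulr_gt0// exprn_even_gt0. Qed.

(** The Moyal prefactor is the one that normalises the kernel: [(pi theta)^(-2k) (pi / a)^k] equals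
    [(rate a / pi)^k]. *)
Lemma moyal_cst_kern_gauss (a : R) x y : 0 < a ->
  (moyal_cst k theta)%:C * kern (gaussC a) x y = twist x y * (heat (rate a) (y - x))%:C.
Proof.
move=> a0; rewrite kern_gauss// mulrCA -mulrzC; congr (_ * _%:C).
rewrite /heat /rate /gauss mulrA; congr (_ * expR _); last first.
  by rewrite mulNr [in RHS]mulrC.
rewrite /moyal_cst -exprVn exprD -!exprMn; congr (_ ^+ k).
have := lt0r_neq0 (pi_gt0 R); move: (@pi R) => p p0; by field; rewrite theta0 p0 lt0r_neq0.
Qed.

Lemma star_gauss_r f (a : R) x : integrableRn f -> 0 < a ->
  star f (gaussC a) x =
  Cintegral mu (fun t => (f (rv t) * twist x (rv t)) * (heat (rate a) (rv t - x))%:C).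
Proof.
move=> fi a0; rewrite starE_l//; last exact: integrableRn_gaussC.
rewrite -CintegralZ; last by apply: integrable_mul_kern_r => //; exact: integrableRn_gaussC.
by congr Cintegral; apply/funext => t; rewrite mulrCA moyal_cst_kern_gauss// mulrA.
Qed.

Lemma star_gauss_l f (a : R) x : integrableRn f -> 0 < a ->
  star (gaussC a) f x =
  Cintegral mu (fun t => (f (rv t) * twist (rv t) x) * (heat (rate a) (rv t - x))%:C).
Proof.
move=> fi a0; rewrite starE_r//; last exact: integrableRn_gaussC.
rewrite -CintegralZ; last by apply: integrable_mul_kern_l => //; exact: integrableRn_gaussC.
by congr Cintegral; apply/funext => t; rewrite mulrCA moyal_cst_kern_gauss// mulrA heatB.
Qed.

Lemma twistxx x : twist x x = 1.
Proof. by rewrite /twist omegaxx mulr0 expi0. Qed.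

Lemma cnorm_twist x y : cnorm (twist x y) = 1.
Proof. exact: cnorm_expi. Qed.

Lemma continuous_omega_r x : continuous (fun y => omega x y).
Proof.
move=> y; rewrite /omega.
apply: (@cvg_big _ _ _ _ _ (@add_continuous R) _ (nbhs y)) => i _.
apply: (@cvgB _ _ _ (nbhs y)); apply: (@cvgM _ _ (nbhs y)); first [exact: coord_continuous|apply: (@cvg_cst _ _ _ (nbhs y))].
Qed.

Lemma continuous_omega_l x : continuous (fun y => omega y x).
Proof.
move=> y; rewrite (_ : (fun y => omega y x) = (fun y => - omega x y)).
  by apply: (@cvgN _ _ _ (nbhs y)); exact: continuous_omega_r.
by apply/funext => z; rewrite omegaC.
Qed.

Lemma ccontinuous_twist_r x y : ccontinuous_at (twist x) y.
Proof.
apply: ccontinuous_expi; apply: (@cvgM _ _ (nbhs y)); last exact: continuous_omega_r.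
by apply: (@cvg_cst _ _ _ (nbhs y)).
Qed.

Lemma ccontinuous_twist_l x y : ccontinuous_at (fun z => twist z x) y.
Proof.
apply: ccontinuous_expi; apply: (@cvgM _ _ (nbhs y)); last exact: continuous_omega_l.
by apply: (@cvg_cst _ _ _ (nbhs y)).
Qed.

Lemma Cmeasurable_twist d (S : measurableType d) (hx hy : S -> V) :
  (forall i, measurable_fun setT (fun s => hx s 0 i)) ->
  (forall i, measurable_fun setT (fun s => hy s 0 i)) ->
  Cmeasurable (fun s => twist (hx s) (hy s)).
Proof.
by move=> mx my; apply: Cmeasurable_expi; apply: measurable_funM => //; exact: measurable_omega.
Qed.

Lemma Cmeasurable_twist_l x : Cmeasurable (fun t => twist (rv t) x).
Proof. by apply: Cmeasurable_twist => i; [exact: measurable_coord|exact: measurable_cst]. Qed.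

Lemma Cmeasurable_twist_r x : Cmeasurable (fun t => twist x (rv t)).
Proof. by apply: Cmeasurable_twist => i; [exact: measurable_cst|exact: measurable_coord]. Qed.

Lemma rateV_cvg (u : nat -> R) : u n @[n --> \oo] --> (0 : R) ->
  (rate (u n))^-1 @[n --> \oo] --> (0 : R).
Proof.
move=> u0; rewrite /rate; under eq_cvg do rewrite invrK.
have H : theta ^+ 2 * u n @[n --> \oo] --> theta ^+ 2 * 0 by apply: cvgM => //; exact: cvg_cst.
by rewrite mulr0 in H.
Qed.

(* [h_ n] tends to [h] at rate [u n], up to a weight [g] absorbed by the Gaussian. *)
Lemma heat_approx_seq (u : nat -> R) (h_ : nat -> V -> R[i]) h (g : V -> R) x :
  (forall n, 0 < u n) -> u n @[n --> \oo] --> (0 : R) ->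
  Cmeasurable (h \o rv) -> (forall n, Cmeasurable (h_ n \o rv)) ->
  measurable_fun setT (g \o rv) ->
  ccontinuous_at h x -> {for x, continuous g} ->
  Cintegrable mu (fun t => (gauss 1 (rv t - x))%:C * h (rv t)) ->
  Rintegrable mu (fun t => gauss 1 (rv t - x) * g (rv t)) ->
  (forall n y, cnorm (h_ n y - h y) <= u n * g y) ->
  ccvg (fun n => Cintegral mu (fun t => h_ n (rv t) * (heat (rate (u n)) (rv t - x))%:C)) (h x).
Proof.
move=> u0 uc mh mh_ mg ch cg ih ig hg.
have A0 n : 0 < rate (u n) by exact: rate_gt0.
have [I1 C1] := heat_approx A0 (rateV_cvg uc) ih mh ch.
have igC : Cintegrable mu (fun t => (gauss 1 (rv t - x))%:C * (g (rv t))%:C).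
  by under eq_fun do rewrite -mulrzC; exact: CintegrableR.
have [I2 C2] := heat_approx A0 (rateV_cvg uc) igC (CmeasurableR mg) (ccontinuousR cg).
have D1 : ccvg (fun n => Cintegral mu (fun t => h_ n (rv t) * (heat (rate (u n)) (rv t - x))%:C) -
    Cintegral mu (fun t => h (rv t) * (heat (rate (u n)) (rv t - x))%:C)) 0.
  pose G n := complex.Re (Cintegral mu (fun t => (g (rv t))%:C * (heat (rate (u n)) (rv t - x))%:C)).
  have G0 : u n * G n @[n --> \oo] --> (0 : R).
    rewrite -[X in _ --> X](mul0r (g x)); apply: cvgM => //; exact: C2.1.
  have near_le : \forall n \near \oo,
     cnorm (Cintegral mu (fun t => h_ n (rv t) * (heat (rate (u n)) (rv t - x))%:C) -
     Cintegral mu (fun t => h (rv t) * (heat (rate (u n)) (rv t - x))%:C)) <= u n * G n.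
    apply: filterS2 I1 I2 => n J1 J2.
    have iG : Rintegrable mu (fun t => g (rv t) * heat (rate (u n)) (rv t - x)).
      have := J2.1; congr (_.-integrable _ _); apply/funext => t /=; congr EFin; ring.
    have dI : Cintegrable mu (fun t => (h_ n (rv t) - h (rv t)) * (heat (rate (u n)) (rv t - x))%:C).
      apply: (@le_Cintegrable _ _ _ _ _ (fun t => u n * (g (rv t) * heat (rate (u n)) (rv t - x)))).
      - apply: CmeasurableM; last by apply: CmeasurableR; exact: measurable_heat_shift.
        under eq_fun do rewrite -mulN1r; apply: CmeasurableD; first exact: mh_.
        by apply: CmeasurableM => //; exact: Cmeasurable_cst.
      - exact: EFin_integrableZ.
      - by move=> t; rewrite cnormM cnormR ger0_norm ?heat_ge0// mulrA ler_wpM2r ?heat_ge0.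
    have J3 : Cintegrable mu (fun t => h_ n (rv t) * (heat (rate (u n)) (rv t - x))%:C).
      have := CintegrableD J1 dI; congr Cintegrable; apply/funext => t; ring.
    rewrite -CintegralB//.
    have -> : (fun t => h_ n (rv t) * (heat (rate (u n)) (rv t - x))%:C - h (rv t) * (heat (rate (u n)) (rv t - x))%:C) =
        (fun t => (h_ n (rv t) - h (rv t)) * (heat (rate (u n)) (rv t - x))%:C).
      by apply/funext => t; rewrite mulrBl.
    apply: (le_trans (cnorm_Cintegral_le dI)).
    have -> : u n * G n = \int[mu]_t (u n * (g (rv t) * heat (rate (u n)) (rv t - x))).
      rewrite RintegralZl//; congr (_ * _); apply: eq_Rintegral => t _ /=; ring.
    apply: le_Rintegral => //; first exact: Cintegrable_cnorm.
      exact: EFin_integrableZ.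
    by move=> t _; rewrite cnormM cnormR ger0_norm ?heat_ge0// mulrA ler_wpM2r ?heat_ge0.
  have N0 : cnorm (Cintegral mu (fun t => h_ n (rv t) * (heat (rate (u n)) (rv t - x))%:C) -
     Cintegral mu (fun t => h (rv t) * (heat (rate (u n)) (rv t - x))%:C)) @[n --> \oo] --> (0 : R).
    apply: (@squeeze_cvgr _ _ _ _ (cst 0) _ _ _ _ _ G0); last exact: cvg_cst.
    by apply: filterS near_le => n ->; rewrite cnorm_ge0.
  by apply: squeeze_ccvg N0 => n; rewrite subr0.
have := ccvgD D1 C1; rewrite add0r.
by under [X in ccvg X _]eq_fun do rewrite subrK.
Qed.

Lemma integrable_gauss_shift f x : integrableRn f ->
  Cintegrable mu (fun t => (gauss 1 (rv t - x))%:C * f (rv t)).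
Proof.
move=> fi; apply: (@Cintegrable_bM _ _ _ _ _ (f \o rv) 1) => //.
  by apply: CmeasurableR; exact: measurable_gauss_shift.
by move=> t; rewrite cnormR ger0_norm ?gauss_ge0// gauss_le1.
Qed.

Lemma star_gauss_r_cvg (u : nat -> R) f x : (forall n, 0 < u n) ->
  u n @[n --> \oo] --> (0 : R) -> integrableRn f -> ccontinuous_at f x ->
  ccvg (fun n => star f (gaussC (u n)) x) (f x).
Proof.
move=> u0 uc fi cf.
under [X in ccvg X _]eq_fun do rewrite star_gauss_r//.
have mf := integrableRn_measurable fi.
have mt := Cmeasurable_twist_r x.
have [|||||_ C] := @heat_approx R k (fun n => rate (u n)) (fun y => f y * twist x y) x.
- by move=> n; exact: rate_gt0.
- exact: rateV_cvg.
- under eq_fun do rewrite mulrA mulrC.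
  apply: (@Cintegrable_bM _ _ _ _ _ _ 1) => //; last exact: integrable_gauss_shift.
  by move=> t; rewrite cnorm_twist.
- exact: CmeasurableM.
- by apply: ccontinuousM => //; exact: ccontinuous_twist_r.
by rewrite twistxx mulr1 in C.
Qed.

(** Fourier inversion in disguise: [f] is the pointwise limit of its star products with Gaussians,
    and integrating [kern f] against a Gaussian, which is at most 1, gives a bound independent of
    its width. *)
Lemma decaying_bounded f : integrableRn f -> (forall x, ccontinuous_at f x) ->
  decaying theta f -> exists2 C, 0 <= C & forall x, cnorm (f x) <= C.
Proof.
move=> fi cf [C C0 H].
have th : 2 / theta != 0 by rewrite mulf_neq0// invr_neq0.
have iw := weight_integrable m th.
pose K := `|moyal_cst k theta| * (C * \int[mu]_t weight (2 / theta) (rv t)).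
exists K.
  by rewrite !mulr_ge0// Rintegral_ge0// => t _; exact: weight_ge0.
move=> x; pose u n : R := n.+1%:R^-1.
have u0 n : 0 < u n by rewrite invr_gt0.
have uc : u n @[n --> \oo] --> (0 : R) by exact: cvg_harmonic.
apply: (ccvg_bounded (star_gauss_r_cvg u0 uc fi (cf x))) => n.
rewrite starE_r//; last exact: integrableRn_gaussC.
rewrite cnormM cnormR ler_wpM2l//.
have iwx : Rintegrable mu (fun t => C * weight (2 / theta) (rv t - x)).
  apply: EFin_integrableZ; have := translation_integrable (- x) iw.
  by under eq_fun do rewrite /= addrC.
have B t : cnorm (gaussC (u n) (rv t) * kern f (rv t) x) <= C * weight (2 / theta) (rv t - x).
  rewrite cnormM cnormR ger0_norm ?gauss_ge0//.
  rewrite (le_trans _ (H _ _))// ler_piMl ?cnorm_ge0// gauss_le1// ltW//.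
have I := integrable_mul_kern_l theta x (integrableRn_gaussC (u0 n)) fi.
apply: (le_trans (cnorm_Cintegral_le I)).
have <- : \int[mu]_t (C * weight (2 / theta) (rv t - x)) = C * \int[mu]_t weight (2 / theta) (rv t).
  have := translation_Rintegral (f := weight (2 / theta)) (- x) (integrable_measurable iw).
  under eq_Rintegral do rewrite addrC.
  move=> <-; rewrite RintegralZl//.
  by have := translation_integrable (- x) iw; under eq_fun do rewrite /= addrC.
apply: le_Rintegral => //; exact: Cintegrable_cnorm.
Qed.

Lemma gauss_mul_cvg (u : nat -> R) f : (forall n, 0 < u n) -> u n @[n --> \oo] --> (0 : R) ->
  integrableRn f ->
  ccvg (fun n => integralRn (fun x => f x * gaussC (u n) x)) (integralRn f).
Proof.
move=> u0 uc fi; have mf := integrableRn_measurable fi.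
have [] := @Cintegral_dct _ _ _ mu (fun n t => f (rv t) * gaussC (u n) (rv t)) (f \o rv) (fun t => cnorm (f (rv t))) => //.
- move=> n; apply: CmeasurableM => //; apply: integrableRn_measurable.
  exact: integrableRn_gaussC.
- exact: Cintegrable_cnorm fi.
- move=> n t; rewrite mulrC; apply: cnorm_gaussM_le; exact: ltW.
- move=> t; rewrite -[X in ccvg _ X]mulr1; apply: ccvgM; first exact: ccvg_cst.
  exact: gauss_cvg.
Qed.

(** The trace property. A Gaussian is inserted under the integral, moved next to [g] by
    [integral_star_mul], then removed by dominated convergence: since the heat kernel has mass 1,
    starring [g] with a Gaussian does not exceed the bound [C] of [g]. *)
Lemma integral_star f g : integrableRn f -> integrableRn g -> integrableRn (star f g) ->
  (forall x, ccontinuous_at g x) -> (exists C, forall x, cnorm (g x) <= C) ->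
  integralRn (star f g) = integralRn (fun x => f x * g x).
Proof.
move=> fi gi fgi cg [C gC].
pose u n : R := n.+1%:R^-1.
have u0 n : 0 < u n by rewrite invr_gt0.
have uc : u n @[n --> \oo] --> (0 : R) by exact: cvg_harmonic.
have L := gauss_mul_cvg u0 uc fgi.
apply: (ccvg_unique L).
have E n := integral_star_mul theta fi gi (integrableRn_gaussC (u0 n)).
under [X in ccvg X _]eq_fun do rewrite E.
have [] // := @Cintegral_dct _ _ _ mu (fun n t => f (rv t) * star g (gaussC (u n)) (rv t))
   (fun t => f (rv t) * g (rv t)) (fun t => C * cnorm (f (rv t))).
- move=> n; apply: CmeasurableM; first exact: integrableRn_measurable.
  by apply: Cmeasurable_star => //; exact: integrableRn_gaussC.
- by apply: EFin_integrableZ; exact: Cintegrable_cnorm fi.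
- move=> n t; rewrite cnormM mulrC ler_wpM2r ?cnorm_ge0//.
  rewrite star_gauss_r//.
  have [iN JN] := heat_integrable (rv t) (rate_gt0 (u0 n)).
  have B s : cnorm (g (rv s) * twist (rv t) (rv s) * (heat (rate (u n)) (rv s - rv t))%:C) <=
      C * heat (rate (u n)) (rv s - rv t).
    rewrite !cnormM cnorm_twist mulr1 cnormR ger0_norm ?heat_ge0 ?rate_gt0//.
    by rewrite ler_wpM2r ?heat_ge0 ?rate_gt0.
  have I : Cintegrable mu (fun s => g (rv s) * twist (rv t) (rv s) * (heat (rate (u n)) (rv s - rv t))%:C).
    apply: le_Cintegrable (EFin_integrableZ C iN) B.
    apply: CmeasurableM; first apply: CmeasurableM.
    + exact: integrableRn_measurable.
    + exact: Cmeasurable_twist_r.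
    + by apply: CmeasurableR; exact: measurable_heat_shift.
  apply: (le_trans (cnorm_Cintegral_le I)).
  rewrite -[leRHS]mulr1 -JN -RintegralZl//; apply: le_Rintegral => //.
    exact: Cintegrable_cnorm.
  exact: EFin_integrableZ.
- move=> t; apply: ccvgM; first exact: ccvg_cst.
  exact: star_gauss_r_cvg.
Qed.

End gaussian_star.

(** * Multiplication by linear functions *)

Section gaussian_damping.
Context (R : realType) (n : nat).
Local Notation V := ('rV[R]_n).
Local Notation mu := (lebesgue_tuple R n).
Local Notation rv := (@rv_of_tuple R n).
Implicit Types (x y z : V) (phi : V -> R) (i : 'I_n).

Lemma bounded_cvg (u : nat -> R) (l : R) : u n @[n --> \oo] --> l ->
  exists2 K, 0 <= K & forall n, u n <= K.
Proof.
move=> /cvgP/cvg_seq_bounded/ex_bound H.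
have [|K uK] := H; first exact: (@globally_properfilter _ _ 0%N I).
exists (Num.max 0 K); first by rewrite le_max lexx.
by move=> j; rewrite le_max (le_trans (ler_norm _) (uK j _)) ?orbT.
Qed.

Lemma sqnorm_gauss_le (a : R) x : 0 < a -> sqnorm x * gauss a x <= a^-1.
Proof.
move=> a0; have := mul_expRN_le1 (a * sqnorm x); rewrite /gauss mulNr => H.
by rewrite -(ler_pM2l a0) divff ?lt0r_neq0// mulrA.
Qed.

Lemma weighted_gauss_le (a : R) x : 0 < a -> (1 + sqnorm x) * gauss a x <= 1 + a^-1.
Proof.
move=> a0; rewrite mulrDl mul1r lerD//; first by rewrite gauss_le1// ltW.
exact: sqnorm_gauss_le.
Qed.

Lemma weighted2_gauss_le (a : R) x : 0 < a ->
  (1 + sqnorm x) ^+ 2 * gauss a x <= (1 + (a / 2)^-1) ^+ 2.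
Proof.
move=> a0; have a20 : 0 < a / 2 by rewrite divr_gt0.
have aE : a = a / 2 + a / 2 by rewrite -splitr.
have H := weighted_gauss_le x a20.
have p0 : 0 <= (1 + sqnorm x) * gauss (a / 2) x.
  by rewrite mulr_ge0 ?gauss_ge0// addr_ge0 ?sqnorm_ge0.
by rewrite {1}aE gaussD -expr2 -exprMn ler_pXn2r ?nnegrE// (le_trans p0).
Qed.

(** From [|y|^2 <= 2 |y - x|^2 + 2 |x|^2]: recentring at the origin costs half of the rate and a
    factor depending on [x]. *)
Lemma gauss_shift_le (a : R) x y : 0 <= a ->
  gauss a (y - x) <= expR (a * sqnorm x) * gauss (a / 2) y.
Proof.
move=> a0; rewrite /gauss -expRD ler_expR.
have := sqnormD_le (y - x) x; rewrite subrK; nra.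
Qed.

(** The exponent 2 covers the worst case, [xtilde i] times the factor [x_i] produced by
    differentiating the damping, each at most a multiple of [1 + sqnorm x]. *)
Lemma integrable_weighted_gauss (a C : R) (p : V -> R) phi : 0 < a ->
  measurable_fun setT (p \o rv) -> (forall x, `|p x| <= C * (1 + sqnorm x) ^+ 2) ->
  Rintegrable mu (phi \o rv) ->
  Rintegrable mu (fun t => gauss a (rv t) * (p (rv t) * phi (rv t))).
Proof.
move=> a0 mp pC iphi.
have mg : measurable_fun setT (fun t => gauss a (rv t)).
  by apply: measurable_gauss_comp; exact: measurable_coord.
have C0 : 0 <= C.
  by have := le_trans (normr_ge0 _) (pC 0); rewrite sqnorm0 addr0 expr1n mulr1.
apply: (@le_EFin_integrable _ _ _ _ _ (fun t => C * (1 + (a / 2)^-1) ^+ 2 * `|phi (rv t)|)).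
- apply: measurable_funM => //; apply: measurable_funM => //; exact: (integrable_measurable iphi).
- by apply: EFin_integrableZ; exact: integrable_norm.
- move=> t; rewrite !normrM (ger0_norm (gauss_ge0 _ _)) mulrA ler_wpM2r//.
  rewrite mulrC (le_trans (ler_wpM2r (gauss_ge0 _ _) (pC _)))//.
  by rewrite -mulrA ler_wpM2l// weighted2_gauss_le.
Qed.

Lemma gauss1_ge (a : R) x : 0 <= a -> 1 - gauss a x <= a * sqnorm x.
Proof.
move=> a0; rewrite lerBlDr -lerBlDl /gauss mulNr.
exact: (expR_ge1Dx (- (a * sqnorm x))).
Qed.

Definition dampD i (a : R) phi : V -> R :=
  fun x => gauss a x * (partial i phi x - 2 * a * x 0 i * phi x).

Lemma has_partial_coord i : has_partial i (fun x => x 0 i) (fun=> 1).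
Proof. by apply: has_partial_affine => x s; rewrite !mxE !eqxx. Qed.

Lemma has_partial_sqnorm i : has_partial i (@sqnorm R n) (fun x => 2 * x 0 i).
Proof.
move=> x.
rewrite (_ : (fun s : R => _) = (fun s : R => sqnorm x + s * (2 * x 0 i) + s * s)); last first.
  apply/funext => s; rewrite /sqnorm (bigD1 i)//= [in RHS](bigD1 i)//= !mxE !eqxx.
  under eq_bigr => j ji do rewrite !mxE eqxx (negbTE ji) mulr0 addr0.
  by rewrite mulr1; ring.
have d1 := is_deriveD (is_derive_cst (sqnorm x) (0:R) (1:R))
  (is_deriveM (is_derive_id (0:R) (1:R)) (is_derive_cst (2 * x 0 i) (0:R) (1:R))).
have d2 := is_deriveD d1 (is_deriveM (is_derive_id (0:R) (1:R)) (is_derive_id (0:R) (1:R))).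
move: d2; congr is_derive; rewrite /GRing.scale /=; ring.
Qed.

Lemma has_partial_gauss i (a : R) :
  has_partial i (gauss a) (fun x => - (2 * a * x 0 i) * gauss a x).
Proof.
have D (y : R) : is_derive y 1 (fun y : R => expR (- a * y)) (- a * expR (- a * y)).
  have d1 : is_derive y 1 (fun y : R => - a * y) (- a).
    have := is_deriveZ (- a) (is_derive_id y (1:R)).
    by rewrite /GRing.scale /= mulr1.
  by have := @is_derive1_comp _ expR (fun y : R => - a * y) y _ _ (is_derive_expR _) d1; rewrite mulrC.
have := has_partial_comp D (has_partial_sqnorm i).
by congr has_partial; apply/funext => x; rewrite /gauss; ring.
Qed.

Lemma has_partial_damp i (a : R) phi : D_L1 phi ->
  has_partial i (damp a phi) (dampD i a phi).
Proof.
move=> Dphi; have := has_partialM (has_partial_gauss i a) (D_L1_has_partial i Dphi).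
by congr has_partial; apply/funext => x; rewrite /dampD; ring.
Qed.

Lemma line_continuous_dampD i (a : R) phi : D_L1 phi ->
  line_continuous i (dampD i a phi).
Proof.
move=> Dphi; apply: line_continuousM.
  exact: has_partial_line_continuous (has_partial_gauss i a).
apply: line_continuousD.
  by apply: line_continuous_continuous; exact: D_L1_continuous (D_L1_partial i Dphi).
rewrite (_ : (fun x => - _) = (fun x => (- (2 * a) * x 0 i) * phi x)); last by apply/funext => x; ring.
apply: line_continuousM; last by apply: line_continuous_continuous; exact: D_L1_continuous.
apply: line_continuousM; first exact: line_continuous_cst.
exact: has_partial_line_continuous (has_partial_coord i).
Qed.

Lemma damp_le (a : R) phi x : 0 <= a -> `|damp a phi x| <= `|phi x|.
Proof.
by move=> a0; rewrite /damp normrM (ger0_norm (gauss_ge0 _ _)) ler_piMl// gauss_le1.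
Qed.

(** The term [2 a x_i phi] is not small by itself, but [a (1 + |x|^2) exp(- a |x|^2) <= a + 1]. This
    makes the bound uniform in the damping, as dominated convergence requires. *)
Lemma dampD_le i (a K : R) phi x : 0 < a -> a <= K ->
  `|dampD i a phi x| <= `|partial i phi x| + 2 * (K + 1) * `|phi x|.
Proof.
move=> a0 aK; rewrite /dampD mulrBr (le_trans (ler_normB _ _))// lerD//.
  by rewrite normrM (ger0_norm (gauss_ge0 _ _)) ler_piMl// gauss_le1// ltW.
rewrite mulrA normrM ler_wpM2r// normrM (ger0_norm (gauss_ge0 _ _)) !normrM.
rewrite (ger0_norm (ltW a0)) ger0_norm// -!mulrA mulrCA ler_wpM2l//.
have H := weighted_gauss_le x a0.
rewrite mulrCA (le_trans (ler_wpM2l (ltW a0) (le_trans _ H)))//.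
  by rewrite mulrC ler_wpM2r ?gauss_ge0// normr_coord_le.
by rewrite mulrDr mulr1 divff ?lt0r_neq0// lerD2r.
Qed.

End gaussian_damping.

(** * Star products with linear functions *)

Section star_by_parts.
Context (R : realType) (k : nat) (theta : R) (theta0 : theta != 0).
Local Notation m := (k + k)%N.
Local Notation V := ('rV[R]_m).
Local Notation mu := (lebesgue_tuple R m).
Local Notation rv := (@rv_of_tuple R m).
Local Notation "r %:C" := (real_complex R r).
Local Notation kern := (kern theta).
Local Notation star := (star theta).
Local Notation xt := (xtilde theta).
Local Notation ii := (Complex 0 1 : R[i]).
Implicit Types (x y z : V) (f h : V -> R[i]) (g phi : V -> R) (i : 'I_m).

Lemma xtildeB i x y : xt i (x - y) = xt i x - xt i y.
Proof. by rewrite /xtilde omegaDl omegaNl; ring. Qed.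

(** Since [omega] is alternating, [xtilde i] is constant along the axis [i]: it commutes with [d_i],
    which keeps the formulas by parts short and makes the cross terms total derivatives. *)
Lemma xtilde_shift i x (s : R) : xt i (x + s *: delta_mx 0 i) = xt i x.
Proof. by rewrite /xtilde omegaDl omegaZl omegaxx mulr0 addr0. Qed.

Lemma xtilde_sqr_le i x : xt i x ^+ 2 <= (2 / theta) ^+ 2 * sqnorm x.
Proof.
rewrite /xtilde exprMn ler_wpM2l ?sqr_ge0// -sqnorm_symplectic_row.
by have := coord_sqnorm_le (symplectic_row x) i; rewrite mxE.
Qed.

Lemma xtilde_le i x : `|xt i x| <= `|2 / theta| * (1 + sqnorm x).
Proof.
rewrite /xtilde normrM ler_wpM2l// -sqnorm_symplectic_row.
by have := normr_coord_le (symplectic_row x) i; rewrite mxE.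
Qed.

Lemma continuous_xtilde i : continuous (xt i).
Proof.
move=> x; apply: (@cvgM _ _ (nbhs x)); last exact: continuous_omega_l.
by apply: (@cvg_cst _ _ _ (nbhs x)).
Qed.

Lemma measurable_xtilde i : measurable_fun setT (xt i \o rv).
Proof.
apply: measurable_funM => //; apply: measurable_omega => j; first exact: measurable_coord.
exact: measurable_cst.
Qed.

(** Along the axis [i], the phase is affine in its third argument with slope [xtilde i (y - x)];
    integration by parts exchanges this slope for a derivative of [g]. *)
Lemma kern_partial i g g' x y : has_partial i g g' -> line_continuous i g' ->
  integrableRn (toC g) -> integrableRn (toC g') ->
  (xt i y)%:C * kern (toC g) x y = (xt i x)%:C * kern (toC g) x y + ii * kern (toC g') x y.
Proof.
move=> gg' cg' [ig _] [ig' _].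
have := @integration_by_parts_expi _ _ i g g'
  (fun z => 2 / theta * (omega x y + omega y z + omega z x)) (xt i (y - x)) gg' cg' ig ig'.
rewrite -/(kern (toC g) x y) -/(kern (toC g') x y) => ->.
- rewrite xtildeB mulrA.
  have -> : ii * Complex 0 (- (xt i y - xt i x)) = (xt i y)%:C - (xt i x)%:C.
    by apply: complexP; rewrite ?ReM ?ImM ?ReB ?ImB /=; ring.
  by rewrite mulrBl addrC subrK.
- apply: measurable_funM => //; apply: measurable_funD; first apply: measurable_funD => //.
    by apply: measurable_omega => j; [exact: measurable_cst|exact: measurable_coord].
  by apply: measurable_omega => j; [exact: measurable_coord|exact: measurable_cst].
move=> z s; rewrite /xtilde !omegaDl !omegaDr !omegaZl omegaZr omegaNl.
rewrite (omegaC x (delta_mx 0 i)); ring.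
Qed.

Lemma star_xtilde_l i f g g' x : integrableRn f ->
  integrableRn (fun y => (xt i y)%:C * f y) ->
  has_partial i g g' -> line_continuous i g' ->
  integrableRn (toC g) -> integrableRn (toC g') ->
  star (fun y => (xt i y)%:C * f y) (toC g) x =
  (xt i x)%:C * star f (toC g) x + ii * star f (toC g') x.
Proof.
move=> fi xfi gg' cg' gi gi'; rewrite !starE_l//.
have E t : (xt i (rv t))%:C * f (rv t) * kern (toC g) x (rv t) =
    (xt i x)%:C * (f (rv t) * kern (toC g) x (rv t)) + ii * (f (rv t) * kern (toC g') x (rv t)).
  by rewrite mulrAC (kern_partial x (rv t) gg' cg' gi gi'); ring.
under [X in Cintegral _ X]eq_fun do rewrite E.
have I := integrable_mul_kern_r theta x fi gi; have I' := integrable_mul_kern_r theta x fi gi'.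
have -> := CintegralD (CintegrableZ (xt i x)%:C I) (CintegrableZ ii I').
have -> := CintegralZ (xt i x)%:C I; have -> := CintegralZ ii I'.
by rewrite mulrDr; congr (_ + _); exact: mulrCA.
Qed.

Lemma conjcD (z w : R[i]) : conjc (z + w) = conjc z + conjc w.
Proof. exact: rmorphD. Qed.

Lemma conjc_toC g : (fun x => conjc (toC g x)) = toC g.
Proof. by apply/funext => x; rewrite /toC conjcR. Qed.

(** The mirror image of [star_xtilde_l] under conjugation, which reverses the factors and flips the
    sign of the derivative term. *)
Lemma star_xtilde_r i f g g' x : integrableRn f ->
  integrableRn (fun y => (xt i y)%:C * f y) ->
  has_partial i g g' -> line_continuous i g' ->
  integrableRn (toC g) -> integrableRn (toC g') ->
  star (toC g) (fun y => (xt i y)%:C * f y) x =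
  (xt i x)%:C * star (toC g) f x - ii * star (toC g') f x.
Proof.
move=> fi xfi gg' cg' gi gi'.
have xfiJ := integrableRnJ xfi.
have E : (fun y => conjc ((xt i y)%:C * f y)) = (fun y => (xt i y)%:C * conjc (f y)).
  by apply/funext => y; rewrite conjcM conjcR.
rewrite E in xfiJ.
have := star_xtilde_l x (integrableRnJ fi) xfiJ gg' cg' gi gi'.
move=> /(congr1 (@conjc R)); rewrite starJ// conjc_toC.
have -> : (fun x0 => conjc ((xt i x0)%:C * conjc (f x0))) = (fun y => (xt i y)%:C * f y).
  by apply/funext => y; rewrite conjcM conjcR conjcK.
move=> ->; rewrite conjcD (conjcM (xt i x)%:C) (conjcM ii) conjcR !starJ//; try exact: integrableRnJ.
rewrite !conjc_toC.
have -> : (fun x0 => conjc (conjc (f x0))) = f by apply/funext => y; rewrite conjcK.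
have -> : conjc ii = - ii by apply: complexP => /=; rewrite ?oppr0.
by rewrite mulNr.
Qed.

Lemma integrableRn_toC g : Rintegrable mu (g \o rv) -> integrableRn (toC g).
Proof. exact: CintegrableR. Qed.

Lemma integrableRn_gauss_poly (a C : R) (p : V -> R) phi : 0 < a ->
  measurable_fun setT (p \o rv) -> (forall x, `|p x| <= C * (1 + sqnorm x) ^+ 2) ->
  D_L1 phi -> integrableRn (toC (fun x => gauss a x * (p x * phi x))).
Proof.
move=> a0 mp pC Dphi; apply: integrableRn_toC; apply: integrable_weighted_gauss => //.
exact: D_L1_integrable.
Qed.

Lemma one_le_sqnorm_weight x : 1 <= 1 + sqnorm x.
Proof. by rewrite lerDl sqnorm_ge0. Qed.

Lemma le_weight2 (C r : R) x : r <= C * (1 + sqnorm x) -> 0 <= C -> r <= C * (1 + sqnorm x) ^+ 2.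
Proof.
move=> rC C0; apply: (le_trans rC); rewrite ler_wpM2l// expr2 ler_peMl ?one_le_sqnorm_weight//.
by rewrite addr_ge0// sqnorm_ge0.
Qed.

Lemma integrableRn_xtilde_gauss i (a : R) : 0 < a ->
  integrableRn (fun y => (xt i y)%:C * gaussC a y).
Proof.
move=> a0; have a20 : 0 < a / 2 by rewrite divr_gt0.
have [I _] := gauss_integrable m a20.
rewrite (_ : (fun y => _) = toC (fun y => xt i y * gauss a y)); last first.
  by apply/funext => y; rewrite /toC mulrzC.
apply: integrableRn_toC.
apply: (@le_EFin_integrable _ _ _ _ _ (fun t => `|2 / theta| * (1 + (a / 2)^-1) * gauss (a / 2) (rv t))).
- apply: measurable_funM; first exact: measurable_xtilde.
  by apply: measurable_gauss_comp; exact: measurable_coord.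
- exact: EFin_integrableZ.
- move=> t; rewrite /= {1}(splitr a) gaussD normrM (ger0_norm (mulr_ge0 (gauss_ge0 _ _) (gauss_ge0 _ _))).
  rewrite mulrA ler_wpM2r ?gauss_ge0//.
  rewrite (le_trans (ler_wpM2r (gauss_ge0 _ _) (xtilde_le _ _)))//.
  by rewrite -mulrA ler_wpM2l// weighted_gauss_le.
Qed.

Section damping.
Variables (phi : V -> R) (Dphi : D_L1 phi) (i : 'I_m).
Let iphi := D_L1_integrable Dphi.
Let idphi := D_L1_integrable (D_L1_partial i Dphi).
Let mphi : measurable_fun setT (phi \o rv) := integrable_measurable iphi.

Lemma integrableRn_damp (a : R) : 0 < a -> integrableRn (toC (damp a phi)).
Proof.
move=> a0; have := @integrableRn_gauss_poly a 1 (cst 1) phi a0.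
rewrite (_ : (fun x => _) = damp a phi); last by apply/funext => x; rewrite mul1r.
apply => //; first exact: measurable_cst.
by move=> x; rewrite normr1 mul1r exprn_ege1// one_le_sqnorm_weight.
Qed.

Lemma integrableRn_xtilde_damp (a : R) : 0 < a ->
  integrableRn (toC (fun x => xt i x * damp a phi x)).
Proof.
move=> a0; have := @integrableRn_gauss_poly a `|2 / theta| (xt i) phi a0 (measurable_xtilde i).
rewrite (_ : (fun x => gauss a x * _) = (fun x => xt i x * damp a phi x)); last first.
  by apply/funext => x; rewrite /damp; ring.
by apply => // x; apply: le_weight2 => //; exact: xtilde_le.
Qed.

Lemma integrableRn_poly_dampD (a C : R) (p : V -> R) : 0 < a ->
  measurable_fun setT (p \o rv) -> (forall x, `|p x| <= C * (1 + sqnorm x)) ->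
  integrableRn (toC (fun x => p x * dampD i a phi x)).
Proof.
move=> a0 mp pC.
have C0 : 0 <= C by have := le_trans (normr_ge0 _) (pC 0); rewrite sqnorm0 addr0 mulr1.
have I1 := integrableRn_gauss_poly a0 mp (fun x => le_weight2 (pC x) C0) (D_L1_partial i Dphi).
have mq : measurable_fun setT ((fun x => p x * x 0 i) \o rv).
  by apply: measurable_funM => //; exact: measurable_coord.
have qC x : `|p x * x 0 i| <= C * (1 + sqnorm x) ^+ 2.
  by rewrite normrM expr2 mulrA ler_pM// ?normr_coord_le.
have I2 := integrableRn_gauss_poly a0 mq qC Dphi.
have := CintegrableD I1 (CintegrableZ (- (2 * a))%:C I2); congr Cintegrable.
by apply/funext => t; rewrite /= /toC -rmorphM -rmorphD /dampD; congr (_ %:C); ring.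
Qed.

Lemma integrableRn_dampD (a : R) : 0 < a -> integrableRn (toC (dampD i a phi)).
Proof.
move=> a0; have := @integrableRn_poly_dampD a 1 (cst 1) a0.
rewrite (_ : (fun x => _) = dampD i a phi); last by apply/funext => x; rewrite mul1r.
apply => //; first exact: measurable_cst.
by move=> x; rewrite normr1 mul1r one_le_sqnorm_weight.
Qed.

Lemma integrableRn_xtilde_dampD (a : R) : 0 < a ->
  integrableRn (toC (fun x => xt i x * dampD i a phi x)).
Proof.
move=> a0; apply: (integrableRn_poly_dampD a0 (measurable_xtilde i)).
exact: xtilde_le.
Qed.

(** Once [xtilde] is pulled out, what is left of its damped version is the Gaussian alone, now
    acting from the left as an approximate unit. *)
Lemma moyal_reg_xtilde_l (a : R) x : 0 < a ->
  moyal_reg theta a (toC (xt i)) (toC phi) x =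
  (xt i x)%:C * star (gaussC a) (toC (damp a phi)) x +
  ii * star (gaussC a) (toC (dampD i a phi)) x.
Proof.
move=> a0; rewrite moyal_regE.
have := star_xtilde_l x (integrableRn_gaussC k a0) (integrableRn_xtilde_gauss i a0)
  (has_partial_damp i a Dphi) (line_continuous_dampD Dphi) (integrableRn_damp a0) (integrableRn_dampD a0).
move=> <-; apply: (congr2 (fun f h => star f h x)); apply/funext => y; first by rewrite mulrC.
by rewrite /toC -rmorphM.
Qed.

(** Combined with its mirror image, this is the analytic content of [d_i phi =
    [- i/2 xtilde i, phi]]. The parameter [u n] acts twice, in the approximate unit and in the
    damping of [phi], so the function and the kernel vary together. *)
Lemma moyal_reg_xtilde_l_cvg (u : nat -> R) x :
  (forall n, 0 < u n) -> u n @[n --> \oo] --> (0 : R) ->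
  ccvg (fun n => moyal_reg theta (u n) (toC (xt i)) (toC phi) x)
    ((xt i x)%:C * (phi x)%:C + ii * (partial i phi x)%:C).
Proof.
move=> u0 uc; under [X in ccvg X _]eq_fun do rewrite moyal_reg_xtilde_l//.
have tw : ccontinuous_at (fun y => twist theta y x) x by exact: ccontinuous_twist_l.
have mtw := Cmeasurable_twist_l theta x.
have cphi := D_L1_continuous Dphi.
have cdphi := D_L1_continuous (D_L1_partial i Dphi).
have mdphi := integrable_measurable idphi.
(* One weight for both errors, each of order [u n]: [1 - gauss (u n) y] is at most [u n * |y|^2],
   and [dampD] adds a term [2 (u n) y_i phi]. *)
pose g y := (1 + sqnorm y) * (`|partial i phi y| + 2 * `|phi y|).
have csq : {for x, continuous (@sqnorm R m)}.
  apply: (@cvg_big _ _ _ _ _ (@add_continuous R) _ (nbhs x)) => j _.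
  have C : {for x, continuous (fun y : V => y 0 j)} by exact: coord_continuous.
  by rewrite expr2; under eq_cvg do rewrite expr2; apply: (@cvgM _ _ (nbhs x)).
have cg : {for x, continuous g}.
  apply: (@cvgM _ _ (nbhs x)).
    by apply: (@cvgD _ _ _ (nbhs x)) => //; apply: (@cvg_cst _ _ _ (nbhs x)).
  apply: (@cvgD _ _ _ (nbhs x)).
    by apply: (@cvg_norm _ _ _ (nbhs x)); exact: cdphi.
  apply: (@cvgM _ _ (nbhs x)); first by apply: (@cvg_cst _ _ _ (nbhs x)).
  by apply: (@cvg_norm _ _ _ (nbhs x)); exact: cphi.
have msq : measurable_fun setT (@sqnorm R m \o rv).
  by apply: measurable_sqnorm; exact: measurable_coord.
have mg : measurable_fun setT (g \o rv).
  apply: measurable_funM; first exact: measurable_funD.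
  apply: measurable_funD; first exact: measurableT_comp.
  by apply: measurable_funM => //; exact: measurableT_comp.
have ig : Rintegrable mu (fun t => gauss 1 (rv t - x) * g (rv t)).
  apply: (@le_EFin_integrable _ _ _ _ _ (fun t => expR (1 * sqnorm x) * (1 + (1 / 2)^-1) *
     (`|partial i phi (rv t)| + 2 * `|phi (rv t)|))).
  - by apply: measurable_funM => //; exact: measurable_gauss_shift.
  - apply: EFin_integrableZ; apply: EFin_integrableD; first exact: integrable_norm.
    by apply: EFin_integrableZ; exact: integrable_norm.
  - move=> t; rewrite /g mulrA normrM [X in _ * X <= _]ger0_norm ?addr_ge0// ler_wpM2r ?addr_ge0//.
    rewrite normrM (ger0_norm (gauss_ge0 _ _)) ger0_norm ?addr_ge0 ?sqnorm_ge0//.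
    rewrite (le_trans (ler_wpM2r _ (gauss_shift_le _ _ ler01))) ?addr_ge0 ?sqnorm_ge0//.
    by rewrite -mulrA ler_wpM2l ?expR_ge0// mulrC weighted_gauss_le.
have ih (f : V -> R) : Rintegrable mu (f \o rv) ->
    Cintegrable mu (fun t => (gauss 1 (rv t - x))%:C * ((f (rv t))%:C * twist theta (rv t) x)).
  move=> fi; under eq_fun do rewrite mulrA mulrC.
  apply: (@Cintegrable_bM _ _ _ _ _ _ 1) => //; first by move=> t; rewrite cnorm_twist.
  exact: (integrable_gauss_shift x (integrableRn_toC fi)).
apply: ccvgD; apply: ccvgM; try exact: ccvg_cst.
- have E n := star_gauss_l theta0 x (integrableRn_damp (u0 n)) (u0 n).
  under [X in ccvg X _]eq_fun do rewrite E.
  have -> : (phi x)%:C = (phi x)%:C * twist theta x x by rewrite twistxx mulr1.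
  apply: (@heat_approx_seq _ _ _ theta0 u (fun n y => toC (damp (u n) phi) y * twist theta y x)
    (fun y => (phi y)%:C * twist theta y x) g) => //.
  + by apply: CmeasurableM => //; exact: CmeasurableR.
  + move=> n; apply: CmeasurableM => //; apply: CmeasurableR; apply: measurable_funM => //.
    by apply: measurable_gauss_comp; exact: measurable_coord.
  + by apply: ccontinuousM => //; apply: ccontinuousR; exact: cphi.
  + exact: ih.
  + move=> n y; rewrite -mulrBl cnormM cnorm_twist mulr1 /toC -rmorphB cnormR.
    have -> : damp (u n) phi y - phi y = - ((1 - gauss (u n) y) * phi y) by rewrite /damp; ring.
    rewrite normrN normrM ger0_norm ?subr_ge0 ?gauss_le1// ?(ltW (u0 n))//.
    rewrite (le_trans (ler_wpM2r (normr_ge0 _) (gauss1_ge _ (ltW (u0 n)))))//.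
    rewrite /g -mulrA ler_wpM2l ?(ltW (u0 n))// ler_pM ?sqnorm_ge0//.
      by rewrite lerDr.
    have := normr_ge0 (partial i phi y); have := normr_ge0 (phi y); lra.
- have E n := star_gauss_l theta0 x (integrableRn_dampD (u0 n)) (u0 n).
  under [X in ccvg X _]eq_fun do rewrite E.
  have -> : (partial i phi x)%:C = (partial i phi x)%:C * twist theta x x by rewrite twistxx mulr1.
  apply: (@heat_approx_seq _ _ _ theta0 u (fun n y => toC (dampD i (u n) phi) y * twist theta y x)
    (fun y => (partial i phi y)%:C * twist theta y x) g) => //.
  + by apply: CmeasurableM => //; exact: CmeasurableR.
  + move=> n; apply: CmeasurableM => //.
    exact: (integrableRn_measurable (integrableRn_dampD (u0 n))).
  + by apply: ccontinuousM => //; apply: ccontinuousR; exact: cdphi.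
  + exact: ih.
  + move=> n y; rewrite -mulrBl cnormM cnorm_twist mulr1 /toC -rmorphB cnormR.
    have -> : dampD i (u n) phi y - partial i phi y =
      - ((1 - gauss (u n) y) * partial i phi y) - u n * (gauss (u n) y * (2 * y 0 i * phi y)).
      by rewrite /dampD; ring.
    rewrite (le_trans (ler_normB _ _))// normrN normrM ger0_norm ?subr_ge0 ?gauss_le1// ?(ltW (u0 n))//.
    rewrite [X in _ + X]normrM (ger0_norm (ltW (u0 n))).
    rewrite (le_trans (lerD (ler_wpM2r (normr_ge0 _) (gauss1_ge _ (ltW (u0 n)))) (lexx _)))//.
    rewrite -(mulrA (u n) (sqnorm y)) -mulrDr ler_wpM2l ?(ltW (u0 n))// /g mulrDr lerD//.
      by rewrite ler_wpM2r// lerDr.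
    rewrite normrM (ger0_norm (gauss_ge0 _ _)) mulrC.
    rewrite (le_trans (ler_piMr _ (gauss_le1 _ (ltW (u0 n)))))//.
    rewrite !normrM ger0_norm// -mulrA mulrCA ler_wpM2r ?mulr_ge0//.
    exact: normr_coord_le.
Qed.

Lemma moyal_reg_xtilde_r_cvg (u : nat -> R) x :
  (forall n, 0 < u n) -> u n @[n --> \oo] --> (0 : R) ->
  ccvg (fun n => moyal_reg theta (u n) (toC phi) (toC (xt i)) x)
    ((xt i x)%:C * (phi x)%:C - ii * (partial i phi x)%:C).
Proof.
move=> u0 uc; have := ccvgJ (moyal_reg_xtilde_l_cvg x u0 uc).
rewrite conjcD !conjcM !conjcR.
have -> : conjc ii = - ii by apply: complexP => /=; rewrite ?oppr0.
rewrite mulNr.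
have E n : conjc (moyal_reg theta (u n) (toC (xt i)) (toC phi) x) =
    moyal_reg theta (u n) (toC phi) (toC (xt i)) x.
  rewrite !moyal_regE starJ.
  - by apply: (congr2 (fun f h => star f h x)); apply/funext => y; rewrite conjcM !conjcR.
  - by have := integrableRn_xtilde_gauss i (u0 n); congr integrableRn; apply/funext => y; rewrite mulrC.
  - by have := integrableRn_damp (u0 n); congr integrableRn; apply/funext => y; rewrite /toC -rmorphM.
by under [X in ccvg X _]eq_fun do rewrite E.
Qed.

End damping.
End star_by_parts.

(** * Moyal squares of non integrable functions *)

Lemma starZ (R : realType) (k : nat) (theta : R) (z w : R[i]) (f h : 'rV[R]_(k + k) -> R[i]) x : integrableRn f -> integrableRn h ->
  star theta (fun y => z * f y) (fun y => w * h y) x = z * w * star theta f h x.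
Proof.
move=> fi hi; rewrite /star.
have I := integrable_star_integrand theta x fi hi.
have E p : z * f (rv_of_tuple p.1) * (w * h (rv_of_tuple p.2)) * phase theta x (rv_of_tuple p.1) (rv_of_tuple p.2) =
  z * w * (f (rv_of_tuple p.1) * h (rv_of_tuple p.2) * phase theta x (rv_of_tuple p.1) (rv_of_tuple p.2)) by ring.
under [X in Cintegral _ X]eq_fun do rewrite E.
by rewrite (CintegralZ _ I) mulrCA.
Qed.

Section star_square.
Context (R : realType) (k : nat) (theta : R) (theta0 : theta != 0).
Local Notation m := (k + k)%N.
Local Notation V := ('rV[R]_m).
Local Notation mu := (lebesgue_tuple R m).
Local Notation rv := (@rv_of_tuple R m).
Local Notation cnorm := (@Normc.normc R).
Local Notation "r %:C" := (real_complex R r).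
Local Notation star := (star theta).
Local Notation xt := (xtilde theta).
Local Notation ii := (Complex 0 1 : R[i]).
Implicit Types (x y z : V) (f g phi : V -> R) (i : 'I_m) (q : V -> R[i]).

Definition star_square (a : R) f x : R[i] := star (toC (damp a f)) (toC (damp a f)) x.

(* [q] is the Moyal square of the possibly non integrable function [f]. *)
Definition regular_square f q : Prop :=
  [/\ forall a, 0 < a -> integrableRn (toC (damp a f)),
      continuous f,
      exists2 C, 0 <= C & forall a x, 0 < a -> a <= 1 ->
        cnorm (star_square a f x) <= C * (1 + sqnorm x) &
      forall u : nat -> R, (forall n, 0 < u n) -> u n @[n --> \oo] --> (0 : R) ->
        forall x, ccvg (fun n => star_square (u n) f x) (q x)].

Lemma moyal_regular_square f q x : regular_square f q ->
  moyal theta (toC f) (toC f) x = q x.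
Proof.
move=> [_ _ _ H]; apply: moyal_cvg => u u0 uc.
have E n : moyal_reg theta (u n) (toC f) (toC f) x = star_square (u n) f x.
  rewrite moyal_regE /star_square; apply: (congr2 (fun p q => star p q x)); apply/funext => y;
  by rewrite /toC -mulrzC.
under [X in ccvg X _]eq_fun do rewrite E.
exact: H.
Qed.

Lemma regular_squareZ (c : R) f q : regular_square f q ->
  regular_square (fun x => c * f x) (fun x => (c ^+ 2)%:C * q x).
Proof.
move=> [fi cf [C C0 fC] fq].
have dE a : toC (damp a (fun x => c * f x)) = (fun x => c%:C * toC (damp a f) x).
  by apply/funext => x; rewrite /toC /damp -mulrzC mulrCA.
have E a x : 0 < a -> star_square a (fun x => c * f x) x = (c ^+ 2)%:C * star_square a f x.
  move=> a0; rewrite /star_square !dE starZ; [by rewrite -mulrzC|exact: fi..].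
split.
- by move=> a a0; rewrite dE; apply: CintegrableZ; exact: fi.
- move=> x; apply: (@cvgM _ _ (nbhs x)); last exact: cf.
  by apply: (@cvg_cst _ _ _ (nbhs x)).
- exists (c ^+ 2 * C); first by rewrite mulr_ge0// sqr_ge0.
  move=> a x a0 a1; rewrite E// cnormM cnormR ger0_norm ?sqr_ge0// -[leRHS]mulrA.
  by rewrite ler_wpM2l ?sqr_ge0// fC.
- move=> u u0 uc x; under [X in ccvg X _]eq_fun do rewrite E//.
  by apply: ccvgZ; exact: fq.
Qed.

(** For integrable functions the L1 norms bound the star product uniformly both in the damping and
    in the point. *)
Lemma D_L1_regular_square phi : D_L1 phi ->
  regular_square phi (star (toC phi) (toC phi)).
Proof.
move=> Dphi; have iphi := D_L1_integrable Dphi.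
have B a x : 0 < a -> cnorm (toC (damp a phi) x) <= cnorm (toC phi x).
  by move=> a0; rewrite !cnormR damp_le// ltW.
have id a : 0 < a -> integrableRn (toC (damp a phi)) by exact: integrableRn_damp.
split => //; first exact: D_L1_continuous.
- exists (`|moyal_cst k theta| * (\int[mu]_t cnorm (toC phi (rv t)) * \int[mu]_t cnorm (toC phi (rv t)))).
    by rewrite !mulr_ge0//; apply: Rintegral_ge0 => t _; exact: cnorm_ge0.
  move=> a x a0 _.
  have J : \int[mu]_t cnorm (toC (damp a phi) (rv t)) <= \int[mu]_t cnorm (toC phi (rv t)).
    apply: le_Rintegral => //.
    - exact: Cintegrable_cnorm (id a a0).
    - exact: Cintegrable_cnorm (integrableRn_toC iphi).
    - by move=> t _; exact: B.
  have J0 : 0 <= \int[mu]_t cnorm (toC (damp a phi) (rv t)).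
    by apply: Rintegral_ge0 => t _; exact: cnorm_ge0.
  rewrite (le_trans (cnorm_star_le _ _ (id a a0) (id a a0)))//.
  rewrite (le_trans (ler_wpM2l _ (ler_pM _ _ J J)))// ler_peMr ?lerDl ?sqnorm_ge0//.
  by rewrite !mulr_ge0//; apply: (le_trans J0 J).
- move=> u u0 uc x.
  have c y := damp_cvg phi y uc.
  apply: (@star_cvg _ _ _ _ _ _ _ (fun x => cnorm (toC phi x)) (fun x => cnorm (toC phi x))) => //.
  + by move=> n; exact: (integrableRn_measurable (id _ (u0 n))).
  + by move=> n; exact: (integrableRn_measurable (id _ (u0 n))).
  + exact: Cintegrable_cnorm (integrableRn_toC iphi).
  + exact: Cintegrable_cnorm (integrableRn_toC iphi).
  + by move=> n y; exact: B.
  + by move=> n y; exact: B.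
Qed.

Section xtilde_square.
Variables (phi : V -> R) (Dphi : D_L1 phi) (i : 'I_m).
Let iphi := D_L1_integrable Dphi.
Let idphi := D_L1_integrable (D_L1_partial i Dphi).

(** Both factors [xtilde] are pulled out by parts, the left one first; the derivative of the right
    factor is again [xtilde i] times a function, because [d_i] does not act on [xtilde i]. The
    remaining star products have factors with L1 bounds uniform in small [a]. *)
Lemma star_square_xtilde (a : R) x : 0 < a ->
  star_square a (fun x => xt i x * phi x) x =
  (xt i x)%:C * ((xt i x)%:C * star (toC (damp a phi)) (toC (damp a phi)) x
                 - ii * star (toC (dampD i a phi)) (toC (damp a phi)) x)
  + ii * ((xt i x)%:C * star (toC (damp a phi)) (toC (dampD i a phi)) x
                 - ii * star (toC (dampD i a phi)) (toC (dampD i a phi)) x).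
Proof.
move=> a0; rewrite /star_square.
have dE : toC (damp a (fun x => xt i x * phi x)) = toC (fun x => xt i x * damp a phi x).
  by apply/funext => y; rewrite /toC /damp mulrCA.
have tE (g : V -> R) : toC (fun x => xt i x * g x) = (fun y => (xt i y)%:C * toC g y).
  by apply/funext => y; rewrite /toC mulrzC.
have hp := has_partial_damp i a Dphi; have lc := line_continuous_dampD (i := i) (a := a) Dphi.
have i1 := integrableRn_damp Dphi a0; have i2 := integrableRn_dampD Dphi i a0.
have i3 := integrableRn_xtilde_damp theta Dphi i a0.
have i4 := integrableRn_xtilde_dampD theta Dphi i a0.
have hx : has_partial i (xt i) (fun=> 0).
  by apply: has_partial_affine => y s; rewrite xtilde_shift mulr0 addr0.
have hp' : has_partial i (fun x => xt i x * damp a phi x) (fun x => xt i x * dampD i a phi x).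
  have := has_partialM hx hp; congr has_partial.
  by apply/funext => y; rewrite mul0r add0r.
have lc' : line_continuous i (fun x => xt i x * dampD i a phi x).
  apply: line_continuousM => //; exact: has_partial_line_continuous hx.
have i3' := i3; have i4' := i4; rewrite tE in i3'; rewrite tE in i4'.
rewrite dE [X in star X _]tE (star_xtilde_l x i1 i3' hp' lc' i3 i4).
by rewrite !tE (star_xtilde_r x i1 i3' hp lc i1 i2) (star_xtilde_r x i2 i4' hp lc i1 i2).
Qed.

(** The formula of [star_square_xtilde] with the damping removed: it involves star products of
    integrable functions only, although [xtilde i * phi] itself may not be integrable. *)
Definition xtilde_square x : R[i] :=
  (xt i x)%:C * ((xt i x)%:C * star (toC phi) (toC phi) x
                 - ii * star (toC (partial i phi)) (toC phi) x)
  + ii * ((xt i x)%:C * star (toC phi) (toC (partial i phi)) x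
                 - ii * star (toC (partial i phi)) (toC (partial i phi)) x).

Lemma xtilde_regular_square : regular_square (fun x => xt i x * phi x) xtilde_square.
Proof.
pose N f := \int[mu]_t cnorm (toC f (rv t)).
pose G (K : R) x := `|partial i phi x| + 2 * (K + 1) * `|phi x|.
have iG K : Rintegrable mu (G K \o rv).
  apply: EFin_integrableD; first exact: integrable_norm.
  by apply: EFin_integrableZ; exact: integrable_norm.
have iF : Rintegrable mu ((fun x => `|phi x|) \o rv) by exact: integrable_norm.
have BF a x : 0 < a -> cnorm (toC (damp a phi) x) <= `|phi x|.
  by move=> a0; rewrite cnormR damp_le// ltW.
have BG K a x : 0 < a -> a <= K -> cnorm (toC (dampD i a phi) x) <= G K x.
  by move=> a0 aK; rewrite cnormR dampD_le.
have i1 a : 0 < a -> integrableRn (toC (damp a phi)) by exact: integrableRn_damp.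
have i2 a : 0 < a -> integrableRn (toC (dampD i a phi)) by exact: integrableRn_dampD.
split.
- move=> a a0; have := integrableRn_xtilde_damp theta Dphi i a0; congr integrableRn.
  by apply/funext => y; rewrite /toC /damp mulrCA.
- move=> x; apply: (@cvgM _ _ (nbhs x)); first exact: continuous_xtilde.
  exact: D_L1_continuous.
- pose c := `|moyal_cst k theta|; pose A := \int[mu]_t `|phi (rv t)|; pose B := \int[mu]_t G 1 (rv t).
  pose e := `|2 / theta|.
  have e0 : 0 <= e by exact: normr_ge0.
  have cge : 0 <= c by exact: normr_ge0.
  have A0 : 0 <= A by apply: Rintegral_ge0.
  have B0 : 0 <= B.
    by apply: Rintegral_ge0 => t _; rewrite addr_ge0// mulr_ge0.
  have NA a : 0 < a -> N (damp a phi) <= A.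
    move=> a0; apply: le_Rintegral => //; last by move=> t _; exact: BF.
    exact: Cintegrable_cnorm (i1 a a0).
  have NB a : 0 < a -> a <= 1 -> N (dampD i a phi) <= B.
    move=> a0 a1; apply: le_Rintegral => //; last by move=> t _; exact: BG.
      exact: Cintegrable_cnorm (i2 a a0).
    exact: iG.
  have N0 f : 0 <= N f by apply: Rintegral_ge0 => t _; exact: cnorm_ge0.
  have S f g x (X Y : R) : integrableRn (toC f) -> integrableRn (toC g) ->
      N f <= X -> N g <= Y -> cnorm (star (toC f) (toC g) x) <= c * (X * Y).
    move=> fi gi fX gY; rewrite (le_trans (cnorm_star_le _ _ fi gi))// ler_wpM2l//.
    by apply: ler_pM => //; exact: N0.
  (* One summand per star product, with one factor [e] for each [xtilde] in front of it; two of them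
     account for the growth [1 + sqnorm x]. *)
  exists (e ^+ 2 * (c * (A * A)) + e * (c * (B * A)) + e * (c * (A * B)) + c * (B * B)).
    by rewrite !addr_ge0// ?mulr_ge0// ?sqr_ge0.
  move=> a x a0 a1; rewrite star_square_xtilde//.
  have ni : cnorm ii = 1 by rewrite /= expr0n expr1n add0r sqrtr1.
  have S1 := S _ _ x _ _ (i1 a a0) (i1 a a0) (NA a a0) (NA a a0).
  have S2 := S _ _ x _ _ (i2 a a0) (i1 a a0) (NB a a0 a1) (NA a a0).
  have S3 := S _ _ x _ _ (i1 a a0) (i2 a a0) (NA a a0) (NB a a0 a1).
  have S4 := S _ _ x _ _ (i2 a a0) (i2 a a0) (NB a a0 a1) (NB a a0 a1).
  move: S1 S2 S3 S4.
  set s1 := star _ _ _; set s2 := star (toC (dampD _ _ _)) (toC (damp _ _)) _.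
  set s3 := star (toC (damp _ _)) (toC (dampD _ _ _)) _; set s4 := star _ _ _ => S1 S2 S3 S4.
  clearbody s1 s2 s3 s4.
  have xe := xtilde_le theta i x; have xs := xtilde_sqr_le theta i x.
  have s0 := sqnorm_ge0 x.
  rewrite (le_trans (cnormD _ _))//.
  have -> : (xt i x)%:C * ((xt i x)%:C * s1 - ii * s2) = (xt i x ^+ 2)%:C * s1 - (xt i x)%:C * (ii * s2).
    by rewrite expr2 mulrzC; ring.
  have -> : ii * ((xt i x)%:C * s3 - ii * s4) = (xt i x)%:C * (ii * s3) - ii * (ii * s4) by ring.
  apply: (le_trans (lerD (cnormD _ _) (cnormD _ _))); rewrite !cnormN.
  have n1 : cnorm ((xt i x ^+ 2)%:C * s1) = xt i x ^+ 2 * cnorm s1.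
    by rewrite cnormM cnormR ger0_norm ?sqr_ge0.
  have nx s : cnorm ((xt i x)%:C * (ii * s)) = `|xt i x| * cnorm s.
    by rewrite cnormM cnormR (cnormM ii) ni mul1r.
  have nn s : cnorm (ii * (ii * s)) = cnorm s by rewrite !(cnormM ii) ni !mul1r.
  rewrite n1 !nx nn.
  have E1 : xt i x ^+ 2 * cnorm s1 <= e ^+ 2 * (c * (A * A)) * (1 + sqnorm x).
    rewrite [leRHS]mulrAC; apply: ler_pM; rewrite ?sqr_ge0 ?cnorm_ge0//.
    by rewrite (le_trans xs)// /e real_normK ?num_real// ler_wpM2l ?sqr_ge0// lerDr.
  have E2 : `|xt i x| * cnorm s2 <= e * (c * (B * A)) * (1 + sqnorm x).
    by rewrite [leRHS]mulrAC; apply: ler_pM; rewrite ?cnorm_ge0.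
  have E3 : `|xt i x| * cnorm s3 <= e * (c * (A * B)) * (1 + sqnorm x).
    by rewrite [leRHS]mulrAC; apply: ler_pM; rewrite ?cnorm_ge0.
  have E4 : cnorm s4 <= c * (B * B) * (1 + sqnorm x).
    by rewrite (le_trans S4)// ler_peMr ?lerDl// !mulr_ge0.
  lra.
- move=> u u0 uc x; under [X in ccvg X _]eq_fun do rewrite star_square_xtilde//.
  (* The bound [dampD_le] is uniform for parameters below a fixed [K]; here [u] is an arbitrary null
     sequence, so [K] is taken as an upper bound of it. *)
  have [K K0 uK] := bounded_cvg uc.
  have c1 y := damp_cvg phi y uc.
  have c2 y : ccvg (fun n => toC (dampD i (u n) phi) y) (toC (partial i phi) y).
    rewrite -[X in ccvg _ X]mul1r /toC /dampD; under [X in ccvg X _]eq_fun do rewrite mulrzC.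
    apply: ccvgM; first exact: gauss_cvg.
    apply: ccvgR.
    have : partial i phi y - 2 * u n * y 0 i * phi y @[n --> \oo] -->
           partial i phi y - 2 * 0 * y 0 i * phi y.
      apply: cvgB; first exact: cvg_cst.
      apply: cvgM; last exact: cvg_cst.
      apply: cvgM; last exact: cvg_cst.
      by apply: cvgM => //; exact: cvg_cst.
    by rewrite mulr0 !mul0r subr0.
  have m1 n : Cmeasurable (toC (damp (u n) phi) \o rv) := integrableRn_measurable (i1 _ (u0 n)).
  have m2 n : Cmeasurable (toC (dampD i (u n) phi) \o rv) := integrableRn_measurable (i2 _ (u0 n)).
  have b1 n y : cnorm (toC (damp (u n) phi) y) <= `|phi y| by exact: BF.
  have b2 n y : cnorm (toC (dampD i (u n) phi) y) <= G K y by exact: BG.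
  have cv1 := star_cvg theta x m1 m1 iF iF b1 b1 c1 c1.
  have cv2 := star_cvg theta x m2 m1 (iG K) iF b2 b1 c2 c1.
  have cv3 := star_cvg theta x m1 m2 iF (iG K) b1 b2 c1 c2.
  have cv4 := star_cvg theta x m2 m2 (iG K) (iG K) b2 b2 c2 c2.
  have ccvgB (v w : nat -> R[i]) l l' : ccvg v l -> ccvg w l' -> ccvg (fun n => v n - ii * w n) (l - ii * l').
    move=> vl wl; rewrite -!mulNr; under [X in ccvg X _]eq_fun do rewrite -mulNr.
    by apply: ccvgD => //; exact: ccvgZ.
  apply: ccvgD; apply: ccvgZ; apply: ccvgB => //; exact: ccvgZ.
Qed.

End xtilde_square.
End star_square.

(** * Composition of Gaussians and square norms *)

Section gaussian_composition.
Context (R : realType) (k : nat) (theta : R) (theta0 : theta != 0).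
Local Notation m := (k + k)%N.
Local Notation RR := (measurableTypeR R).
Local Notation V := ('rV[R]_m).
Local Notation T := (m.-tuple RR).
Local Notation mu := (lebesgue_tuple R m).
Local Notation rv := (@rv_of_tuple R m).
Local Notation cnorm := (@Normc.normc R).
Local Notation "r %:C" := (real_complex R r).
Local Notation star := (star theta).
Local Notation rate := (rate theta).
Local Notation twist := (twist theta).
Implicit Types (x y z : V) (f g : V -> R) (s : R).

(* The star product of a Gaussian of parameter [s] with itself is [mass2 s] times
   the Gaussian of parameter [rate2 s]. *)
Definition rate2 s : R := 2 * s / (1 + theta ^+ 2 * s ^+ 2).

Definition mass2 s : R := ((1 + theta ^+ 2 * s ^+ 2)^-1) ^+ k.

(** Apollonius' identity: centring at the midpoint of [y] and [z] decouples the integration variable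
    [x] from [y - z]. *)
Lemma sqnorm_midpoint x y z : let c := 2^-1 *: (y + z) in
  sqnorm (c + x - z) + sqnorm (c + x - y) = 2 * sqnorm x + sqnorm (y - z) / 2.
Proof.
rewrite /sqnorm mulr_sumr mulr_suml -!big_split; apply: eq_bigr => i _ /=.
by rewrite !mxE; field.
Qed.

(** With the same centre the quadratic terms of the phase cancel, leaving the twist of the end
    points and a phase linear in [x]. *)
Lemma twist_midpoint x y z : let c := 2^-1 *: (y + z) in
  twist z (c + x) * twist (c + x) y =
  twist z y * expi (\sum_i symplectic_row (- (2 / theta) *: (y - z)) 0 i * x 0 i).
Proof.
move=> c; rewrite -omega_symplectic_row /twist -!expiD; apply: (congr1 (@expi R)).
rewrite /c.
rewrite omegaZl !omegaDl !omegaDr !omegaZl !omegaZr !omegaDl !omegaDr !omegaNl.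
rewrite !omegaxx (omegaC y x); field.
exact: theta0.
Qed.

Lemma denominator_gt0 s : 0 < 1 + theta ^+ 2 * s ^+ 2.
Proof. by rewrite ltr_pwDl// mulr_ge0// sqr_ge0. Qed.

Lemma rate2_gt0 s : 0 < s -> 0 < rate2 s.
Proof. by move=> s0; rewrite divr_gt0 ?denominator_gt0// mulr_gt0. Qed.

Lemma mass2_ge0 s : 0 <= mass2 s.
Proof. by rewrite exprn_ge0// invr_ge0 ltW// denominator_gt0. Qed.

Lemma mass2_le1 s : mass2 s <= 1.
Proof.
by rewrite exprn_ile1 ?invr_ge0 ?(ltW (denominator_gt0 _))// invf_le1 ?denominator_gt0// lerDl mulr_ge0// sqr_ge0.
Qed.

Lemma heat_bound (A : R) x : 0 < A -> heat A x <= (A / pi) ^+ k.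
Proof.
move=> A0; rewrite /heat ler_piMr ?gauss_le1 ?(ltW A0)//.
by rewrite exprn_ge0// divr_ge0// ?(ltW (pi_gt0 R))// ltW.
Qed.

Lemma Cintegrable_heat (A : R) (f : V -> R[i]) (b : T -> R[i]) x :
  0 < A -> integrableRn f -> Cmeasurable b -> (forall t, cnorm (b t) = 1) ->
  Cintegrable mu (fun t => f (rv t) * b t * (heat A (rv t - x))%:C).
Proof.
move=> A0 fi mb b1.
apply: (@le_Cintegrable _ _ _ _ _ (fun t => (A / pi) ^+ k * cnorm (f (rv t)))).
- apply: CmeasurableM; last by apply: CmeasurableR; exact: measurable_heat_shift.
  by apply: CmeasurableM => //; exact: integrableRn_measurable.
- by apply: EFin_integrableZ; exact: Cintegrable_cnorm fi.
- move=> t; rewrite !cnormM b1 mulr1 cnormR ger0_norm ?heat_ge0// mulrC ler_wpM2r ?cnorm_ge0//.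
  exact: heat_bound.
Qed.

(** After recentring, the integral is the Fourier integral of a Gaussian of rate [2A]. The two
    Gaussians in [y - z], from Apollonius' identity and from that transform, have rates [A / 2] and
    [s / 2]; their sum is [rate (rate2 s)], and [mass2 s] collects the prefactors. *)
Lemma twist_heat_composition s y z : 0 < s ->
  Cintegral mu (fun t => (twist z (rv t) * (heat (rate s) (rv t - z))%:C) *
                         (twist (rv t) y * (heat (rate s) (rv t - y))%:C)) =
  (mass2 s)%:C * (twist z y * (heat (rate (rate2 s)) (y - z))%:C).
Proof.
move=> s0; set A := rate s; have A0 : 0 < A by exact: rate_gt0.
have A20 : 0 < 2 * A by rewrite mulr_gt0.
pose c := 2^-1 *: (y + z).
pose F (v : V) := (twist z v * (heat A (v - z))%:C) * (twist v y * (heat A (v - y))%:C).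
have mF : Cmeasurable (F \o rv).
  apply: CmeasurableM; apply: CmeasurableM; try (apply: CmeasurableR; exact: measurable_heat_shift).
    exact: Cmeasurable_twist_r.
  exact: Cmeasurable_twist_l.
rewrite -[LHS](translation_Cintegral c mF).
pose w := symplectic_row (- (2 / theta) *: (y - z)).
have [I J] := Cintegral_gauss_rv w A20.
pose K := twist z y * ((A / pi) ^+ k * (A / pi) ^+ k * expR (- (A / 2 * sqnorm (y - z))))%:C.
have FE t : F (c + rv t) = K * ((gauss (2 * A) (rv t))%:C * expi (\sum_i w 0 i * rv t 0 i)).
  rewrite /F mulrACA twist_midpoint -/w -/c.
  have -> : (heat A (c + rv t - z))%:C * (heat A (c + rv t - y))%:C =
     ((A / pi) ^+ k * (A / pi) ^+ k * expR (- (A / 2 * sqnorm (y - z))))%:C * (gauss (2 * A) (rv t))%:C.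
    rewrite -!mulrzC; apply: (congr1 (real_complex R)).
    have G : gauss A (c + rv t - z) * gauss A (c + rv t - y) =
        expR (- (A / 2 * sqnorm (y - z))) * gauss (2 * A) (rv t).
      rewrite /gauss -!expRD -mulrDr sqnorm_midpoint; congr expR; by field.
    by rewrite /heat mulrACA G mulrA.
  by rewrite /K; ring.
under [X in Cintegral _ X]eq_fun do rewrite FE.
rewrite (CintegralZ K I) J /K -mulrA -mulrzC [RHS]mulrCA -mulrzC; apply: (congr1 (fun r => twist z y * r%:C)).
have -> : sqnorm w = (2 / theta) ^+ 2 * sqnorm (y - z).
  by rewrite sqnorm_symplectic_row /sqnorm mulr_sumr; apply: eq_bigr => i _; rewrite mxE exprMn sqrrN.
rewrite sqrt_addn; last by rewrite divr_ge0// ltW// pi_gt0.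
rewrite /mass2 /heat /gauss mulrACA [RHS]mulrA.
have dn := lt0r_neq0 (denominator_gt0 s).
have sn := lt0r_neq0 s0.
have dn' : 1 + (theta * s) ^+ 2 != 0 by rewrite exprMn.
rewrite -!exprMn -expRD /A /rate /rate2.
congr (_ ^+ k * expR _).
  have := lt0r_neq0 (pi_gt0 R); move: (@pi R) => p p0.
  by field; rewrite theta0 p0 sn ?dn ?dn'.
by field; rewrite theta0 sn ?dn ?dn'.
Qed.

(** The formula of [star_gauss_r] taken as a definition: as a single integral against a heat kernel
    it makes sense for functions, such as [xtilde * phi], that are integrable only after damping. *)
Definition smooth s (f : V -> R[i]) x : R[i] :=
  Cintegral mu (fun t => f (rv t) * twist x (rv t) * (heat (rate s) (rv t - x))%:C).

Lemma star_smooth s (f : V -> R[i]) x : integrableRn f -> 0 < s ->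
  star f (gaussC s) x = smooth s f x.
Proof. exact: star_gauss_r. Qed.

Lemma measurable_heat_kernel (A : R) :
  measurable_fun setT (fun p : T * T => heat A (rv p.2 - rv p.1)).
Proof.
apply: measurable_heat => i; apply: measurable_coordB => j; first exact: measurable_coord2.
exact: measurable_coord1.
Qed.

Lemma integrable_heat_kernel (A : R) (f : T -> R) : 0 < A -> Rintegrable mu f ->
  Rintegrable (mu \x mu)%E (fun p => f p.2 * heat A (rv p.2 - rv p.1)).
Proof.
move=> A0 fi; apply: (@integrable_kernel_r _ _ _ _ _ mu mu
  (fun p => heat A (rv p.2 - rv p.1)) f 1) => //.
- exact: measurable_heat_kernel.
- by move=> p; exact: heat_ge0.
- move=> t; have [I J] := heat_integrable (rv t) A0.
  under eq_integral do rewrite heatB.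
  by rewrite -EFin_Rintegral// J.
Qed.

Lemma Cintegrable_heat_kernel (A : R) (f : V -> R[i]) (b : T * T -> R[i]) :
  0 < A -> integrableRn f -> Cmeasurable b -> (forall p, cnorm (b p) = 1) ->
  Cintegrable (mu \x mu)%E (fun p => f (rv p.2) * b p * (heat A (rv p.2 - rv p.1))%:C).
Proof.
move=> A0 fi mb b1.
apply: (@le_Cintegrable _ _ _ _ _ (fun p : T * T => cnorm (f (rv p.2)) * heat A (rv p.2 - rv p.1))).
- apply: CmeasurableM; last by apply: CmeasurableR; exact: measurable_heat_kernel.
  by apply: CmeasurableM => //; apply: Cmeasurable_snd; exact: integrableRn_measurable.
- exact: (integrable_heat_kernel A0 (Cintegrable_cnorm fi)).
- by move=> p; rewrite !cnormM b1 mulr1 cnormR ger0_norm ?heat_ge0.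
Qed.

Lemma Cmeasurable_twist12 : Cmeasurable (fun p : T * T => twist (rv p.1) (rv p.2)).
Proof. by apply: Cmeasurable_twist => i; [exact: measurable_coord1|exact: measurable_coord2]. Qed.

Lemma Cmeasurable_twist21 : Cmeasurable (fun p : T * T => twist (rv p.2) (rv p.1)).
Proof. by apply: Cmeasurable_twist => i; [exact: measurable_coord2|exact: measurable_coord1]. Qed.

Lemma integrableRn_star_gauss_r s (f : V -> R[i]) : 0 < s -> integrableRn f ->
  integrableRn (star f (gaussC s)).
Proof.
move=> s0 fi; rewrite /integrableRn /comp; under eq_fun do rewrite star_gauss_r//.
have := Cintegrable_heat_kernel (rate_gt0 theta0 s0) fi Cmeasurable_twist12
  (fun p => cnorm_twist _ _ _).
by move=> /Cintegrable_fubini_l.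
Qed.

Lemma integrableRn_star_gauss_l s (f : V -> R[i]) : 0 < s -> integrableRn f ->
  integrableRn (star (gaussC s) f).
Proof.
move=> s0 fi; rewrite /integrableRn /comp; under eq_fun do rewrite star_gauss_l//.
have := Cintegrable_heat_kernel (rate_gt0 theta0 s0) fi Cmeasurable_twist21
  (fun p => cnorm_twist _ _ _).
by move=> /Cintegrable_fubini_l.
Qed.

(** An instance of associativity, obtained by Fubini from the composition of the two twisted heat
    kernels. *)
Lemma star_gauss_gauss s (f : V -> R[i]) y : 0 < s -> integrableRn f ->
  star (gaussC s) (star (gaussC s) f) y = (mass2 s)%:C * star (gaussC (rate2 s)) f y.
Proof.
move=> s0 fi; have A0 := rate_gt0 theta0 s0.
rewrite star_gauss_l//; last exact: integrableRn_star_gauss_l.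
rewrite star_gauss_l//; last exact: rate2_gt0.
pose H (p : T * T) := f (rv p.2) * twist (rv p.2) (rv p.1) * (heat (rate s) (rv p.2 - rv p.1))%:C.
have iH : Cintegrable (mu \x mu)%E H.
  exact: (Cintegrable_heat_kernel A0 fi Cmeasurable_twist21 (fun p => cnorm_twist _ _ _)).
pose b (t : T) := twist (rv t) y * (heat (rate s) (rv t - y))%:C.
have mb : Cmeasurable b.
  by apply: CmeasurableM; [exact: Cmeasurable_twist_l|apply: CmeasurableR; exact: measurable_heat_shift].
have bC t : cnorm (b t) <= (rate s / pi) ^+ k.
  by rewrite cnormM cnorm_twist mul1r cnormR ger0_norm ?heat_ge0// heat_bound.
have iG : Cintegrable (mu \x mu)%E (fun p => b p.1 * H p).
  apply: (@Cintegrable_bM _ _ _ _ (fun p : T * T => b p.1) H ((rate s / pi) ^+ k)) => //.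
  by apply: (@Cmeasurable_comp _ _ _ _ _ fst b).
have E1 t : star (gaussC s) f (rv t) * twist (rv t) y * (heat (rate s) (rv t - y))%:C =
    Cintegral mu (fun r => b t * H (t, r)).
  rewrite star_gauss_l// -mulrA mulrC; apply/esym.
  have I : Cintegrable mu (fun r => f (rv r) * twist (rv r) (rv t) * (heat (rate s) (rv r - rv t))%:C).
    exact: (Cintegrable_heat (rv t) A0 fi (Cmeasurable_twist_l theta (rv t)) (fun r => cnorm_twist theta (rv r) (rv t))).
  exact: (CintegralZ (b t) I).
under [X in Cintegral _ X = _]eq_fun do rewrite E1.
rewrite (Cintegral_exchange iG).
have E2 r : Cintegral mu (fun t => b t * H (t, r)) =
    (mass2 s)%:C * (f (rv r) * twist (rv r) y * (heat (rate (rate2 s)) (rv r - y))%:C).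
  have -> : (fun t => b t * H (t, r)) = (fun t => f (rv r) *
     ((twist (rv r) (rv t) * (heat (rate s) (rv t - rv r))%:C) *
      (twist (rv t) y * (heat (rate s) (rv t - y))%:C))).
    by apply/funext => t; rewrite /H /b /= (heatB _ (rv r)); ring.
  rewrite (CintegralZ (f (rv r))); last first.
    have [I _] := heat_integrable y A0.
    apply: (@le_Cintegrable _ _ _ _ _ (fun t => (rate s / pi) ^+ k * heat (rate s) (rv t - y))).
    - have m1 := CmeasurableM (Cmeasurable_twist_r theta (rv r)) (CmeasurableR (measurable_heat_shift (rate s) (rv r))).
      exact: (CmeasurableM m1 mb).
    - exact: EFin_integrableZ.
    - move=> t; rewrite !cnormM !cnorm_twist !mul1r !cnormR !ger0_norm ?heat_ge0//.
      by rewrite ler_wpM2r ?heat_ge0// heat_bound.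
  by rewrite twist_heat_composition// heatB; ring.
under [X in Cintegral _ X = _]eq_fun do rewrite E2.
have B0 := rate_gt0 theta0 (rate2_gt0 s0).
exact: (CintegralZ _ (Cintegrable_heat y B0 fi (Cmeasurable_twist_l theta y) (fun r => cnorm_twist theta (rv r) y))).
Qed.

Lemma conj_star_gauss s f x : 0 < s -> integrableRn (toC f) ->
  conjc (star (toC f) (gaussC s) x) = star (gaussC s) (toC f) x.
Proof.
move=> s0 fi; rewrite (starJ theta x fi (integrableRn_gaussC k s0)).
apply: (congr2 (fun p q => star p q x)); last exact: conjc_toC.
by apply/funext => y; rewrite conjcR.
Qed.

(* Pairing the Moyal square with a Gaussian produces a square norm, hence the
   positivity that pointwise values of [f * f] lack. *)
Lemma integral_star_square_gauss s f : 0 < s -> integrableRn (toC f) ->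
  Rintegrable mu (fun t => cnorm (star (toC f) (gaussC s) (rv t)) ^+ 2) /\
  integralRn (fun x => star (toC f) (toC f) x * ((mass2 s)%:C * gaussC (rate2 s) x)) =
  (\int[mu]_t cnorm (star (toC f) (gaussC s) (rv t)) ^+ 2)%:C.
Proof.
move=> s0 fi; have gi := integrableRn_gaussC k s0.
have g2i := integrableRn_gaussC k (rate2_gt0 s0).
have li := integrableRn_star_gauss_l s0 fi; have ri := integrableRn_star_gauss_r s0 fi.
have sq x : star (toC f) (gaussC s) x * star (gaussC s) (toC f) x =
    (cnorm (star (toC f) (gaussC s) x) ^+ 2)%:C by rewrite -conj_star_gauss// mulcJ.
have I : Cintegrable mu (fun t => (cnorm (star (toC f) (gaussC s) (rv t)) ^+ 2)%:C).
  under eq_fun do rewrite -sq.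
  apply: (@Cintegrable_bM _ _ _ _ (star (toC f) (gaussC s) \o rv) (star (gaussC s) (toC f) \o rv)
    (`|moyal_cst k theta| * (\int[mu]_t cnorm (toC f (rv t)) * \int[mu]_t cnorm (gaussC s (rv t))))) => //.
  - exact: integrableRn_measurable.
  - by move=> t; exact: cnorm_star_le.
split; first exact: I.1.
rewrite -CintegralR.
have <- : integralRn (fun x => star (toC f) (gaussC s) x * star (gaussC s) (toC f) x) =
    Cintegral mu (fun t => (cnorm (star (toC f) (gaussC s) (rv t)) ^+ 2)%:C).
  by congr Cintegral; apply/funext => t; exact: sq.
(* With [g] the Gaussian, the square norm is the integral of [(f * g) (g * f)]. Cyclicity makes it
   [f (g * (g * f))], where the two Gaussians merge into one; two more uses bring that one outside
   as a pointwise factor of [f * f]. *)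
rewrite (integral_star_mul theta fi gi li).
have E1 x : toC f x * star (gaussC s) (star (gaussC s) (toC f)) x =
   (mass2 s)%:C * (toC f x * star (gaussC (rate2 s)) (toC f) x).
  by rewrite star_gauss_gauss// mulrCA.
have E2 x : star (toC f) (toC f) x * ((mass2 s)%:C * gaussC (rate2 s) x) =
   (mass2 s)%:C * (star (toC f) (toC f) x * gaussC (rate2 s) x) by rewrite mulrCA.
rewrite /integralRn /comp.
under [X in _ = Cintegral _ X]eq_fun do rewrite E1.
under [X in Cintegral _ X = _]eq_fun do rewrite E2.
have bM (h q : V -> R[i]) (C : R) : Cmeasurable (h \o rv) -> (forall x, cnorm (h x) <= C) ->
    integrableRn q -> Cintegrable mu (fun t => h (rv t) * q (rv t)).
  by move=> mh hC; apply: Cintegrable_bM => // t; exact: hC.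
have I1 : Cintegrable mu (fun t => star (toC f) (toC f) (rv t) * gaussC (rate2 s) (rv t)).
  by apply: bM => //; [exact: Cmeasurable_star|move=> x; exact: cnorm_star_le].
have I2 : Cintegrable mu (fun t => toC f (rv t) * star (gaussC (rate2 s)) (toC f) (rv t)).
  under eq_fun do rewrite mulrC.
  by apply: bM => //; [exact: Cmeasurable_star|move=> x; exact: cnorm_star_le].
rewrite (CintegralZ _ I1) (CintegralZ _ I2); congr (_ * _).
etransitivity; first exact: (integral_star_mul theta fi fi g2i).
etransitivity; last exact: (integral_star_mul theta fi g2i fi).
by congr Cintegral; apply/funext => t; exact: mulrC.
Qed.

Lemma smooth_contraction s f : 0 < s -> integrableRn (toC f) ->
  Rintegrable mu (fun t => f (rv t) ^+ 2) ->
  \int[mu]_t cnorm (star (toC f) (gaussC s) (rv t)) ^+ 2 <= \int[mu]_t f (rv t) ^+ 2.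
Proof.
move=> s0 fi f2i; have A0 := rate_gt0 theta0 s0.
have [I _] := integral_star_square_gauss s0 fi.
have iF := integrable_heat_kernel A0 f2i.
have bh (g : V -> R) x : Rintegrable mu (g \o rv) ->
    Rintegrable mu (fun t => g (rv t) * heat (rate s) (rv t - x)).
  move=> gi; apply: (@le_EFin_integrable _ _ _ _ _ (fun t => (rate s / pi) ^+ k * `|g (rv t)|)).
  - by apply: measurable_funM; [exact: integrable_measurable gi|exact: measurable_heat_shift].
  - by apply: EFin_integrableZ; exact: integrable_norm.
  - by move=> t; rewrite normrM mulrC ler_wpM2r// ger0_norm ?heat_ge0// heat_bound.
have P x : cnorm (star (toC f) (gaussC s) x) ^+ 2 <= \int[mu]_t (f (rv t) ^+ 2 * heat (rate s) (rv t - x)).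
  pose c := \int[mu]_t (`|f (rv t)| * heat (rate s) (rv t - x)).
  have [iH JH] := heat_integrable x A0.
  have i1 : Rintegrable mu (fun t => `|f (rv t)| * heat (rate s) (rv t - x)).
    by apply: (bh (fun x => `|f x|)); exact: integrable_norm fi.1.
  have i2 : Rintegrable mu (fun t => f (rv t) ^+ 2 * heat (rate s) (rv t - x)).
    exact: (bh (fun x => f x ^+ 2)).
  have c0 : 0 <= c by apply: Rintegral_ge0 => t _; rewrite mulr_ge0// heat_ge0.
  have le1 : cnorm (star (toC f) (gaussC s) x) <= c.
    rewrite star_gauss_r//; apply: (le_trans (cnorm_Cintegral_le _)).
      by apply: Cintegrable_heat => //; [exact: Cmeasurable_twist_r|move=> t; exact: cnorm_twist].
    rewrite le_eqVlt; apply/orP; left; apply/eqP; apply: eq_Rintegral => t _.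
    by rewrite !cnormM cnorm_twist mulr1 !cnormR (ger0_norm (heat_ge0 _ A0)).
  apply: (@le_trans _ _ (c ^+ 2)); first by rewrite ler_pXn2r ?nnegrE ?cnorm_ge0.
  (* Jensen's inequality for the probability density [heat]: the variance of [|f|] about its mean
     [c] is nonnegative. *)
  have : 0 <= \int[mu]_t ((`|f (rv t)| - c) ^+ 2 * heat (rate s) (rv t - x)).
    by apply: Rintegral_ge0 => t _; rewrite mulr_ge0 ?sqr_ge0 ?heat_ge0.
  have E t : (`|f (rv t)| - c) ^+ 2 * heat (rate s) (rv t - x) =
     f (rv t) ^+ 2 * heat (rate s) (rv t - x) +
     ((- (2 * c)) * (`|f (rv t)| * heat (rate s) (rv t - x)) + c ^+ 2 * heat (rate s) (rv t - x)).
    by rewrite -[f (rv t) ^+ 2]real_normK ?num_real//; ring.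
  under eq_Rintegral do rewrite E.
  rewrite RintegralD//; last by apply: EFin_integrableD; exact: EFin_integrableZ.
  rewrite RintegralD//; [|exact: EFin_integrableZ..].
  rewrite (@RintegralZl _ _ _ mu setT (fun t => `|f (rv t)| * heat (rate s) (rv t - x)))//.
  rewrite (@RintegralZl _ _ _ mu setT (fun t => heat (rate s) (rv t - x)))// JH -/c.
  by rewrite mulr1; lra.
have J : Rintegrable mu (fun t : T => \int[mu]_r (f (rv r) ^+ 2 * heat (rate s) (rv r - rv t))).
  exact: (Rintegrable_fubini_l iF).
apply: (@le_trans _ _ (\int[mu]_t \int[mu]_r (f (rv r) ^+ 2 * heat (rate s) (rv r - rv t)))).
  by apply: le_Rintegral => // t _; exact: P.
rewrite -(Rintegral_fubini_l iF) (Rintegral_fubini_r iF) le_eqVlt; apply/orP; left; apply/eqP.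
apply: eq_Rintegral => r _ /=.
have [iH JH] := heat_integrable (rv r) A0.
under eq_Rintegral do rewrite heatB.
by rewrite (@RintegralZl _ _ _ mu setT (fun t => heat (rate s) (rv t - rv r)))// JH mulr1.
Qed.

End gaussian_composition.

(** * Traces of sums of Moyal squares *)

Section regular_square_trace.
Context (R : realType) (k : nat) (theta : R) (theta0 : theta != 0).
Local Notation m := (k + k)%N.
Local Notation V := ('rV[R]_m).
Local Notation mu := (lebesgue_tuple R m).
Local Notation rv := (@rv_of_tuple R m).
Local Notation cnorm := (@Normc.normc R).
Local Notation "r %:C" := (real_complex R r).
Local Notation star := (star theta).
Local Notation rate := (rate theta).
Local Notation twist := (twist theta).
Local Notation smooth := (smooth theta).
Local Notation regular_square := (regular_square theta).
Local Notation star_square := (star_square theta).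
Implicit Types (x y z : V) (f g : V -> R) (s : R) (q : V -> R[i]).

(** By [star_gauss_gauss] this is the function whose star action is that of [gaussC s] applied
    twice. It is at most 1 and tends to 1 as [s] tends to 0. *)
Definition cutoff s x : R[i] := (mass2 k theta s)%:C * gaussC (rate2 theta s) x.

Definition inv_seq (n : nat) : R := n.+1%:R^-1.

Lemma inv_seq_gt0 n : 0 < inv_seq n. Proof. by rewrite invr_gt0. Qed.

Lemma inv_seq_le1 n : inv_seq n <= 1. Proof. by rewrite invf_le1// ler1n. Qed.

Lemma inv_seq_cvg : inv_seq n @[n --> \oo] --> (0 : R).
Proof. exact: cvg_harmonic. Qed.

(** Measurability concerns tuples while continuity concerns row vectors; it is inherited from the
    integrable damped functions, whose pointwise limit is [f]. *)
Lemma continuous_measurable f : continuous f -> (forall a, 0 < a -> integrableRn (toC (damp a f))) ->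
  measurable_fun setT (f \o rv).
Proof.
move=> cf fi.
apply: (@measurable_fun_cvg _ _ _ _ (fun n t => damp (inv_seq n) f (rv t))) => //.
  by move=> n; exact: (integrable_measurable (fi _ (inv_seq_gt0 n)).1).
move=> t _; have [H _] := gauss_cvg (rv t) inv_seq_cvg.
rewrite -[X in _ --> X]mul1r; apply: cvgM; [exact: H|exact: cvg_cst].
Qed.

Lemma cnorm_cutoff_le s x : 0 < s -> cnorm (cutoff s x) <= gauss (rate2 theta s) x.
Proof.
move=> s0; rewrite cnormM !cnormR (ger0_norm (gauss_ge0 _ _)) ger0_norm ?mass2_ge0//.
by rewrite ler_piMl ?gauss_ge0// mass2_le1.
Qed.

Lemma rate2_cvg (u : nat -> R) : u n @[n --> \oo] --> (0 : R) ->
  rate2 theta (u n) @[n --> \oo] --> (0 : R).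
Proof.
move=> uc.
have H : 2 * u n / (1 + theta ^+ 2 * u n ^+ 2) @[n --> \oo] --> 2 * 0 / (1 + theta ^+ 2 * 0 ^+ 2).
  apply: cvgM; first by apply: cvgM => //; exact: cvg_cst.
  apply: cvgV; first by rewrite lt0r_neq0// denominator_gt0.
  apply: cvgD; first exact: cvg_cst.
  apply: cvgM; first exact: cvg_cst.
  by rewrite expr2; under eq_cvg do rewrite expr2; exact: cvgM.
by rewrite mulr0 mul0r in H.
Qed.

Lemma mass2_cvg (u : nat -> R) : u n @[n --> \oo] --> (0 : R) ->
  mass2 k theta (u n) @[n --> \oo] --> (1 : R).
Proof.
move=> uc.
have H : (1 + theta ^+ 2 * u n ^+ 2)^-1 @[n --> \oo] --> (1 + theta ^+ 2 * 0 ^+ 2)^-1.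
  apply: cvgV; first by rewrite lt0r_neq0// denominator_gt0.
  apply: cvgD; first exact: cvg_cst.
  apply: cvgM; first exact: cvg_cst.
  by rewrite expr2; under eq_cvg do rewrite expr2; exact: cvgM.
rewrite expr0n mulr0 addr0 invr1 in H.
have := continuous_cvg _ (@exprn_continuous R k 1) H; rewrite expr1n; exact.
Qed.

Lemma cutoff_cvg (u : nat -> R) x : (forall n, 0 < u n) -> u n @[n --> \oo] --> (0 : R) ->
  ccvg (fun n => cutoff (u n) x) 1.
Proof.
move=> u0 uc; rewrite -[X in ccvg _ X]mul1r; apply: ccvgM.
  rewrite -[X in ccvg _ X](rmorph1 (real_complex R)).
  by apply: ccvgR; exact: mass2_cvg.
exact: (gauss_cvg x (rate2_cvg uc)).
Qed.

(** Recentring the heat kernel at the origin halves its rate, so the integral is controlled by [f]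
    damped at [rate s / 2]. *)
Lemma regular_smooth_integrable f q s x : regular_square f q -> 0 < s ->
  Rintegrable mu (fun t => `|f (rv t)| * heat (rate s) (rv t - x)).
Proof.
move=> [fi cf _ _] s0; have A0 := rate_gt0 theta0 s0.
have A20 : 0 < rate s / 2 by rewrite divr_gt0.
pose K := (rate s / pi) ^+ k * expR (rate s * sqnorm x).
apply: (@le_EFin_integrable _ _ _ _ _ (fun t => K * `|damp (rate s / 2) f (rv t)|)).
- apply: measurable_funM; last exact: measurable_heat_shift.
  by apply: measurableT_comp => //; exact: continuous_measurable.
- by apply: EFin_integrableZ; exact: integrable_norm (fi _ A20).1.
- move=> t; rewrite normrM (ger0_norm (heat_ge0 _ A0)) normr_id /damp normrM.
  rewrite (ger0_norm (gauss_ge0 _ _)) [leRHS]mulrA [leLHS]mulrC ler_wpM2r//.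
  rewrite /heat /K -[leRHS]mulrA ler_wpM2l//; last exact: gauss_shift_le (ltW A0).
  by rewrite exprn_ge0// divr_ge0// ?(ltW (pi_gt0 R))// ltW.
Qed.

Lemma Cmeasurable_smooth_integrand (A : R) f x : measurable_fun setT (f \o rv) ->
  Cmeasurable (fun t => toC f (rv t) * twist x (rv t) * (heat A (rv t - x))%:C).
Proof.
move=> mf; apply: CmeasurableM; last by apply: CmeasurableR; exact: measurable_heat_shift.
by apply: CmeasurableM; [exact: CmeasurableR|exact: Cmeasurable_twist_r].
Qed.

Lemma smooth_damp_cvg f q s x : regular_square f q -> 0 < s ->
  ccvg (fun n => star (toC (damp (inv_seq n) f)) (gaussC s) x) (smooth s (toC f) x).
Proof.
move=> rf s0; have [fi cf _ _] := rf; have A0 := rate_gt0 theta0 s0.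
have E n := star_smooth theta0 x (fi _ (inv_seq_gt0 n)) s0.
under [X in ccvg X _]eq_fun do rewrite E.
have [] := @Cintegral_dct _ _ _ mu
  (fun n t => toC (damp (inv_seq n) f) (rv t) * twist x (rv t) * (heat (rate s) (rv t - x))%:C)
  (fun t => toC f (rv t) * twist x (rv t) * (heat (rate s) (rv t - x))%:C)
  (fun t => `|f (rv t)| * heat (rate s) (rv t - x)) => //.
- by move=> n; apply: Cmeasurable_smooth_integrand; exact: integrable_measurable (fi _ (inv_seq_gt0 n)).1.
- exact: regular_smooth_integrable rf s0.
- move=> n t; rewrite !cnormM cnorm_twist mulr1 !cnormR (ger0_norm (heat_ge0 _ A0)).
  by rewrite ler_wpM2r ?heat_ge0// damp_le// ltW// inv_seq_gt0.
- move=> t; apply: ccvgM; last exact: ccvg_cst.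
  apply: ccvgM; last exact: ccvg_cst.
  exact: damp_cvg inv_seq_cvg.
Qed.

Lemma smooth_cvg f q x : regular_square f q ->
  ccvg (fun n => smooth (inv_seq n) (toC f) x) (f x)%:C.
Proof.
move=> rf; have [fi cf _ _] := rf.
have mf := continuous_measurable cf fi.
have [|||||_ C] := @heat_approx R k (fun n => rate (inv_seq n)) (fun y => toC f y * twist x y) x.
- by move=> n; apply: rate_gt0 => //; exact: inv_seq_gt0.
- by apply: rateV_cvg => //; exact: inv_seq_cvg.
- under eq_fun do rewrite mulrA mulrC.
  apply: (@Cintegrable_bM _ _ _ _ _ _ 1); first exact: Cmeasurable_twist_r.
    by move=> t; rewrite cnorm_twist.
  have h0 : 0 < 1 / 2 :> R by rewrite divr_gt0.
  apply: (@le_Cintegrable _ _ _ _ _ (fun t => expR (1 * sqnorm x) * `|damp (1 / 2) f (rv t)|)).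
  + apply: CmeasurableM; last exact: CmeasurableR.
    by apply: CmeasurableR; exact: measurable_gauss_shift.
  + by apply: EFin_integrableZ; exact: integrable_norm (fi _ h0).1.
  + move=> t; rewrite cnormM !cnormR (ger0_norm (gauss_ge0 _ _)) /damp normrM.
    rewrite (ger0_norm (gauss_ge0 _ _)) mulrA ler_wpM2r//.
    exact: gauss_shift_le.
- by apply: CmeasurableM; [exact: CmeasurableR|exact: Cmeasurable_twist_r].
- apply: ccontinuousM; first by apply: ccontinuousR; exact: cf.
  exact: ccontinuous_twist_r.
by rewrite twistxx mulr1 in C.
Qed.

Lemma weighted_gauss_half_le (a : R) x : 0 < a ->
  (1 + sqnorm x) * gauss a x <= (1 + (a / 2)^-1) * gauss (a / 2) x.
Proof.
move=> a0; have -> : gauss a x = gauss (a / 2) x * gauss (a / 2) x by rewrite -gaussD -splitr.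
by rewrite mulrA ler_wpM2r ?gauss_ge0// weighted_gauss_le// divr_gt0.
Qed.

(** As the damping is removed, the pairing converges by domination, half of the Gaussian cutoff
    absorbing the growth [1 + sqnorm x]; the square norms pass to the limit only through Fatou. The
    identity for damped functions therefore becomes one inequality. The opposite bound compares the
    damped functions with [f] in L2. *)
Lemma regular_square_pairing f q s : regular_square f q -> 0 < s ->
  [/\ Cintegrable mu (fun t => q (rv t) * cutoff s (rv t)),
      complex.Im (integralRn (fun x => q x * cutoff s x)) = 0,
      Rintegrable mu (fun t => cnorm (smooth s (toC f) (rv t)) ^+ 2),
      \int[mu]_t cnorm (smooth s (toC f) (rv t)) ^+ 2 <=
        complex.Re (integralRn (fun x => q x * cutoff s x)) &
      Rintegrable mu (fun t => f (rv t) ^+ 2) ->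
      complex.Re (integralRn (fun x => q x * cutoff s x)) <= \int[mu]_t f (rv t) ^+ 2].
Proof.
move=> rf s0; have [fi cf [C C0 fC] fq] := rf.
have B0 := rate2_gt0 theta s0.
have B20 : 0 < rate2 theta s / 2 by rewrite divr_gt0.
have id n := fi _ (inv_seq_gt0 n).
have mcut : Cmeasurable (cutoff s \o rv).
  apply: CmeasurableM; first exact: Cmeasurable_cst.
  by apply: integrableRn_measurable; exact: integrableRn_gaussC.
have [I L] := @Cintegral_dct _ _ _ mu
  (fun n t => star_square (inv_seq n) f (rv t) * cutoff s (rv t))
  (fun t => q (rv t) * cutoff s (rv t))
  (fun t => C * (1 + (rate2 theta s / 2)^-1) * gauss (rate2 theta s / 2) (rv t))
  (fun n => CmeasurableM (Cmeasurable_star theta (id n) (id n)) mcut)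
  (EFin_integrableZ _ (gauss_integrable m B20).1)
  (fun n t => ltac:(
    rewrite cnormM; apply: (le_trans (ler_pM (cnorm_ge0 _) (cnorm_ge0 _)
      (fC _ (rv t) (inv_seq_gt0 n) (inv_seq_le1 n)) (cnorm_cutoff_le (rv t) s0)));
    by rewrite -[leLHS]mulrA -[leRHS]mulrA ler_wpM2l// weighted_gauss_half_le))
  (fun t => ccvgM (fq _ inv_seq_gt0 inv_seq_cvg (rv t)) (ccvg_cst _)).
have P n := integral_star_square_gauss theta0 s0 (id n).
have {}L : ccvg (fun n => (\int[mu]_t cnorm (star (toC (damp (inv_seq n) f)) (gaussC s) (rv t)) ^+ 2)%:C)
    (integralRn (fun x => q x * cutoff s x)).
  by have := L; congr ccvg; apply/funext => n; exact: (P n).2.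
split => //.
- exact: (cvg_unique _ L.2 (cvg_cst _)).
- have [] // := @Rintegral_fatou _ _ _ mu
   (fun n t => cnorm (star (toC (damp (inv_seq n) f)) (gaussC s) (rv t)) ^+ 2)
   (fun t => cnorm (smooth s (toC f) (rv t)) ^+ 2) _ _
   (fun n => (P n).1) (fun n t => sqr_ge0 _) (fun n => lexx _) L.1.
  by move=> t; apply: cvg_cnorm_sqr; exact: smooth_damp_cvg rf s0.
- have [] // := @Rintegral_fatou _ _ _ mu
   (fun n t => cnorm (star (toC (damp (inv_seq n) f)) (gaussC s) (rv t)) ^+ 2)
   (fun t => cnorm (smooth s (toC f) (rv t)) ^+ 2) _ _
   (fun n => (P n).1) (fun n t => sqr_ge0 _) (fun n => lexx _) L.1.
  by move=> t; apply: cvg_cnorm_sqr; exact: smooth_damp_cvg rf s0.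
- move=> f2i; rewrite -(cvg_lim (@Rhausdorff R) L.1); apply: limr_le; first exact: cvgP L.1.
  have D n t : damp (inv_seq n) f (rv t) ^+ 2 <= f (rv t) ^+ 2.
    rewrite -[leLHS]real_normK ?num_real// -[leRHS]real_normK ?num_real//.
    by rewrite lerXn2r ?nnegrE// damp_le// ltW// inv_seq_gt0.
  have d2 n : Rintegrable mu (fun t => damp (inv_seq n) f (rv t) ^+ 2).
    apply: (le_EFin_integrable _ f2i).
      by apply: measurable_funX; exact: integrable_measurable (id n).1.
    by move=> t; rewrite ger0_norm ?sqr_ge0// D.
  apply: nearW => n; apply: (le_trans (smooth_contraction theta0 s0 (id n) (d2 n))).
  by apply: le_Rintegral => // t _; exact: D.
Qed.

(** Stated for a finite family because only the sum of the squares is known to be integrable. The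
    square norms are nonnegative, so Fatou applied to their sum makes every [f i] square
    integrable. *)
Lemma regular_square_trace (I : finType) (f : I -> V -> R) (q : I -> V -> R[i]) :
  (forall i, regular_square (f i) (q i)) ->
  integrableRn (fun x => \sum_i q i x) ->
  (forall i, Rintegrable mu (fun t => f i (rv t) ^+ 2)) /\
  integralRn (fun x => \sum_i q i x) = (\int[mu]_t \sum_i f i (rv t) ^+ 2)%:C.
Proof.
move=> rf hi; pose h x := \sum_i q i x.
have P n i := regular_square_pairing (rf i) (inv_seq_gt0 n).
pose b n := integralRn (fun x => h x * cutoff (inv_seq n) x).
have bE n : b n = \sum_i integralRn (fun x => q i x * cutoff (inv_seq n) x).
  rewrite /integralRn -Cintegral_sum; last by move=> i _; have [] := P n i.
  by congr Cintegral; apply/funext => t /=; rewrite mulr_suml.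
have ReS (J : finType) (z : J -> R[i]) : complex.Re (\sum_i z i) = \sum_i complex.Re (z i).
  by elim/big_ind2 : _ => // x1 x2 y1 y2 <- <-; rewrite ReD.
have ImS (J : finType) (z : J -> R[i]) : complex.Im (\sum_i z i) = \sum_i complex.Im (z i).
  by elim/big_ind2 : _ => // x1 x2 y1 y2 <- <-; rewrite ImD.
have bcvg : ccvg b (integralRn h).
  have [] // := @Cintegral_dct _ _ _ mu (fun n t => h (rv t) * cutoff (inv_seq n) (rv t))
    (h \o rv) (fun t => cnorm (h (rv t))).
  - move=> n; apply: CmeasurableM; first exact: integrableRn_measurable.
    apply: CmeasurableM; first exact: Cmeasurable_cst.
    by apply: integrableRn_measurable; apply: integrableRn_gaussC; exact: rate2_gt0 (inv_seq_gt0 n).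
  - exact: Cintegrable_cnorm hi.
  - move=> n t; rewrite cnormM ler_piMr ?cnorm_ge0//.
    rewrite (le_trans (cnorm_cutoff_le _ (inv_seq_gt0 n)))// gauss_le1//.
    exact: ltW (rate2_gt0 theta (inv_seq_gt0 n)).
  - move=> t; rewrite -[X in ccvg _ X]mulr1; apply: ccvgM; first exact: ccvg_cst.
    exact: cutoff_cvg inv_seq_gt0 inv_seq_cvg.
have [F1 F2] := @Rintegral_fatou _ _ _ mu
  (fun n t => \sum_i cnorm (smooth (inv_seq n) (toC (f i)) (rv t)) ^+ 2)
  (fun t => \sum_i f i (rv t) ^+ 2) (fun n => complex.Re (b n)) (complex.Re (integralRn h))
  (fun n => ltac:(by apply: EFin_integrable_sum => i _; have [] := P n i))
  (fun n t => ltac:(by apply: sumr_ge0 => i _; exact: sqr_ge0))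
  (fun n => ltac:(
    rewrite Rintegral_sumE; [|by move=> i _; have [] := P n i];
    by rewrite bE ReS; apply: ler_sum => i _; have [] := P n i))
  bcvg.1
  (fun t => ltac:(
    apply: (@cvg_big _ _ _ _ _ (@add_continuous R) _ \oo) => i _;
    have := cvg_cnorm_sqr (smooth_cvg (rv t) (rf i)); rewrite cnormR real_normK ?num_real//)).
have fi i : Rintegrable mu (fun t => f i (rv t) ^+ 2).
  apply: (le_EFin_integrable _ F1).
    apply: measurable_funX; have [? ? _ _] := rf i; exact: continuous_measurable.
  move=> t; rewrite ger0_norm ?sqr_ge0// (bigD1 i)//= lerDl.
  by apply: sumr_ge0 => j _; exact: sqr_ge0.
split => //; apply: complexP => /=.
  (* Square integrability of each [f i] gives access to the upper bound of [regular_square_pairing],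
     which holds for every cutoff and passes to the limit. *)
  apply/eqP; rewrite eq_le F2 andbT.
  rewrite -[leLHS](cvg_lim (@Rhausdorff R) bcvg.1); apply: limr_le; first exact: cvgP bcvg.1.
  apply: nearW => n; rewrite bE ReS Rintegral_sumE; last by move=> i _.
  by apply: ler_sum => i _; have [_ _ _ _ H] := P n i; exact: H.
have b0 : (fun n => complex.Im (b n)) = (fun=> 0).
  by apply/funext => n; rewrite bE ImS big1// => i _; have [] := P n i.
have H := bcvg.2; rewrite b0 in H.
exact: (cvg_unique _ H (cvg_cst _)).
Qed.

End regular_square_trace.

(** * The two actions *)

Section super_algebra.
Context (R : realType) (k : nat) (theta alpha : R).
Local Notation m := (k + k)%N.
Local Notation V := ('rV[R]_m).
Local Notation cnorm := (@Normc.normc R).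
Local Notation "r %:C" := (real_complex R r).
Local Notation star := (star theta).
Local Notation xt := (xtilde theta).
Local Notation ii := (Complex 0 1 : R[i]).
Implicit Types (x y z : V) (f g : V -> R[i]) (phi : V -> R) (i : 'I_m).

Lemma moyal0l g : moyal theta 0 g = 0.
Proof.
apply/funext => x; apply: moyal_cvg => u _ _.
have E n : moyal_reg theta (u n) 0 g x = 0.
  rewrite /moyal_reg (_ : (fun p => _) = (fun=> 0%:C)).
    by rewrite CintegralR Rintegral_cst// mul0r mulr0.
  by apply/funext => p /=; rewrite !mul0r mulr0.
by under [X in ccvg X _]eq_fun do rewrite E; exact: ccvg_cst.
Qed.

Lemma moyal0r f : moyal theta f 0 = 0.
Proof.
apply/funext => x; apply: moyal_cvg => u _ _.
have E n : moyal_reg theta (u n) f 0 x = 0.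
  rewrite /moyal_reg (_ : (fun p => _) = (fun=> 0%:C)).
    by rewrite CintegralR Rintegral_cst// mul0r mulr0.
  by apply/funext => p /=; rewrite mulr0 mul0r mulr0.
by under [X in ccvg X _]eq_fun do rewrite E; exact: ccvg_cst.
Qed.

Definition odd_weight : R := alpha * theta / (1 + alpha) ^+ 2.

(** The mixed brackets have no even part. The sign rule for two odd arguments turns their commutator
    into an anticommutator, the source of the harmonic term. *)
Lemma super_comm_even (f g : superfun R k) x :
  (super_comm theta alpha f g).1 x =
  moyal theta f.1 g.1 x - moyal theta g.1 f.1 x +
  Complex 0 odd_weight * (moyal theta f.2 g.2 x + moyal theta g.2 f.2 x).
Proof.
rewrite /super_comm /super_hcomm /super_star /super_even /super_odd /= !moyal0l !moyal0r.
have E (A B C D : V -> R[i]) (c e e' : R[i]) :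
  (A + c *: 0 - e *: (B + c *: 0) + (0 + c *: 0 - e *: (0 + c *: 0)) +
   (0 + c *: 0 - e *: (0 + c *: 0)) + (0 + c *: C - e' *: (0 + c *: D))) x =
  A x + c * 0 - e * (B x + c * 0) + (0 + c * 0 - e * (0 + c * 0)) +
   (0 + c * 0 - e * (0 + c * 0)) + (0 + c * C x - e' * (0 + c * D x)) by [].
rewrite E expr0 expr1 -/odd_weight.
move: (moyal _ _ _ x) (moyal _ _ _ x) (moyal _ _ _ x) (moyal _ _ _ x) (Complex 0 _) => A B C D c.
ring.
Qed.

Lemma super_star_even (f g : superfun R k) x :
  (super_star theta alpha f g).1 x =
  moyal theta f.1 g.1 x + Complex 0 odd_weight * moyal theta f.2 g.2 x.
Proof. by []. Qed.

(** The scalars are extracted before the limit, from the regularised products, where linearity is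
    that of an absolutely convergent integral. *)
Lemma moyal_xtilde_l (z w : R[i]) i phi x : theta != 0 -> D_L1 phi ->
  moyal theta (fun y => z * (xt i y)%:C) (fun y => w * (phi y)%:C) x =
  z * w * ((xt i x)%:C * (phi x)%:C + ii * (partial i phi x)%:C).
Proof.
move=> theta0 Dphi; apply: moyal_cvg => u u0 uc.
have E n : moyal_reg theta (u n) (fun y => z * (xt i y)%:C) (fun y => w * (phi y)%:C) x =
    z * w * moyal_reg theta (u n) (toC (xt i)) (toC phi) x.
  rewrite !moyal_regE -starZ.
  - by apply: (congr2 (fun p q => star p q x)); apply/funext => y; exact: mulrCA.
  - by have := integrableRn_xtilde_gauss theta i (u0 n); congr integrableRn; apply/funext => y; rewrite mulrC.
  - by have := integrableRn_damp Dphi (u0 n); congr integrableRn; apply/funext => y; rewrite /toC -mulrzC.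
under [X in ccvg X _]eq_fun do rewrite E.
by apply: ccvgZ; exact: moyal_reg_xtilde_l_cvg.
Qed.

Lemma moyal_xtilde_r (z w : R[i]) i phi x : theta != 0 -> D_L1 phi ->
  moyal theta (fun y => w * (phi y)%:C) (fun y => z * (xt i y)%:C) x =
  w * z * ((xt i x)%:C * (phi x)%:C - ii * (partial i phi x)%:C).
Proof.
move=> theta0 Dphi; apply: moyal_cvg => u u0 uc.
have E n : moyal_reg theta (u n) (fun y => w * (phi y)%:C) (fun y => z * (xt i y)%:C) x =
    w * z * moyal_reg theta (u n) (toC phi) (toC (xt i)) x.
  rewrite !moyal_regE -starZ.
  - by apply: (congr2 (fun p q => star p q x)); apply/funext => y; exact: mulrCA.
  - by have := integrableRn_damp Dphi (u0 n); congr integrableRn; apply/funext => y; rewrite /toC -mulrzC.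
  - by have := integrableRn_xtilde_gauss theta i (u0 n); congr integrableRn; apply/funext => y; rewrite mulrC.
under [X in ccvg X _]eq_fun do rewrite E.
by apply: ccvgZ; exact: moyal_reg_xtilde_r_cvg.
Qed.

Lemma super_mul_const (f : V -> R) (a b : R) :
  super_mul (even_fun (toC f)) (superconst k a b) =
  (fun y => a%:C * (f y)%:C, fun y => b%:C * (f y)%:C).
Proof.
rewrite /super_mul /even_fun /superconst /=; congr pair; apply/funext => y.
  by rewrite [LHS]mulrC.
by rewrite mul0r addr0 [LHS]mulrC.
Qed.

(** Since [xi^2 = 0], the even part of the square modulus sees only the even part of its argument;
    so the odd components of the commutators never have to be computed. *)
Lemma super_abs2_even (f : superfun R k) x :
  (super_abs2 f).1 x = (cnorm (f.1 x) ^+ 2)%:C.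
Proof. by rewrite -mulcJ mulrC. Qed.

Lemma super_comm_xtilde (b : R) i phi x : theta != 0 -> D_L1 phi ->
  (super_comm theta alpha
     (Complex 0 (- 1 / 2) *: super_mul (even_fun (toC (xt i))) (superconst k 1 b))
     (super_mul (even_fun (toC phi)) (superconst k 1 b))).1 x =
  (partial i phi x + b ^+ 2 * odd_weight * (xt i x * phi x))%:C.
Proof.
move=> theta0 Dphi.
have -> : Complex 0 (- 1 / 2) *: super_mul (even_fun (toC (xt i))) (superconst k 1 b) =
  (fun y => Complex 0 (- 1 / 2) * 1%:C * (xt i y)%:C,
   fun y => Complex 0 (- 1 / 2) * b%:C * (xt i y)%:C) :> superfun R k.
  by rewrite super_mul_const; congr pair; apply/funext => y; rewrite -[RHS]mulrA.
rewrite super_mul_const super_comm_even /=.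
rewrite !moyal_xtilde_l// !moyal_xtilde_r//.
move: (xt i x) (phi x) (partial i phi x) odd_weight => X P D w.
by apply: complexP => /=; field.
Qed.

Lemma super_star_square (b : R) phi x : theta != 0 -> integrableRn (toC phi) ->
  (super_star theta alpha
     (super_mul (even_fun (toC phi)) (superconst k 1 b))
     (super_mul (even_fun (toC phi)) (superconst k 1 b))).1 x =
  Complex 1 (b ^+ 2 * odd_weight) * star (toC phi) (toC phi) x.
Proof.
move=> theta0 fi; rewrite super_mul_const super_star_even /=.
have ci (z : R[i]) : integrableRn (fun y => z * (phi y)%:C) by exact: CintegrableZ.
rewrite !moyal_star// !(starZ theta _ _ x fi fi).
move: (star _ _ x) odd_weight => P w; rewrite mulrA -mulrDl; congr (_ * _).
by apply: complexP => /=; ring.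
Qed.

Lemma super_density_even (b M lambda : R) phi x : theta != 0 -> D_L1 phi ->
  (super_density theta alpha (superconst k 1 b) M lambda phi).1 x =
  (\sum_i (partial i phi x + b ^+ 2 * odd_weight * (xt i x * phi x)) ^+ 2 / 2
   + M ^+ 2 / 2 * phi x ^+ 2
   + lambda * (1 + (b ^+ 2 * odd_weight) ^+ 2) * cnorm (star (toC phi) (toC phi) x) ^+ 2)%:C.
Proof.
move=> theta0 Dphi.
have fi := D_L1_integrableRn Dphi.
rewrite /super_density.
have sumE (F : 'I_m -> superfun R k) : (\sum_i F i).1 x = \sum_i (F i).1 x.
  by elim/big_rec2 : _ => // i y1 y2 _ <-.
have E (a c l : R[i]) (X Y Z : superfun R k) :
  (a *: X + c *: Y + l *: Z).1 x = a * X.1 x + c * Y.1 x + l * Z.1 x by [].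
rewrite E sumE !super_abs2_even.
have E1 : cnorm ((super_mul (even_fun (toC phi)) (superconst k 1 b)).1 x) ^+ 2 = phi x ^+ 2.
  by rewrite super_mul_const cnormM !cnormR normr1 mul1r real_normK ?num_real.
rewrite E1 super_star_square// cnormM exprMn (cnorm_sqr (Complex _ _)).
have E2 i : (super_abs2 (super_comm theta alpha
     (Complex 0 (- 1 / 2) *: super_mul (even_fun (toC (xt i))) (superconst k 1 b))
     (super_mul (even_fun (toC phi)) (superconst k 1 b)))).1 x =
    ((partial i phi x + b ^+ 2 * odd_weight * (xt i x * phi x)) ^+ 2)%:C.
  by rewrite super_abs2_even super_comm_xtilde// cnormR real_normK ?num_real.
under eq_bigr do rewrite E2.
move: (cnorm _) odd_weight => P w.
rewrite -rmorph_sum -!mulrzC -!rmorphD; apply: (congr1 (real_complex R)).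
rewrite mulr_sumr mulrA [complex.Re _]/(1) expr1n; congr (_ + _ + _).
  by apply: eq_bigr => i _; field.
exact: mulrA.
Qed.

End super_algebra.

(** * The quartic term and the cross terms *)

Section harmonic_action.
Context (R : realType) (k : nat) (theta : R) (theta0 : theta != 0).
Local Notation m := (k + k)%N.
Local Notation RR := (measurableTypeR R).
Local Notation V := ('rV[R]_m).
Local Notation T := (m.-tuple RR).
Local Notation mu := (lebesgue_tuple R m).
Local Notation rv := (@rv_of_tuple R m).
Local Notation cnorm := (@Normc.normc R).
Local Notation "r %:C" := (real_complex R r).
Local Notation star := (star theta).
Local Notation xt := (xtilde theta).
Variables (phi : V -> R) (Dphi : D_L1 phi).
Implicit Types (x y z : V) (i : 'I_m).

Let fi : integrableRn (toC phi) := D_L1_integrableRn Dphi.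

Lemma integrableRn_star_D_L1 (f : V -> R[i]) : integrableRn f -> integrableRn (star f (toC phi)).
Proof. by move=> f_int; have [] := decaying_integrable theta0 f_int fi (D_L1_decaying theta Dphi). Qed.

Lemma moyal_D_L1 (f : V -> R[i]) : integrableRn f ->
  moyal theta f (toC phi) = star f (toC phi).
Proof. by move=> f_int; apply/funext => x; exact: moyal_star. Qed.

Definition quartic : V -> R[i] := star (star (star (toC phi) (toC phi)) (toC phi)) (toC phi).

Lemma harmonic_densityE (Omega M lambda : R) x :
  harmonic_density theta Omega M lambda phi x =
  \sum_i (1 / 2)%:C * star (toC (partial i phi)) (toC (partial i phi)) x +
  \sum_i (Omega ^+ 2 / 2)%:C * xtilde_square theta phi i x +
  (M ^+ 2 / 2)%:C * star (toC phi) (toC phi) x + lambda%:C * quartic x.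
Proof.
have i2 := integrableRn_star_D_L1 fi; have i3 := integrableRn_star_D_L1 i2.
rewrite /harmonic_density (moyal_D_L1 fi) (moyal_D_L1 i2) (moyal_D_L1 i3).
have sumE (F : 'I_m -> V -> R[i]) : (\sum_i F i) x = \sum_i F i x.
  by elim/big_rec2 : _ => // i y1 y2 _ <-.
have E (F G : 'I_m -> V -> R[i]) (F' G' : 'I_m -> R[i]) (C D : V -> R[i]) (c l : R[i]) :
    (forall i, F i x = F' i) -> (forall i, G i x = G' i) ->
    (\sum_i F i + \sum_i G i + c *: C + l *: D) x =
    \sum_i F' i + \sum_i G' i + c * C x + l * D x.
  move=> FF' GG'; rewrite -(eq_bigr _ (fun i _ => FF' i)) -(eq_bigr _ (fun i _ => GG' i)).
  by rewrite -!sumE.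
have E1 i : ((1 / 2)%:C *: moyal theta (toC (partial i phi)) (toC (partial i phi))) x =
    (1 / 2)%:C * star (toC (partial i phi)) (toC (partial i phi)) x.
  have di := D_L1_integrableRn (D_L1_partial i Dphi).
  by rewrite -(moyal_star theta x di di).
have E2 i : ((Omega ^+ 2 / 2)%:C *: moyal theta (toC (xt i) * toC phi) (toC (xt i) * toC phi)) x =
    (Omega ^+ 2 / 2)%:C * xtilde_square theta phi i x.
  rewrite -(moyal_regular_square x (xtilde_regular_square theta Dphi i)).
  have -> : toC (xt i) * toC phi = toC (fun x => xt i x * phi x) :> (V -> R[i]).
    by apply/funext => y; rewrite /toC mulrzC.
  by [].
exact: E E1 E2.
Qed.

Lemma D_L1_bounded : exists2 C, 0 <= C & forall x, cnorm (toC phi x) <= C.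
Proof.
apply: (decaying_bounded theta0 fi); last exact: D_L1_decaying.
by move=> x; apply: ccontinuousR; exact: D_L1_continuous.
Qed.

(** Conjugation reverses the factors, so the star square of a real function is real. *)
Lemma star_square_real x : star (toC phi) (toC phi) x * star (toC phi) (toC phi) x =
  (cnorm (star (toC phi) (toC phi) x) ^+ 2)%:C.
Proof. by rewrite -mulcJ (starJ theta x fi fi) conjc_toC. Qed.

(** Let [P] be the star square of [phi]. The trace property removes the outermost star of the
    left-nested product, and [integral_star_mul] then moves one [phi] from [star P phi] to the other
    side, leaving the pointwise square of [P]. *)
Lemma integral_quartic :
  Rintegrable mu (fun t => cnorm (star (toC phi) (toC phi) (rv t)) ^+ 2) /\
  integralRn quartic = (\int[mu]_t cnorm (star (toC phi) (toC phi) (rv t)) ^+ 2)%:C.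
Proof.
pose P := star (toC phi) (toC phi).
have Pi : integrableRn P by exact: integrableRn_star_D_L1.
have Ppi : integrableRn (star P (toC phi)) by exact: integrableRn_star_D_L1.
have I : Cintegrable mu (fun t => (cnorm (P (rv t)) ^+ 2)%:C).
  under eq_fun do rewrite -star_square_real.
  apply: (@Cintegrable_bM _ _ _ _ (P \o rv) (P \o rv)
    (`|moyal_cst k theta| * (\int[mu]_t cnorm (toC phi (rv t)) * \int[mu]_t cnorm (toC phi (rv t))))) => //.
  - exact: integrableRn_measurable.
  - by move=> t; exact: cnorm_star_le.
split; first exact: I.1.
have [C C0 phiC] := D_L1_bounded.
rewrite /quartic (integral_star theta0 Ppi fi); last first.
- by exists C.
- by move=> x; apply: ccontinuousR; exact: D_L1_continuous.
- exact: integrableRn_star_D_L1.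
rewrite (integral_star_mul theta Pi fi fi) -CintegralR.
by congr Cintegral; apply/funext => t; exact: star_square_real.
Qed.

Lemma integral_cross (kappa : R) i :
  Rintegrable mu (fun t => (kappa * (xt i (rv t) * phi (rv t))) ^+ 2) ->
  Rintegrable mu (fun t => partial i phi (rv t) ^+ 2) ->
  Rintegrable mu (fun t => kappa * (xt i (rv t) * phi (rv t)) * partial i phi (rv t)) /\
  \int[mu]_t (kappa * (xt i (rv t) * phi (rv t)) * partial i phi (rv t)) = 0.
Proof.
move=> xi di.
have mphi : measurable_fun setT (phi \o rv) := integrable_measurable fi.1.
have mdphi : measurable_fun setT (partial i phi \o rv).
  exact: integrable_measurable (D_L1_integrable (D_L1_partial i Dphi)).
have mx : measurable_fun setT (xt i \o rv) by exact: measurable_xtilde.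
have mF : measurable_fun setT (fun t => kappa * (xt i (rv t) * phi (rv t))).
  by apply: measurable_funM => //; exact: measurable_funM.
have prod (f g : T -> R) : measurable_fun setT f -> measurable_fun setT g ->
    Rintegrable mu (fun t => f t ^+ 2) -> Rintegrable mu (fun t => g t ^+ 2) ->
    Rintegrable mu (fun t => f t * g t).
  move=> mf mg if2 ig2.
  apply: (@le_EFin_integrable _ _ _ _ _ (fun t => f t ^+ 2 + g t ^+ 2)).
  - exact: measurable_funM.
  - exact: EFin_integrableD.
  - move=> t; rewrite normrM -(real_normK (num_real (f t))) -(real_normK (num_real (g t))).
    have := normr_ge0 (f t); have := normr_ge0 (g t).
    by have := sqr_ge0 (`|f t| - `|g t|); nra.
(* An integrable bounded function is square integrable. This is what makes the primitive [G] below
   integrable, as a product of two square-integrable functions. *)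
have phi2 : Rintegrable mu (fun t => phi (rv t) ^+ 2).
  have [C C0 phiC] := D_L1_bounded.
  apply: (@le_EFin_integrable _ _ _ _ _ (fun t => C * `|phi (rv t)|)).
  - exact: measurable_funX.
  - by apply: EFin_integrableZ; exact: (integrable_norm fi.1).
  - by move=> t; rewrite normrX expr2 ler_wpM2r// -cnormR; exact: phiC.
have I1 := prod _ _ mF mdphi xi di.
split => //.
have hx : has_partial i (xt i) (fun=> 0).
  by apply: has_partial_affine => y s; rewrite xtilde_shift mulr0 addr0.
have hphi := D_L1_has_partial i Dphi.
have hk : has_partial i (fun _ : V => kappa / 2) (fun=> 0).
  by apply: has_partial_affine => y s; rewrite mulr0 addr0.
have hG := has_partialM (has_partialM hk hx) (has_partialM hphi hphi).
(* A primitive of the cross term along the axis [i], on which [xtilde i] is constant. *)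
pose G x := kappa / 2 * xt i x * (phi x * phi x).
pose G' x := kappa * (xt i x * phi x) * partial i phi x.
have {}hG : has_partial i G G'.
  by move: hG; congr has_partial; apply/funext => x; rewrite /G'; field.
have cG' : line_continuous i G'.
  have lx := has_partial_line_continuous hx; have lphi := has_partial_line_continuous hphi.
  apply: line_continuousM; last first.
    by apply: line_continuous_continuous; exact: D_L1_continuous (D_L1_partial i Dphi).
  by apply: line_continuousM; [exact: line_continuous_cst|exact: line_continuousM].
have iG : Rintegrable mu (G \o rv).
  have := EFin_integrableZ 2^-1 (prod _ _ mF mphi xi phi2).
  by congr (_.-integrable _ _); apply/funext => t /=; congr EFin; rewrite /G; field.
exact: (integral_partial0 hG cG' iG I1).
Qed.

End harmonic_action.

(** * Equality of the two actions *)

Section action_identity.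
Context (R : realType) (k : nat) (theta : R) (theta0 : theta != 0).
Local Notation m := (k + k)%N.
Local Notation RR := (measurableTypeR R).
Local Notation V := ('rV[R]_m).
Local Notation T := (m.-tuple RR).
Local Notation mu := (lebesgue_tuple R m).
Local Notation rv := (@rv_of_tuple R m).
Local Notation cnorm := (@Normc.normc R).
Local Notation "r %:C" := (real_complex R r).
Local Notation star := (star theta).
Local Notation xt := (xtilde theta).
Variables (phi : V -> R) (Dphi : D_L1 phi).
Implicit Types (x y z : V) (i : 'I_m).

(* The quadratic part of the action is a sum of Moyal squares of real functions. *)
Definition quadratic_term (kappa M : R) (j : 'I_m + 'I_m + 'I_1) : V -> R :=
  match j with
  | inl (inl i) => fun x => Num.sqrt 2^-1 * partial i phi x
  | inl (inr i) => fun x => Num.sqrt 2^-1 * kappa * (xt i x * phi x)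
  | inr _ => fun x => Num.sqrt 2^-1 * M * phi x
  end.

Definition quadratic_square (kappa M : R) (j : 'I_m + 'I_m + 'I_1) : V -> R[i] :=
  match j with
  | inl (inl i) => fun x => (Num.sqrt 2^-1 ^+ 2)%:C * star (toC (partial i phi)) (toC (partial i phi)) x
  | inl (inr i) => fun x => ((Num.sqrt 2^-1 * kappa) ^+ 2)%:C * xtilde_square theta phi i x
  | inr _ => fun x => ((Num.sqrt 2^-1 * M) ^+ 2)%:C * star (toC phi) (toC phi) x
  end.

Lemma sqr_sqrt_half : Num.sqrt 2^-1 ^+ 2 = 2^-1 :> R.
Proof. by rewrite sqr_sqrtr// invr_ge0. Qed.

Lemma quadratic_regular kappa M j :
  regular_square theta (quadratic_term kappa M j) (quadratic_square kappa M j).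
Proof.
case: j => [[i|i]|i] /=; apply: regular_squareZ.
- exact: D_L1_regular_square (D_L1_partial i Dphi).
- exact: xtilde_regular_square.
- exact: D_L1_regular_square.
Qed.

Lemma sum_quadratic_square kappa Omega M x : kappa ^+ 2 = Omega ^+ 2 ->
  \sum_j quadratic_square kappa M j x =
  \sum_i (1 / 2)%:C * star (toC (partial i phi)) (toC (partial i phi)) x +
  \sum_i (Omega ^+ 2 / 2)%:C * xtilde_square theta phi i x +
  (M ^+ 2 / 2)%:C * star (toC phi) (toC phi) x.
Proof.
move=> kO; rewrite !big_sumType big_ord1 /= !exprMn !sqr_sqrt_half kO mul1r.
by rewrite ![2^-1 * _]mulrC.
Qed.

Lemma sum_quadratic_term kappa M x :
  \sum_j quadratic_term kappa M j x ^+ 2 =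
  \sum_i (partial i phi x ^+ 2 / 2 + (kappa * (xt i x * phi x)) ^+ 2 / 2) + M ^+ 2 / 2 * phi x ^+ 2.
Proof.
rewrite !big_sumType big_ord1 /= big_split /=; congr (_ + _ + _).
- by apply: eq_bigr => i _; rewrite exprMn sqr_sqrt_half mulrC.
- by apply: eq_bigr => i _; rewrite !exprMn sqr_sqrt_half; ring.
- by rewrite !exprMn sqr_sqrt_half; ring.
Qed.

Lemma action_identity (alpha Omega M lambda b : R) :
  (b ^+ 2 * odd_weight theta alpha) ^+ 2 = Omega ^+ 2 ->
  integrableRn (harmonic_density theta Omega M lambda phi) ->
  integrableRn (super_density theta alpha (superconst k 1 b) M (lambda / (1 + Omega ^+ 2)) phi).1 /\
  harmonic_action theta Omega M lambda phi =
  supertrace (super_density theta alpha (superconst k 1 b) M (lambda / (1 + Omega ^+ 2)) phi).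
Proof.
set kappa := b ^+ 2 * _ => kO hi.
pose h x := \sum_j quadratic_square kappa M j x.
pose W x := cnorm (star (toC phi) (toC phi) x) ^+ 2.
pose S x := \sum_j quadratic_term kappa M j x ^+ 2.
pose X i x := kappa * (xt i x * phi x) * partial i phi x.
have [iW JQ] := integral_quartic theta0 Dphi.
have iQ : integrableRn (quartic theta phi).
  by do 3 apply: integrableRn_star_D_L1 => //; exact: D_L1_integrableRn.
have hE x : harmonic_density theta Omega M lambda phi x = h x + lambda%:C * quartic theta phi x.
  by rewrite harmonic_densityE// /h (sum_quadratic_square M x kO).
(* The quartic part is integrable for every [phi] in [D_L1], so integrability of the density passes
   to its quadratic part. *)
have ih : integrableRn h.
  have := CintegrableD hi (CintegrableZ (- lambda%:C) iQ); congr Cintegrable.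
  by apply/funext => t /=; rewrite hE mulNr addrK.
have [if2 Jh] := regular_square_trace theta0 (quadratic_regular kappa M) ih.
have c20 : Num.sqrt 2^-1 != 0 :> R by rewrite lt0r_neq0// sqrtr_gt0 invr_gt0.
(* Only the factor [sqrt (1/2)] is divided out; [kappa] is kept, as it vanishes when [Omega = 0]. *)
have unscale (f : T -> R) : Rintegrable mu (fun t => (Num.sqrt 2^-1 * f t) ^+ 2) ->
    Rintegrable mu (fun t => f t ^+ 2).
  move=> /(EFin_integrableZ 2); congr (_.-integrable _ _); apply/funext => t /=.
  by congr EFin; rewrite exprMn sqr_sqrt_half mulrA divff ?mul1r.
have iX i : Rintegrable mu (fun t => X i (rv t)) /\ \int[mu]_t X i (rv t) = 0.
  apply: integral_cross => //.
    by apply: unscale; have := if2 (inl (inr i)); under eq_fun do rewrite /= -mulrA.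
  by apply: unscale; exact: (if2 (inl (inl i))).
have iS : Rintegrable mu (fun t => S (rv t)).
  by apply: EFin_integrable_sum => j _; exact: if2.
have iSX : Rintegrable mu (fun t => \sum_i X i (rv t)).
  by apply: EFin_integrable_sum => i _; exact: (iX i).1.
have dn : 1 + Omega ^+ 2 != 0 by rewrite lt0r_neq0// ltr_pwDl// sqr_ge0.
have sE x : (super_density theta alpha (superconst k 1 b) M (lambda / (1 + Omega ^+ 2)) phi).1 x =
    (S x + \sum_i X i x + lambda * W x)%:C.
  rewrite super_density_even// -/kappa kO divfK//; apply: (congr1 (real_complex R)).
  rewrite -/(W x); congr (_ + _).
  rewrite /S sum_quadratic_term addrAC -big_split /=; congr (_ + _).
  by apply: eq_bigr => i _; rewrite /X; field.
have iT : Rintegrable mu (fun t => S (rv t) + \sum_i X i (rv t) + lambda * W (rv t)).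
  by apply: EFin_integrableD; [exact: EFin_integrableD|exact: EFin_integrableZ].
split.
  by rewrite /integrableRn /comp; under eq_fun do rewrite sE; exact: CintegrableR.
rewrite /harmonic_action /supertrace /integralRn /comp.
under [in RHS]eq_fun do rewrite sE.
under [in LHS]eq_fun do rewrite hE.
rewrite CintegralR (CintegralD ih (CintegrableZ _ iQ)) (CintegralZ _ iQ).
have -> : Cintegral mu (fun t => h (rv t)) = (\int[mu]_t S (rv t))%:C by exact: Jh.
have -> : Cintegral mu (fun t => quartic theta phi (rv t)) = (\int[mu]_t W (rv t))%:C by exact: JQ.
rewrite -mulrzC -rmorphD; apply: (congr1 (real_complex R)).
rewrite RintegralD//; [|exact: EFin_integrableD|exact: EFin_integrableZ].
have X0 : \int[mu]_t \sum_i X i (rv t) = 0.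
  etransitivity; first exact: (@Rintegral_sumE _ _ _ mu _ _ (fun i t => X i (rv t)) (fun i _ => (iX i).1)).
  by rewrite big1// => i _; exact: (iX i).2.
rewrite (RintegralD _ iS iSX)// X0 addr0.
by rewrite RintegralZl.
Qed.

End action_identity.

Theorem proposition6p2 (R : realType) (k : nat) (a0 theta alpha : R)
  (ha0 : a0 != 0) (htheta : theta = 1 / a0)
  (halpha1 : alpha != -1) (halpha0 : alpha != 0)
  (Omega M lambda : R) :
  exists a b M' lambda' : R,
    forall phi : 'rV[R]_(k + k) -> R,
      D_L1 phi ->
      integrableRn (harmonic_density theta Omega M lambda phi) ->
      integrableRn
        (super_density theta alpha (superconst k a b) M' lambda' phi).1 /\
      harmonic_action theta Omega M lambda phi =
      supertrace (super_density theta alpha (superconst k a b) M' lambda' phi).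
Proof.
have theta0 : theta != 0 by rewrite htheta mul1r invr_eq0.
have w0 : odd_weight theta alpha != 0.
  rewrite /odd_weight !mulf_neq0// invr_eq0 expf_neq0//.
  by rewrite addrC -(opprK 1) subr_eq0.
(* This [b] gives [kappa = |Omega / w| w] with [w] the odd weight, which has the sign of [w] and
   square [Omega^2]; the absolute value makes the square root available whatever the signs of
   [Omega] and [w]. *)
exists 1, (Num.sqrt `|Omega / odd_weight theta alpha|), M, (lambda / (1 + Omega ^+ 2)).
move=> phi Dphi hi; apply: action_identity => //.
rewrite sqr_sqrtr// exprMn real_normK ?num_real// exprMn exprVn divfK//.
by rewrite expf_neq0.
Qed.
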